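(* Let $d\ge 2$ and let $w=(w_1,\dots,w_d)$ be a $d$-tuple of positive real numbers with $\sum_{i=1}^d w_i=1$ and $w_1\ge\cdots\ge w_d$. Let $\operatorname{Sing}(w)\subset\mathbb{R}^d$ be the set of $w$-singular vectors. Then $$\dim \operatorname{Sing}(w)\ \ge\ d-\frac{1}{1+w_1},$$ where $\dim$ is the Hausdorff dimension.
   Context: A vector $x=(x_1,\dots,x_d)\in\mathbb{R}^d$ is $w$-singular if for every $\epsilon>0$ there exists $T_0>1$ such that for all $T>T_0$ the system of inequalities $$\max_{1\le i\le d}|qx_i-p_i|^{1/w_i}<\frac{\epsilon}{T}\quad\text{and}\quad 0<q<T$$ has an integer solution $(p_1,\dots,p_d,q)\in\mathbb{Z}^d\times\mathbb{Z}$. *)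

(* Defs.v *)
From mathcomp Require Import all_boot all_order all_algebra.
From mathcomp Require Import all_classical all_reals all_analysis.

Set Implicit Arguments.
Unset Strict Implicit.
Unset Printing Implicit Defensive.

Import Order.TTheory GRing.Theory Num.Theory.
Import numFieldNormedType.Exports.

Local Open Scope classical_set_scope.
Local Open Scope ring_scope.

(* The canonical norm on 'rV[R]_d is the sup norm, hence the explicit formula. *)
Definition euclidean_dist (R : realType) (d : nat) (x y : 'rV[R]_d) : R :=
  Num.sqrt (\sum_(i < d) (x 0 i - y 0 i) ^+ 2).

(* diam set0 = -oo; every nonempty set has a diameter in [0, +oo]. *)
Definition diam (R : realType) (d : nat) (U : set 'rV[R]_d) : \bar R :=
  ereal_sup [set (euclidean_dist z.1 z.2)%:E | z in U `*` U].

(* diam(U)^s, with the usual conventions that the empty set contributes 0 and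
   that 0^0 = 1, so that the 0-dimensional measure is the counting measure. *)
Definition diam_pow (R : realType) (d : nat) (s : R) (U : set 'rV[R]_d)
    : \bar R :=
  if U == set0 then 0%E else poweR (diam U) s.

Definition delta_cover (R : realType) (d : nat) (delta : R)
    (A : set 'rV[R]_d) : set ((set 'rV[R]_d)^nat) :=
  [set U | A `<=` \bigcup_k U k /\ forall k, (diam (U k) <= delta%:E)%E].

Definition hausdorff_premeasure (R : realType) (d : nat) (s delta : R)
    (A : set 'rV[R]_d) : \bar R :=
  ereal_inf [set (\sum_(0 <= k <oo) diam_pow s (U k))%E
            | U in delta_cover delta A].

Definition hausdorff_measure (R : realType) (d : nat) (s : R)
    (A : set 'rV[R]_d) : \bar R :=
  ereal_sup [set hausdorff_premeasure s delta A
            | delta in [set delta : R | 0 < delta]].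

Definition hausdorff_dim (R : realType) (d : nat) (A : set 'rV[R]_d)
    : \bar R :=
  ereal_inf [set s%:E
            | s in [set s : R | 0 <= s /\ hausdorff_measure s A = 0%E]].

(* The terms of the maximum are nonnegative, so 0 is a neutral default. *)
Definition singular (R : realType) (d : nat) (w : 'I_d -> R) (x : 'rV[R]_d)
    : Prop :=
  forall eps : R, 0 < eps ->
  exists T0 : R, 1 < T0 /\
  forall T : R, T0 < T ->
  exists (p : 'I_d -> int) (q : int),
    \big[Num.max/(0 : R)]_(i < d) `|(q%:~R * x 0 i - (p i)%:~R : R)| `^ (1 / w i)
      < eps / T
    /\ 0 < (q%:~R : R) < T.

Definition Sing (R : realType) (d : nat) (w : 'I_d -> R) : set 'rV[R]_d :=
  [set x | singular w x].

(* Main.v *)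
(** Points are followed through integer forms [V = (a, b)] with value
    [a . x + b].  If [V] has coefficients of size at most [P T^(w_i)] and a value
    much smaller than [1 / T'] at [x], with [T'] much larger than [T], then the
    lattice of the [(p, q)] on which [V] vanishes is dense enough for the
    pigeonhole principle to give the [q x - p] which singularity demands for the
    bounds between [T] and [T'].

    Given such a [V] vanishing at the center of a box of sides
    [s_i = T^-(1 + w_i)], most points of the box where [V] is about [1 / T'] admit
    no form which is short at height [T'] (a union bound over all such forms).
    At these points the lattice of forms is well rounded, so that a next form
    [V'] can be chosen with large [i0]-th coefficient and large component
    independent of [V].  Moving such a point along a coordinate [i1], so that [V']
    keeps its value while [V] becomes much smaller, preserves well-roundedness,
    and the moved points are the centers of the boxes of the next level.  They
    are spread over a neighbourhood of the hyperplane [V = 0], of relative width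
    about [1 / C] with [C = T' / T], whereas the side [s_i0] is divided by
    [C^(1 + w_i0)]: this is the loss of [1 / (1 + w_i0)] in the dimension.

    The lower bound is obtained without a measure.  Weigh a set of diameter [rho]
    that meets a box by a potential depending on [rho] and on the level; by
    averaging over the children, some child has total weight at most that of its
    parent.  A cover with small [s]-sum has initial weight less than [1], while
    a set containing the limit point would eventually have weight [1]; the limit
    point is therefore singular and not covered. *)

Require Import Defs.
From mathcomp Require Import all_boot all_order all_algebra.
From mathcomp Require Import all_classical all_reals all_analysis.
From mathcomp Require Import zify ring lra.

Set Implicit Arguments.
Unset Strict Implicit.
Unset Printing Implicit Defensive.

Import Order.TTheory GRing.Theory Num.Theory.
Import numFieldNormedType.Exports.

Local Open Scope ring_scope.

(** Well-roundedness cannot be obtained by a union bound at the children themselves: [V] is much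
    smaller than [1 / T'] there and is itself one of the short forms to be excluded. So the union
    bound is made where [V] is about [1 / T'], and the result is carried over to the children with a
    covering radius that grows like [1 / e] when the value of [V] is multiplied by [e]. This is why
    nodes carry a covering radius and not a first minimum.

    Every quantity of a level is a power of one base [A], and a spare factor [A] absorbs the
    numerical constants. One step then loses [A ^+ c], with [c] independent of the exponent [m] in
    [C = A ^+ m]; so the loss is [C] to the power [c / m], which is negligible for large [m]. The
    base has to tend to infinity with the level, since singularity concerns every [eps]. With
    [A_ j = a ^ j.+1] the height [T_ j] has an exponent quadratic in [j], hence [C] is below any
    power of the height up to a constant, and the coarseness of the scales costs nothing in the
    limit. *)

Section Counting.

Lemma size_le_card (T : eqType) (F : finType) (s : seq T) (f : T -> F) :
  uniq s -> {in s &, injective f} -> (size s <= #|F|)%N.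
Proof.
move=> us finj; have ums : uniq (map f s) by rewrite map_inj_in_uniq.
by rewrite -(size_map f) -(card_uniqP ums) max_card.
Qed.

Lemma size_le_fibers (T K : eqType) (s : seq T) (ks : seq K) (f : T -> K)
    (N : nat) :
    {in s, forall x, f x \in ks} ->
    (forall k, k \in ks -> (size [seq x <- s | f x == k] <= N)%N) ->
  (size s <= size ks * N)%N.
Proof.
elim: ks s => [|k ks IH] s fks fN /=.
  by case: s fks {fN} => [//|a s] /(_ a); rewrite inE eqxx /= => /(_ isT).
rewrite mulSn -(count_predC (fun x => f x == k)) leq_add //.
  by rewrite -size_filter fN // inE eqxx.
rewrite -size_filter; apply: IH => [x|j jks].
  by rewrite mem_filter /= => /andP[fxk /fks]; rewrite inE (negbTE fxk).
rewrite -filter_predI; apply: leq_trans (fN j _); last by rewrite inE jks orbT.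
rewrite !size_filter; apply: sub_count => x /=; by case/andP.
Qed.

Lemma pigeonhole_fiber (T K : eqType) (s : seq T) (ks : seq K) (f : T -> K)
    (N : nat) :
    {in s, forall x, f x \in ks} -> (size ks * N < size s)%N ->
  exists k, (N < size [seq x <- s | f x == k])%N.
Proof.
move=> fks lt; apply: contrapT => /forallNP H.
suff : (size s <= size ks * N)%N by rewrite leqNgt lt.
by apply: size_le_fibers fks _ => k _; rewrite leqNgt; apply/negP/H.
Qed.

End Counting.

Section NatFloor.
Variable R : realType.
Implicit Types x : R.

Lemma truncn_bounds x : 0 <= x ->
  (Num.truncn x)%:R <= x /\ x < (Num.truncn x)%:R + 1.
Proof. by move=> /truncn_itv/andP[-> /=]; rewrite -natr1. Qed.

Lemma floor_bounds x :
  (Num.floor x)%:~R <= x /\ x < (Num.floor x)%:~R + 1.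
Proof. by have /andP[? ?] := floor_itv x; rewrite -intrD1. Qed.

Lemma half_le_truncn x : 1 <= x -> x / 2 <= (Num.truncn x)%:R.
Proof.
move=> x1; have [? ?] := truncn_bounds (le_trans ler01 x1).
have : (1 <= Num.truncn x)%N by rewrite truncn_gt0.
by rewrite -(ler_nat R) => ?; lra.
Qed.

End NatFloor.

(** * Integer affine forms and their number in a box *)

Section Forms.
Variables (R : realType) (d : nat).

Definition form := ({ffun 'I_d -> int} * int)%type.

Implicit Types (x h S : 'I_d -> R) (V W : form) (rho K : R).

Definition ev W x : R := \sum_(i < d) (W.1 i)%:~R * x i + (W.2)%:~R.

Definition box S rho x W :=
  (forall i, `|(W.1 i)%:~R : R| <= S i) /\ `|ev W x| <= rho.

(* The covering radius, at the point [x] and in the box with sides [h i] and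
   [1 / \prod_i h i], of the lattice of integer forms is at most [K]. *)
Definition cov x h K := forall (y : 'I_d -> R) (v : R), exists W : form,
  (forall i, `|(W.1 i)%:~R - y i| <= K * h i) /\
  `|ev W x - v| <= K / \prod_i h i.

Lemma evD V W x : ev (V + W) x = ev V x + ev W x.
Proof.
rewrite /ev /= intrD addrACA -big_split /=; congr (_ + _).
by apply: eq_bigr => i _; rewrite ffunE intrD mulrDl.
Qed.

Lemma evMz V (k : int) x : ev (V *~ k) x = k%:~R * ev V x.
Proof.
rewrite /ev (raddfMz snd) (raddfMz fst) /= mulrDr mulr_sumr; congr (_ + _).
  by apply: eq_bigr => i _; rewrite ffunMzE mulrzz intrM; ring.
by rewrite mulrzz intrM mulrC.
Qed.

Lemma evN V x : ev (- V) x = - ev V x.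
Proof. by rewrite -[- V]/(V *~ (-1)) evMz mulN1r. Qed.

Lemma evB V W x : ev (V - W) x = ev V x - ev W x.
Proof. by rewrite evD evN. Qed.

Lemma ev0 x : ev 0 x = 0.
Proof. by rewrite /ev big1 ?addr0 // => i _; rewrite ffunE mul0r. Qed.

Lemma coef0 i : (0 : form).1 i = 0.
Proof. by rewrite /= ffunE. Qed.

Lemma coefMz V (k : int) i : (V *~ k).1 i = V.1 i * k.
Proof. by rewrite (raddfMz fst) ffunMzE mulrzz. Qed.

Lemma coefB V W i : (V - W).1 i = V.1 i - W.1 i.
Proof. by rewrite /= !ffunE. Qed.

Lemma form_eqP V W x : (forall i, V.1 i = W.1 i) -> ev V x = ev W x -> V = W.
Proof.
case: V W => [a b] [a' b'] /= aa'; have -> : a = a' by apply/ffunP.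
by rewrite /ev /= => /addrI /intr_inj ->.
Qed.

Lemma ev_sum (J : Type) (r : seq J) (P : pred J) (F : J -> form) x :
  ev (\sum_(j <- r | P j) F j) x = \sum_(j <- r | P j) ev (F j) x.
Proof. by apply: (big_morph (ev^~ x)); [move=> V W; exact: evD|exact: ev0]. Qed.

Lemma coef_sum (J : Type) (r : seq J) (P : pred J) (F : J -> form) i :
  (\sum_(j <- r | P j) F j).1 i = \sum_(j <- r | P j) (F j).1 i.
Proof.
by apply: (big_morph (fun W : form => W.1 i)) => [V W|]; rewrite /= ffunE.
Qed.

Lemma ev_move W x x' :
  ev W x' = ev W x + \sum_i (W.1 i)%:~R * (x' i - x i).
Proof.
rewrite /ev addrAC -big_split /=; congr (_ + _).
by apply: eq_bigr => i _; ring.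
Qed.

(** A form is coded by its coefficients and by the offset of its constant term from the least one,
    [lo W], that they allow. The final [+ 1] makes the bound wasteful for [rho < 1], which is what
    [cov_count] repairs. *)
Lemma box_count S rho x (s : seq form) : (forall i, 0 <= S i) -> 0 <= rho ->
    uniq s -> (forall W, W \in s -> box S rho x W) ->
  (size s)%:R <= \prod_i (2 * S i + 1) * (2 * rho + 1).
Proof.
move=> S0 rho0 us sbox.
pose N i := Num.truncn (S i); pose m i := (2 * N i)%N.
pose nr := Num.truncn (2 * rho).
(* The constant term cancels here, so [lo] depends on the coefficients only and the offset can be
   decoded. *)
pose lo W := Num.ceil (- rho - (ev W x - (W.2)%:~R)).
pose F := ({dffun forall i : 'I_d, 'I_((m i).+1)} * 'I_nr.+1)%type.
pose f (W : form) : F := ([ffun i => inord (`|(W.1 i + (N i)%:Z)%R|%N)],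
  inord (`|(W.2 - lo W)%R|%N)).
have aN W i : W \in s -> - (N i)%:Z <= W.1 i <= (N i)%:Z.
  move=> /sbox[/(_ i) Wi _]; have : (`|W.1 i|%N <= N i)%N.
    by rewrite truncn_ge_nat // natr_absz intr_norm.
  lia.
have bN W : W \in s -> 0 <= W.2 - lo W <= nr%:Z.
  move=> /sbox[_ Wr]; have lob : (lo W)%:~R - 1 < - rho - (ev W x - (W.2)%:~R)
      <= (lo W)%:~R.
    by have := ceil_itv (- rho - (ev W x - (W.2)%:~R)); rewrite intrB.
  have l1 : ((lo W)%:~R : R) < (W.2)%:~R + 1.
    move: Wr; rewrite ler_norml => /andP[? ?]; move: lob => /andP[? ?]; lra.
  have l2 : lo W <= W.2 by move: l1; rewrite -intrD1 ltr_int; lia.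
  rewrite subr_ge0 l2 /=.
  have : (`|(W.2 - lo W)%R|%N <= nr)%N.
    rewrite truncn_ge_nat ?mulr_ge0// natr_absz ger0_norm ?subr_ge0// intrB.
    move: Wr; rewrite ler_norml => /andP[? ?]; move: lob => /andP[? ?]; lra.
  lia.
have finj : {in s &, injective f}.
  move=> V W Vs Ws [/ffunP fa fb].
  have aa i : V.1 i = W.1 i.
    have := fa i; rewrite !ffunE => /(congr1 val).
    have /andP[? ?] := aN V i Vs; have /andP[? ?] := aN W i Ws.
    by rewrite /= /m !inordK; lia.
  have e : lo V = lo W.
    rewrite /lo /ev !addrK; congr (Num.ceil (_ - _)).
    by apply: eq_bigr => i _; rewrite aa.
  move/(congr1 val): fb => fb.
  have /andP[v1 v2] := bN _ Vs; have /andP[w1 w2] := bN _ Ws.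
  rewrite -?e in fb *; move: fb => /=; rewrite !inordK ?ltnS => [fb||]; [|lia|lia].
  have bb : V.2 = W.2.
    clear -fb e v1 w1; move: (lo V) (lo W) e v1 w1 fb => a b; case: V => ? c; case: W => ? c' /=; lia.
  by apply: (form_eqP (x := x)) => //; rewrite /ev bb; congr (_ + _);
    apply: eq_bigr => i _; rewrite aa.
have := size_le_card us finj.
rewrite card_prod card_dep_ffun card_ord foldrE big_map -(ler_nat R).
move=> /le_trans; apply; rewrite natrM natr_prod big_enum /=.
apply: ler_pM => //; first by apply: prodr_ge0.
  apply: ler_prod => i _; rewrite ler0n card_ord /m /= -natr1 natrM.
  by have [] := truncn_bounds (S0 i); rewrite -/(N i) => ? _; lra.
have /truncn_bounds[] : 0 <= 2 * rho by rewrite mulr_ge0.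
by rewrite -/nr -natr1 => ? _; lra.
Qed.

End Forms.

(** * Consequences of a bounded covering radius *)

Section Covering.
Variables (R : realType) (d : nat).
Implicit Types (x h S : 'I_d -> R) (V W : form d) (rho K : R).

Lemma prod_ge1 h : (forall i, 1 <= h i) -> 1 <= \prod_i h i.
Proof.
move=> h1; elim/big_rec: _ => // i y _ y1.
by rewrite mulr_ege1.
Qed.

Lemma prod_scale (c : R) h : \prod_i (c * h i) = c ^+ d * \prod_i h i.
Proof. by rewrite big_split /= prodr_const card_ord. Qed.

(* In the nontrivial case [rho < 1], about [1 / rho] translates of the box by
   lattice points with small coefficients and spread values are disjoint, and
   their union is counted exactly up to constants by [box_count]. *)
Lemma cov_count x h K S rho (s : seq (form d)) :
    (forall i, 1 <= h i) -> 1 <= K -> cov x h K ->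
    (forall i, K * h i <= S i) -> K / \prod_i h i <= rho ->
    uniq s -> (forall W, W \in s -> box S rho x W) ->
  (size s)%:R <= 5 ^+ d * 30 * (\prod_i S i * rho).
Proof.
move=> h1 K1 xhK KS Krho us sbox.
have T1 := prod_ge1 h1.
have rho0 : 0 < rho by apply: lt_le_trans Krho; rewrite divr_gt0 ?(lt_le_trans ltr01).
have S1 i : 1 <= S i.
  by apply: le_trans (KS i); rewrite mulr_ege1.
have S0 i : 0 <= S i := le_trans ler01 (S1 i).
have pS (c e : R) : 0 <= c -> 0 <= e -> c + e <= 5 ->
    \prod_i (c * S i + e) <= 5 ^+ d * \prod_i S i.
  move=> c0 e0 ce; rewrite -prod_scale; apply: ler_prod => i _.
  have := S1 i; have := S0 i; move=> ? ?; apply/andP; split; first by nra.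
  nra.
have pS0 : 0 <= \prod_i S i by apply: prodr_ge0.
have p5 : 0 <= 5 ^+ d :> R by rewrite exprn_ge0.
have [rho1|rho1] := leP 1 rho.
  apply: le_trans (box_count S0 (ltW rho0) us sbox) _.
  have -> : 5 ^+ d * 30 * (\prod_i S i * rho) =
    (5 ^+ d * \prod_i S i) * (30 * rho) by ring.
  apply: ler_pM; [by apply: prodr_ge0 => i _; rewrite addr_ge0 ?mulr_ge0|lra| |lra].
  by apply: pS => //; lra.
have ir1 : 1 <= rho^-1 by rewrite invf_ge1 // ltW.
have [m1 m2] := truncn_bounds (le_trans ler01 ir1).
set m := Num.truncn _ in m1 m2.
have m0 : (1 <= m)%N by rewrite truncn_gt0.
(* The value of [W + Z j] is within [2 * rho] of [5 * j * rho], so the spacing 5 keeps the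
   translates disjoint. *)
have /choice[Z HZ] (j : nat) := xhK (fun=> 0) (5 * j%:R * rho).
pose s' := [seq W + Z j | j <- iota 0 m, W <- s].
have mrho : m%:R * rho <= 1 by rewrite -ler_pdivlMr // div1r.
have s'box W : W \in s' -> box (fun i => 2 * S i) 7 x W.
  move=> /allpairsP[[j V] /= [jm Vs ->]].
  have [Za Zv] := HZ j; have [Va Vv] := sbox _ Vs; split.
    move=> i; rewrite ffunE intrD; apply: le_trans (ler_normD _ _) _.
    have := Za i; have := Va i; have := KS i; rewrite subr0; lra.
  have jr : (j%:R + 1) * rho <= 1.
    apply: le_trans mrho; rewrite ler_pM2r // natr1 ler_nat.
    by move: jm; rewrite mem_iota => /andP[].
  rewrite evD; move: Zv Vv; rewrite !ler_norml => /andP[? ?] /andP[? ?].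
  have : 0 <= j%:R * rho by rewrite mulr_ge0 // ltW.
  by move=> ?; apply/andP; split; nra.
have us' : uniq s'.
  apply: allpairs_uniq => //; first exact: iota_uniq.
  move=> [j V] [k W] /allpairsP[[j' V'] /= [_ Vs [-> ->]]].
  move=> /allpairsP[[k' W'] /= [_ Ws [-> ->]]] /= e.
  have jk : j' = k'.
    have [_ Zj] := HZ j'; have [_ Zk] := HZ k'.
    have [_ Vv] := sbox _ Vs; have [_ Wv] := sbox _ Ws.
    have /(congr1 (fun V : form d => ev V x)) := e; rewrite !evD => e'.
    have : `|(j'%:R - k'%:R : R)| < 1.
      rewrite -(ltr_pM2r rho0) -[X in _ * X < _](gtr0_norm rho0) -normrM.
      move: Zj Zk Vv Wv; rewrite ltr_norml !ler_norml.
      by move=> /andP[? ?] /andP[? ?] /andP[? ?] /andP[? ?]; apply/andP; split; nra.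
    rewrite !pmulrn -intrB -intr_norm -[1]/(1%:~R) ltr_int; clear; lia.
  by move: e; rewrite jk => /addIr ->.
have ms : (m * size s)%:R <= 5 ^+ d * \prod_i S i * 15.
  have S20 i : 0 <= 2 * S i by rewrite mulr_ge0.
  have := box_count S20 (ler0n R 7) us' s'box.
  rewrite size_allpairs size_iota => /le_trans; apply.
  have -> : (2 * 7 + 1 : R) = 15 by ring.
  rewrite ler_pM2r // (eq_bigr (fun i => 4 * S i + 1)) => [|i _]; last by ring.
  by apply: pS; lra.
rewrite natrM in ms.
have m2r : 1 <= 2 * m%:R * rho.
  have : (1 : R) <= m%:R by rewrite ler1n.
  move: m2; rewrite -[_^-1]div1r ltr_pdivrMr //; nra.
have : (size s)%:R <= (2 * m%:R * rho) * (size s)%:R.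
  by rewrite ler_peMl.
move=> /le_trans; apply.
have -> : 2 * m%:R * rho * (size s)%:R = (m%:R * (size s)%:R) * (2 * rho) by ring.
have -> : 5 ^+ d * 30 * (\prod_i S i * rho) = (5 ^+ d * \prod_i S i * 15) * (2 * rho) by ring.
by rewrite ler_pM2r // mulr_gt0.
Qed.

(** The multiples of [W] up to [K / del] all stay in the box of size [K], whose number of points
    [cov_count] bounds. *)
Lemma cov_first_min x h K (del : R) W :
    (forall i, 1 <= h i) -> 1 <= K -> cov x h K -> 0 < del -> W != 0 ->
    box (fun i => del * h i) (del / \prod_i h i) x W ->
  1 <= del * (5 ^+ d * 31 * K ^+ d).
Proof.
move=> h1 K1 xhK del0 W0 [Wa Wv].
have T1 := prod_ge1 h1; have T0 := lt_le_trans ltr01 T1.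
have K0 := lt_le_trans ltr01 K1.
have [m1 m2] := truncn_bounds (ltW (divr_gt0 K0 del0)).
set m := Num.truncn _ in m1 m2.
pose s := [seq W *~ j.+1%:Z | j <- iota 0 m].
have us : uniq s.
  rewrite map_inj_uniq ?iota_uniq // => i j e.
  have {}e : W *~ (i%:Z - j%:Z) = 0 by apply/eqP; rewrite mulrzBr subr_eq0; apply/eqP; move: e; rewrite -!pmulrn !mulrS => /addrI.
  have [|ij] := eqVneq (i%:Z - j%:Z) 0; first by clear; lia.
  case/eqP: W0; apply: (form_eqP (x := x)) => [k|].
    move/(congr1 (fun V : form d => V.1 k)): e; rewrite coefMz coef0.
    by move/eqP; rewrite mulf_eq0 (negbTE ij) orbF => /eqP->.
  move/(congr1 (fun V : form d => ev V x)): e; rewrite evMz ev0 => /eqP.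
  by rewrite mulf_eq0 intr_eq0 (negbTE ij) /= => /eqP.
have mdel : m%:R * del <= K by rewrite -ler_pdivlMr.
have sbox V : V \in s -> box (fun i => K * h i) (K / \prod_i h i) x V.
  move=> /mapP[j]; rewrite mem_iota => jm ->.
  have jd : (j.+1)%:R * del <= K.
    by apply: le_trans mdel; rewrite ler_pM2r // ler_nat; case/andP: jm.
  split=> [i|].
    rewrite coefMz intrM normrM mulrC; apply: le_trans (_ : _ <= j.+1%:R * (del * h i)) _.
      by apply: ler_pM => //; rewrite ?Wa // normr_nat.
    by rewrite mulrA ler_pM2r // (lt_le_trans ltr01).
  rewrite evMz normrM; apply: le_trans (_ : _ <= j.+1%:R * (del / \prod_i h i)) _.
    by apply: ler_pM => //; rewrite normr_nat.
  by rewrite mulrA ler_pM2r // invr_gt0.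
have := cov_count h1 K1 xhK (fun i => lexx _) (lexx _) us sbox.
rewrite size_map size_iota prod_scale.
have -> : K ^+ d * \prod_i h i * (K / \prod_i h i) = K ^+ d * K.
  by field; rewrite gt_eqF.
move=> mK; have Kd : 1 <= K ^+ d by rewrite exprn_ege1.
have p5 : 1 <= 5 ^+ d :> R by rewrite exprn_ege1 // ler1n.
have : K / del < 5 ^+ d * 31 * K ^+ d * K.
  apply: lt_le_trans m2 _.
  have : 1 <= 5 ^+ d * (K ^+ d * K).
    by rewrite !mulr_ege1.
  lra.
rewrite ltr_pdivrMr // => H.
rewrite -(ler_pM2r K0) mul1r ltW //; apply: lt_le_trans H _.
by rewrite le_eqVlt; apply/orP; left; apply/eqP; ring.
Qed.

End Covering.

(** * Many lattice points in a box, by pigeonhole *)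

Section LatticePoints.
Variables (R : realType) (d : nat).
Implicit Types (x h S : 'I_d -> R) (V W : form d) (rho K : R).

(** A quantitative Minkowski theorem. Forms with coefficients in [[0, S * h i)] and constant term
    normalized to give a value in [[0, 1)] are sorted into about [T / S] classes of nearby values;
    the points are the differences inside a most populated class. *)
Lemma many_lattice_points x h (S : R) :
    (forall i, 1 <= h i) -> 1 <= S -> S <= \prod_i h i ->
  exists s : seq (form d), [/\ uniq s,
    forall W, W \in s -> box (fun i => S * h i) (S / \prod_i h i) x W &
    S ^+ d.+1 <= 2 ^+ d.+1 * (size s)%:R].
Proof.
move=> h1 S1 ST; set T := \prod_i h i in ST *.
have S0 : 0 < S := lt_le_trans ltr01 S1.
have T0 : 0 < T := lt_le_trans S0 ST.
have Sh1 i : 1 <= S * h i by rewrite mulr_ege1.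
pose N i := Num.truncn (S * h i); pose m := (Num.truncn (T / S)).+1.
pose F := {dffun forall i : 'I_d, 'I_(N i)}.
pose Wf (f : F) : form d :=
  let a := [ffun i => (val (f i))%:Z] in (a, - Num.floor (ev (a, 0) x)).
have evab (a : {ffun 'I_d -> int}) (b : int) : ev (a, b) x = ev (a, 0) x + b%:~R.
  by rewrite /ev /= addr0.
have evWf f : 0 <= ev (Wf f) x < 1.
  rewrite /Wf evab rmorphN /=.
  by have [] := floor_bounds (ev ([ffun i => (f i : nat)%:Z], 0) x) => ? ?; apply/andP; split; lra.
pose key f := Num.truncn (ev (Wf f) x * (T / S)).
have keyb f : (key f)%:R <= ev (Wf f) x * (T / S) < (key f)%:R + 1.
  have /andP[e0 _] := evWf f.
  by have [] := truncn_bounds (mulr_ge0 e0 (ltW (divr_gt0 T0 S0))); rewrite -/(key f) => -> ->.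
have TS1 : 1 <= T / S by rewrite ler_pdivlMr // mul1r.
have keyin : {in enum F, forall f, key f \in iota 0 m}.
  move=> f _; rewrite mem_iota /= add0n /m ltnS; apply: le_truncn.
  have /andP[_ e1] := evWf f.
  by rewrite -[leRHS]mul1r ler_pM2r ?(ltW e1) // (lt_le_trans ltr01).
pose P := #|F|.
have P0 : (0 < P)%N.
  rewrite /P card_dep_ffun foldrE big_map big_enum /= prodn_gt0 // => i.
  by rewrite card_ord truncn_gt0.
have Plt : (size (iota 0 m) * (P.-1 %/ m) < size (enum F))%N.
  rewrite size_iota -cardE -/P mulnC; apply: leq_ltn_trans (leq_trunc_div _ _) _.
  by rewrite prednK.
have [k kP] := pigeonhole_fiber keyin Plt.
set l := [seq f <- _ | _] in kP.
have lk f : f \in l -> key f = k by rewrite mem_filter => /andP[/eqP].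
have [f0 f0l] : exists f0, f0 \in l.
  by case: l kP {lk} => [//|f l'] _; exists f; rewrite inE eqxx.
have Winj : injective Wf.
  move=> f g [/ffunP fg _]; apply/ffunP => i; apply/val_inj.
  by have := fg i; rewrite !ffunE => -[].
exists [seq Wf f - Wf f0 | f <- l]; split.
- rewrite map_inj_uniq => [|f g /addIr /Winj //].
  by apply: filter_uniq; apply: enum_uniq.
- move=> W /mapP[f fl ->]; split=> [i|].
    rewrite coefB /= !ffunE intrB.
    have [] := truncn_bounds (le_trans ler01 (Sh1 i)); rewrite -/(N i) => ? _.
    have fN (g : F) : 0 <= (g i)%:R :> R /\ (g i)%:R + 1 <= (N i)%:R :> R.
      by rewrite natr1 ler_nat.
    have [? ?] := fN f; have [? ?] := fN f0.
    by rewrite -!pmulrn ler_norml; apply/andP; split; lra.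
  rewrite evB; have := keyb f; have := keyb f0; rewrite !lk // => /andP[? ?] /andP[? ?].
  have TS0 : 0 < T / S by rewrite divr_gt0.
  have : `|ev (Wf f) x - ev (Wf f0) x| * (T / S) <= 1.
    by rewrite -[X in _ * X](gtr0_norm TS0) -normrM mulrBl ler_norml; apply/andP; split; lra.
  by rewrite -ler_pdivlMr // div1r invf_div.
rewrite size_map.
have Pm : (P <= m * size l)%N.
  move: kP; rewrite ltn_divLR // => kP; rewrite mulnC.
  by case: P P0 kP {Plt} => // P' _ /=.
have mT : m%:R <= 2 * (T / S) :> R.
  have [] := truncn_bounds (le_trans ler01 TS1); rewrite /m -natr1 => ? _; lra.
have PN : (2^-1) ^+ d * (S ^+ d * T) <= P%:R :> R.
  rewrite /P card_dep_ffun foldrE big_map big_enum /= natr_prod.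
  rewrite -!prod_scale; apply: ler_prod => i _; rewrite card_ord.
  rewrite mulr_ge0 ?invr_ge0 ?(le_trans ler01 (Sh1 i)) //=.
  by rewrite mulrC half_le_truncn.
have Pl : P%:R <= 2 * (T / S) * (size l)%:R :> R.
  by rewrite -(ler_nat R) natrM in Pm; apply: le_trans Pm _; rewrite ler_wpM2r.
have := le_trans PN Pl; rewrite exprVn -ler_pdivlMl ?invr_gt0 ?exprn_gt0 // invrK.
rewrite -(ler_pM2r (divr_gt0 S0 T0)) !exprSr.
have -> : S ^+ d * T * (S / T) = S ^+ d * S by field; rewrite gt_eqF.
move=> /le_trans; apply; rewrite le_eqVlt; apply/orP; left; apply/eqP; field.
by rewrite !gt_eqF.
Qed.

End LatticePoints.

(** * From the first minimum to the covering radius *)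

Section MinToCov.
Variables (R : realType) (d : nat).
Implicit Types (x h S : 'I_d -> R) (V W : form d) (rho K : R).

(* Coordinates of a form in the box of sides [h], the value coming first. *)
Definition coords x h W : 'rV[R]_d.+1 :=
  \row_j (if unlift ord0 j is Some i then (W.1 i)%:~R / h i
          else (\prod_i h i) * ev W x).

Lemma coords0 x h W : coords x h W 0 ord0 = (\prod_i h i) * ev W x.
Proof. by rewrite mxE unlift_none. Qed.

Lemma coordsS x h W i : coords x h W 0 (lift ord0 i) = (W.1 i)%:~R / h i.
Proof. by rewrite mxE liftK. Qed.

Lemma coordsB x h V W : coords x h (V - W) = coords x h V - coords x h W.
Proof.
apply/rowP => j; rewrite !mxE; case: unliftP => [i _|_].
  by rewrite coefB intrB mulrBl.
by rewrite evB mulrBr.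
Qed.

Lemma coordsBE x h V W j :
  coords x h (V - W) 0 j = coords x h V 0 j - coords x h W 0 j.
Proof. by rewrite coordsB !mxE. Qed.

Lemma boxP_coords x h (S : R) W : (forall i, 0 < h i) ->
  box (fun i => S * h i) (S / \prod_i h i) x W <->
  forall j, `|coords x h W 0 j| <= S.
Proof.
move=> h0; have T0 : 0 < \prod_i h i by apply: prodr_gt0.
split=> [[Wa Wv] j|H].
  case: (unliftP ord0 j) => [i|] ->.
    by rewrite coordsS normrM normfV (gtr0_norm (h0 i)) ler_pdivrMr.
  by rewrite coords0 normrM (gtr0_norm T0) mulrC -ler_pdivlMr.
split=> [i|].
  have := H (lift ord0 i).
  by rewrite coordsS normrM normfV (gtr0_norm (h0 i)) ler_pdivrMr.
by have := H ord0; rewrite coords0 normrM (gtr0_norm T0) mulrC -ler_pdivlMr.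
Qed.

(** The coordinate [j] where [f] is largest is controlled by the others on the kernel of [f]. Hence
    two points in the same cell of side [1 / (d.+1 * A)] for the other [d] coordinates differ by an
    element of the forbidden box, and only [d] coordinates have to be counted. *)
Lemma not_in_hyperplane x h (A S : R) (s : seq (form d)) (f : 'cV[R]_d.+1) :
    (forall i, 0 < h i) -> 1 <= A -> 1 <= S ->
    (forall W, box (fun i => A^-1 * h i) (A^-1 / \prod_i h i) x W -> W = 0) ->
    uniq s -> (forall W, W \in s -> box (fun i => S * h i) (S / \prod_i h i) x W) ->
    f != 0 -> (forall W, W \in s -> coords x h W *m f = 0) ->
  (size s)%:R <= (3 * S * d.+1%:R * A) ^+ d.
Proof.
move=> h0 A1 S1 minA us sbox f0 fs.
have A0 := lt_le_trans ltr01 A1; have S0 := lt_le_trans ltr01 S1.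
have D0 : 0 < d.+1%:R :> R by rewrite ltr0n.
pose j := [arg max_(j > ord0) `|f j 0|]%O.
have fj i : `|f i 0| <= `|f j 0| by rewrite /j; case: arg_maxP => // k _; apply.
have fj0 : 0 < `|f j 0|.
  rewrite lt_neqAle normr_ge0 andbT eq_sym; apply: contra f0 => /eqP e.
  apply/eqP/colP => i; rewrite mxE; apply/eqP; rewrite -normr_eq0.
  by rewrite eq_le normr_ge0 andbT -e fj.
pose c : R := d.+1%:R * A; have c0 : 0 < c by rewrite mulr_gt0.
pose B := Num.truncn (2 * S * c).
pose key (W : form d) : {ffun 'I_d -> 'I_B.+1} :=
  [ffun i => inord (Num.truncn ((coords x h W 0 (lift j i) + S) * c))].
have keyinj : {in s &, injective key}.
  move=> V W Vs Ws /ffunP VW; apply/eqP; rewrite -subr_eq0; apply/eqP.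
  apply: minA; apply/boxP_coords => // k.
  have small i : `|coords x h (V - W) 0 (lift j i)| <= c^-1.
    have := VW i; rewrite !ffunE => /(congr1 val).
    have bd U : U \in s -> 0 <= (coords x h U 0 (lift j i) + S) * c <= 2 * S * c.
      move=> /sbox /(boxP_coords _ _ _ h0)/(_ (lift j i)); rewrite ler_norml => /andP[? ?].
      by rewrite mulr_ge0 ?(ltW c0) ?ler_pM2r //; lra.
    have /andP[V0 V1] := bd _ Vs; have /andP[W0 W1] := bd _ Ws.
    rewrite /= !inordK ?ltnS ?le_truncn // => e.
    have [] := truncn_bounds V0; have [] := truncn_bounds W0; rewrite e => ? ? ? ?.
    rewrite coordsBE -[c^-1]div1r ler_pdivlMr //.
    rewrite -[X in _ * X](gtr0_norm c0) -normrM ler_norml.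
    by apply/andP; split; lra.
  case: (unliftP j k) => [i|] ->.
    apply: le_trans (small i) _; rewrite lef_pV2 ?posrE // /c ler_peMl ?ler1n //.
    exact: ltW.
  have fVW : \sum_i coords x h (V - W) 0 i * f i 0 = 0.
    have := fs V Vs; have := fs W Ws; move=> fW fV.
    have : (coords x h (V - W) *m f) 0 0 = 0 by rewrite coordsB mulmxBl fV fW subrr mxE.
    by rewrite mxE.
  move: fVW; rewrite (bigD1 j) //= => /eqP; rewrite addr_eq0 => /eqP e.
  have : `|coords x h (V - W) 0 j| * `|f j 0| <= d%:R * c^-1 * `|f j 0|.
    rewrite -normrM e normrN; apply: le_trans (ler_norm_sum _ _ _) _.
    apply: le_trans (_ : _ <= \sum_(i | i != j) c^-1 * `|f j 0|) _.
      apply: ler_sum => i; case: (unliftP j i) => [i'|] ->; last by rewrite eqxx.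
      by rewrite normrM => _; apply: ler_pM.
    by rewrite sumr_const cardC1 card_ord /= -mulrA mulr_natl.
  rewrite ler_pM2r // => /le_trans; apply.
  rewrite /c invfM mulrA ler_piMl ?invr_ge0 ?(ltW A0) //.
  by rewrite ler_pdivrMr // mul1r ler_nat.
have := size_le_card us keyinj; rewrite card_ffun !card_ord -(ler_nat R).
move=> /le_trans; apply; rewrite natrX; apply: lerXn2r; rewrite ?nnegrE //.
  by rewrite !mulr_ge0 // ltW.
have /truncn_bounds[] : 0 <= 2 * S * c by rewrite !mulr_ge0 // ltW.
rewrite -/B -natr1 => ? _.
have : 1 <= S * c by rewrite mulr_ege1 // mulr_ege1 // ler1n.
rewrite -mulrA -/c; lra.
Qed.

(** The exponent of [A] in [A * (S * A) ^+ d * S] when [S = A ^+ d.+1]. *)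
Definition cov_exp := (d * d.+2 + d.+2)%N.

(** The box of size [S] contains about [S ^+ d.+1] points and a hyperplane at most about
    [(S * A) ^+ d] of them, so for [S = A ^+ d.+1] they span. Any target is a real combination of
    spanning points, and rounding its coefficients down costs the number of points times [S]. *)
Lemma min_cov x h (A : R) : (forall i, 1 <= h i) ->
    2 ^+ d.+1 * (3 * d.+1%:R) ^+ d < A -> A ^+ d.+1 <= \prod_i h i ->
    (forall W, box (fun i => A^-1 * h i) (A^-1 / \prod_i h i) x W -> W = 0) ->
  cov x h (A ^+ cov_exp).
Proof.
move=> h1 cA AT minA.
have h0 i : 0 < h i := lt_le_trans ltr01 (h1 i).
have T0 : 0 < \prod_i h i by apply: prodr_gt0.
have q1 : 1 <= (3 * d.+1%:R) ^+ d :> R.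
  by rewrite exprn_ege1 // mulr_ege1 // ler1n.
have p2 : 1 <= 2 ^+ d.+1 :> R by rewrite exprn_ege1 // ler1n.
have A1 : 1 <= A by apply: le_trans (ltW cA); rewrite mulr_ege1.
have A0 : 0 < A := lt_le_trans ltr01 A1.
pose S := A ^+ d.+1; have S1 : 1 <= S by rewrite exprn_ege1.
have S0 := lt_le_trans ltr01 S1.
have [s [us sbox sbig]] := many_lattice_points x h1 S1 AT.
pose Q := (3 * S * d.+1%:R * A) ^+ d.
have Q1 : 1 <= Q by rewrite exprn_ege1 // !mulr_ege1 // ler1n.
have Qlt : Q < (size s)%:R.
  rewrite -(ltr_pM2l (lt_le_trans ltr01 p2)); apply: lt_le_trans sbig.
  have -> : Q = (3 * d.+1%:R) ^+ d * A ^+ d * S ^+ d by rewrite /Q -!exprMn; congr (_ ^+ _); ring.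
  rewrite [S ^+ d.+1]exprS !mulrA ltr_pM2r ?exprn_gt0 // {1}/S [A ^+ d.+1]exprS ltr_pM2r //.
  exact: exprn_gt0.
(* Just enough points to escape every hyperplane: their number enters the covering radius. *)
pose n0 := (Num.truncn Q).+1.
have [Qn1 Qn2] := truncn_bounds (le_trans ler01 Q1).
have n0s : (n0 <= size s)%N by rewrite /n0 -(ltr_nat R) (le_lt_trans Qn1).
pose s0 := take n0 s.
have ss0 : size s0 = n0 by rewrite size_takel.
have us0 : uniq s0 by rewrite take_uniq.
have s0box W : W \in s0 -> box (fun i => S * h i) (S / \prod_i h i) x W.
  by move=> /mem_take; apply: sbox.
have n0A : n0%:R * S <= A ^+ cov_exp.
  have : n0%:R <= 2 * Q by rewrite /n0 -natr1; lra.
  have QA : 2 * Q <= A * (S * A) ^+ d.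
    have -> : Q = (3 * d.+1%:R) ^+ d * (S * A) ^+ d.
      by rewrite /Q -!exprMn; congr (_ ^+ _); ring.
    rewrite mulrA ler_pM2r ?exprn_gt0 ?mulr_gt0 //; apply: le_trans (ltW cA).
    by rewrite ler_pM2r ?(lt_le_trans ltr01 q1) // exprS ler_peMr // exprn_ege1 // ler1n.
  move=> /le_trans/(_ QA) n0Q; apply: le_trans (_ : _ <= A * (S * A) ^+ d * S) _.
    by rewrite ler_pM2r.
  rewrite /S -exprSr -exprM -exprS -exprD ler_weXn2l // /cov_exp.
  by rewrite mulnC; clear; lia.
pose M : 'M[R]_(n0, d.+1) := \matrix_(k < n0) coords x h (nth 0 s0 k).
have s0nth (k : 'I_n0) : nth 0 s0 k \in s0 by rewrite mem_nth ?ss0.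
have fullM : row_full M.
  apply: contraT => nf.
  have C0 : cokermx M != 0.
    by rewrite -mxrank_eq0 mxrank_coker subn_eq0 col_leq_rank.
  have [i [j Cij]] : exists i j, cokermx M i j != 0.
    apply: contrapT => H; case/eqP: C0; apply/matrixP => i j; rewrite [RHS]mxE.
    by apply/eqP; apply: contrapT => /negP ij; apply: H; exists i, j.
  have f0 : col j (cokermx M) != 0.
    apply: contra Cij => /eqP/colP/(_ i); rewrite mxE [RHS]mxE => ->; exact: eqxx.
  have fs W : W \in s0 -> coords x h W *m col j (cokermx M) = 0.
    move=> Ws; have kn : (index W s0 < n0)%N by rewrite -ss0 index_mem.
    have -> : coords x h W = row (Ordinal kn) M by rewrite rowK /= nth_index.
    by rewrite colE mulmxA -row_mul mulmx_coker row0 mul0mx.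
  have := not_in_hyperplane h0 A1 S1 minA us0 s0box f0 fs.
  by rewrite ss0 -/Q /n0 -natr1 leNgt => /negP.
move=> y v.
pose t : 'rV[R]_d.+1 := \row_j (if unlift ord0 j is Some i then y i / h i
  else (\prod_i h i) * v).
have /submxP[c tc] : (t <= M)%MS by apply: submx_full.
pose W : form d := \sum_(k < n0) nth 0 s0 k *~ Num.floor (c 0 k).
have Wt j : `|coords x h W 0 j - t 0 j| <= n0%:R * S.
  have -> : coords x h W 0 j = \sum_(k < n0) (Num.floor (c 0 k))%:~R * M k j.
    rewrite mxE; case: unliftP => [i|] ->.
      rewrite coef_sum rmorph_sum /= mulr_suml; apply: eq_bigr => k _.
      by rewrite coefMz intrM !mxE liftK; ring.
    rewrite ev_sum mulr_sumr; apply: eq_bigr => k _.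
    by rewrite evMz !mxE unlift_none; ring.
  rewrite tc mxE -sumrB; apply: le_trans (ler_norm_sum _ _ _) _.
  apply: le_trans (_ : _ <= \sum_(k < n0) S) _; last by rewrite sumr_const card_ord mulr_natl.
  apply: ler_sum => k _; rewrite -mulrBl normrM -[S]mul1r; apply: ler_pM => //.
    by have [? ?] := floor_bounds (c 0 k); rewrite ler_norml; apply/andP; split; lra.
  have := s0box _ (s0nth k) => /(boxP_coords _ _ _ h0)/(_ j).
  by rewrite [M k j]mxE.
exists W; split=> [i|].
  have := Wt (lift ord0 i); rewrite coordsS mxE liftK -mulrBl normrM normfV (gtr0_norm (h0 i)).
  by rewrite ler_pdivrMr // => /le_trans; apply; rewrite ler_pM2r.
have := Wt ord0; rewrite coords0 mxE unlift_none -mulrBr normrM (gtr0_norm T0) mulrC.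
rewrite -ler_pdivlMr // => /le_trans; apply.
by rewrite ler_pM2r // invr_gt0.
Qed.

End MinToCov.

(** * Counting in grids, Dirichlet approximation, geometric classes *)

Section GridCounting.
Variable R : realType.

Lemma size_le_fibersR (T K : eqType) (s : seq T) (ks : seq K) (f : T -> K)
    (F : R) : 0 <= F ->
    {in s, forall x, f x \in ks} ->
    (forall k, k \in ks -> (size [seq x <- s | f x == k])%:R <= F) ->
  (size s)%:R <= (size ks)%:R * F.
Proof.
move=> F0 fks fF; have [F1 _] := truncn_bounds F0.
apply: le_trans (_ : _ <= (size ks * Num.truncn F)%:R) _; last first.
  by rewrite natrM ler_wpM2l.
rewrite ler_nat; apply: size_le_fibers fks _ => k ks_k.
by rewrite truncn_ge_nat // fF.
Qed.

Lemma card_le_fibersR (T : finType) (K : eqType) (Y : {set T}) (ks : seq K)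
    (f : T -> K) (F : R) : 0 <= F ->
    {in Y, forall x, f x \in ks} ->
    (forall k, k \in ks -> #|[set x in Y | f x == k]|%:R <= F) ->
  #|Y|%:R <= (size ks)%:R * F.
Proof.
move=> F0 fks fF; rewrite cardE; apply: (size_le_fibersR (f := f)) => // [x|k kks].
  by rewrite mem_enum; apply: fks.
apply: le_trans (fF k kks); rewrite ler_nat cardE.
apply: uniq_leq_size; first by rewrite filter_uniq ?enum_uniq.
by move=> x; rewrite mem_filter !mem_enum inE andbC.
Qed.

(** The coordinate [k] is controlled only along lines of direction [k], as in a slab transversal to
    it. Each coordinate is coded by its excess over the minimum on a slice: all of [Y] for [i != k],
    the line through the point for [i = k], which is known once the other coordinates are
    decoded. *)
Lemma grid_count (d M : nat) (k : 'I_d) (Y : {set {ffun 'I_d -> 'I_M}})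
    (l : 'I_d -> R) : (forall i, 0 <= l i) ->
    (forall g g' i, g \in Y -> g' \in Y -> i != k ->
       `|(g i)%:R - (g' i)%:R : R| <= l i) ->
    (forall g g', g \in Y -> g' \in Y -> (forall i, i != k -> g i = g' i) ->
       `|(g k)%:R - (g' k)%:R : R| <= l k) ->
  #|Y|%:R <= \prod_i (l i + 1).
Proof.
move=> l0 offk atk.
pose agree (g g' : {ffun 'I_d -> 'I_M}) (i : 'I_d) :=
  (i != k) || [forall j, (j != k) ==> (g j == g' j)].
pose base i g : {ffun 'I_d -> 'I_M} :=
  [arg min_(g' < g | (g' \in Y) && agree g g' i) (g' i : nat)]%N.
have agreexx g i : agree g g i by rewrite /agree; apply/orP; right; apply/forallP=> j; rewrite eqxx implybT.
have baseP i g : g \in Y -> [/\ base i g \in Y, agree g (base i g) i &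
    forall g', g' \in Y -> agree g g' i -> (base i g i <= g' i)%N].
  move=> gY; rewrite /base; case: arg_minnP; first by rewrite gY agreexx.
  by move=> b /andP[bY ab] minb; split=> // g' g'Y ag'; apply: minb; rewrite g'Y.
have dist i g : g \in Y -> (g i - base i g i <= Num.truncn (l i))%N.
  move=> gY; have [bY ab minb] := baseP i g gY.
  have big : (base i g i <= g i)%N by apply: minb.
  rewrite truncn_ge_nat // natrB //; apply: le_trans (ler_norm _) _.
  have [ik|ik] := eqVneq i k; last exact: offk.
  subst i; move: ab; rewrite /agree eqxx /= => /forallP H.
  by apply: atk => // j jk; apply/eqP; move: (H j); rewrite jk.
pose F := {dffun forall i : 'I_d, 'I_((Num.truncn (l i)).+1)}.
pose f (g : {ffun 'I_d -> 'I_M}) : F := [ffun i => inord (g i - base i g i)].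
have finj : {in enum Y &, injective f}.
  move=> g g'; rewrite !mem_enum => gY g'Y /ffunP fgg'.
  have step i : agree g g' i -> g i = g' i.
    move=> ag; have := fgg' i; rewrite !ffunE => /(congr1 val).
    rewrite /= !inordK ?ltnS ?dist // => e.
    have [bY ab mb] := baseP i g gY; have [bY' ab' mb'] := baseP i g' g'Y.
    have ag' : agree g' g i.
      by move: ag; rewrite /agree; case: eqP => //= _ /forallP H; apply/forallP => j; rewrite [g' j == _]eq_sym; apply: H.
    have agb : agree g (base i g') i.
      move: ag ab'; rewrite /agree; case: eqP => //= _ /forallP H /forallP H'.
      apply/forallP => j; apply/implyP => jk; move: (H j) (H' j); rewrite jk /=.
      by move=> /eqP->.
    have agb' : agree g' (base i g) i.
      move: ag' ab; rewrite /agree; case: eqP => //= _ /forallP H /forallP H'.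
      apply/forallP => j; apply/implyP => jk; move: (H j) (H' j); rewrite jk /=.
      by move=> /eqP->.
    have b1 := mb _ bY' agb; have b2 := mb' _ bY agb'.
    have b3 : (base i g i <= g i)%N by apply: mb.
    have b4 : (base i g' i <= g' i)%N by apply: mb'.
    have bb : (base i g i = base i g' i :> nat) by apply/eqP; rewrite eqn_leq b1 b2.
    by apply/val_inj; rewrite /= -(subnK b3) e bb subnK.
  have off i : i != k -> g i = g' i by move=> ik; apply: step; rewrite /agree ik.
  apply/ffunP => i; have [->|/off//] := eqVneq i k; apply: step.
  by rewrite /agree eqxx /=; apply/forallP => j; apply/implyP => jk; rewrite off.
have := size_le_card (enum_uniq _) finj; rewrite -cardE card_dep_ffun -(ler_nat R).
move=> /le_trans; apply; rewrite foldrE big_map big_enum /= natr_prod.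
apply: ler_prod => i _; rewrite card_ord ler0n -natr1.
by have [? _] := truncn_bounds (l0 i); lra.
Qed.

Lemma dirichlet (t : R) (J : nat) : (0 < J)%N ->
  exists j k, (0 < j <= J)%N /\ `|j%:R * t - (k : int)%:~R| <= J%:R^-1.
Proof.
move=> J0; pose fr (j : nat) := j%:R * t - (Num.floor (j%:R * t))%:~R.
have frb j : 0 <= fr j < 1.
  by have [? ?] := floor_bounds (j%:R * t); rewrite /fr; apply/andP; split; lra.
have J0R : 0 < J%:R :> R by rewrite ltr0n.
pose key j := Num.truncn (fr j * J%:R).
have keyb j : (key j)%:R <= fr j * J%:R < (key j)%:R + 1.
  have /andP[f0 _] := frb j.
  by have [] := truncn_bounds (mulr_ge0 f0 (ltW J0R)); rewrite -/(key j) => -> ->.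
have keyin : {in iota 0 J.+1, forall j, key j \in iota 0 J}.
  move=> j _; rewrite mem_iota /= add0n -(ltr_nat R).
  have /andP[? _] := keyb j; apply: le_lt_trans (_ : fr j * J%:R < _); first by [].
  by have /andP[_ ?] := frb j; rewrite gtr_pMl.
have := @pigeonhole_fiber _ _ (iota 0 J.+1) (iota 0 J) key 1 keyin.
rewrite !size_iota muln1 => /(_ (ltnSn _))[c].
set l := [seq j <- _ | _] => lc.
have : exists a b, [/\ (a < b)%N, (b <= J)%N & key a = key b].
  have sl : sorted ltn l by apply: sorted_filter; [exact: ltn_trans|exact: iota_ltn_sorted].
  have lk j : j \in l -> key j = c /\ (j <= J)%N.
    by rewrite mem_filter mem_iota add0n => /and3P[/eqP-> _]; rewrite ltnS.
  case: l lc sl lk => [//|a [//|b l]] _ /= /andP[ab _] lk.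
  have [ka _] := lk a (mem_head _ _); have [|kb bJ] := lk b; first by rewrite !inE eqxx orbT.
  by exists a, b; rewrite ka kb.
move=> [a [b [ab bJ kab]]].
exists (b - a)%N, (Num.floor (b%:R * t) - Num.floor (a%:R * t)); split.
  by rewrite subn_gt0 ab (leq_trans (leq_subr _ _)).
rewrite natrB ?(ltnW ab) // intrB.
have -> : (b%:R - a%:R) * t - ((Num.floor (b%:R * t))%:~R - (Num.floor (a%:R * t))%:~R) = fr b - fr a.
  by rewrite /fr; ring.
rewrite -[_^-1]div1r ler_pdivlMr // -[X in _ * X](gtr0_norm J0R) -normrM mulrBl.
have := keyb a; have := keyb b; rewrite kab => /andP[? ?] /andP[? ?].
by rewrite ler_norml; apply/andP; split; lra.
Qed.

Lemma log_class (A Z : R) (N : nat) : 1 <= Z -> Z < A ^+ N ->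
  exists2 j, (j < N)%N & A ^+ j <= Z < A ^+ j.+1.
Proof.
elim: N => [|N IH] Z1 ZA; first by move: ZA; rewrite expr0 ltNge Z1.
have [ZN|NZ] := ltP Z (A ^+ N).
  by have [j jN Zj] := IH Z1 ZN; exists j => //; apply: ltnW.
by exists N; rewrite // NZ.
Qed.

End GridCounting.

(** * Nodes, and short forms that are nearly proportional to [V] *)

Section Nodes.
Variables (R : realType) (d : nat) (i0 : 'I_d).
Implicit Types (x h : 'I_d -> R) (V W : form d).

(* [V] generates the integer points of the line that it spans. *)
Definition primitive V := forall W (t : R),
  (forall i, (W.1 i)%:~R = t * (V.1 i)%:~R) -> (W.2)%:~R = t * (V.2)%:~R ->
  t = 0 \/ 1 <= `|t|.

(** The [i0]-th coefficient is comparable with the largest one allowed, so that the hyperplane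
    [V = 0] is a graph over the coordinates other than [i0] with controlled slopes. *)
Record node x V h (P K : R) : Prop := Node {
  node_gt0 : 0 < V.1 i0;
  node_lead : h i0 <= P * (V.1 i0)%:~R;
  node_le : forall i, `|(V.1 i)%:~R : R| <= P * h i;
  node_ev : ev V x = 0;
  node_prim : primitive V;
  node_cov : cov x h K }.

Definition lead V : R := (V.1 i0)%:~R.

(** Coefficients of [W] minus the real multiple of [V] that cancels the one at [i0]: the variation
    of [W] along the hyperplanes where [V] is constant. *)
Definition tl V W i : R := (W.1 i)%:~R - (W.1 i0)%:~R / lead V * (V.1 i)%:~R.

Lemma ev_tl_move V W x x' : ev W x' = ev W x +
  (W.1 i0)%:~R / lead V * (ev V x' - ev V x) + \sum_i tl V W i * (x' i - x i).
Proof.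
rewrite (ev_move W x x') (ev_move V x x') [ev V x + _]addrC addrK mulr_sumr.
rewrite -[RHS]addrA -big_split /=; congr (_ + _).
by apply: eq_bigr => i _; rewrite /tl; ring.
Qed.

Lemma tl0 V W : lead V != 0 -> tl V W i0 = 0.
Proof. by move=> n0; rewrite /tl -/(lead V) divfK ?subrr. Qed.

(** [W] is close to [t] times [V] for a real [t]. Dirichlet gives [j <= J] with [j * t] near an
    integer [k], and then [j W - k V] is too short for a nonzero form, by [cov_first_min]. *)
Lemma node_thin x V h (P K Y : R) (J : nat) W :
    (forall i, 1 <= h i) -> 1 <= K -> node x V h P K -> (0 < J)%N -> 0 <= Y -> 0 < P ->
    (J%:R * (Y * d%:R) + P / J%:R) * (5 ^+ d * 31 * K ^+ d) < 1 ->
    (forall i, i != i0 -> `|tl V W i| <= Y * h i) ->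
    `|ev W x| <= Y * d%:R / \prod_i h i ->
  (forall i, (W.1 i)%:~R = (W.1 i0)%:~R / lead V * (V.1 i)%:~R) /\ ev W x = 0.
Proof.
move=> h1 K1 [Vn0 _ Vle Vx _ Vcov] J0 Y0 P0 cJ Wtl Wx.
have T1 := prod_ge1 h1; have T0 := lt_le_trans ltr01 T1.
have J0R : 0 < J%:R :> R by rewrite ltr0n.
have n0 : 0 < lead V by rewrite /lead ltr0z.
have h0 i : 0 < h i := lt_le_trans ltr01 (h1 i).
set t := (W.1 i0)%:~R / lead V in Wtl *.
have [j [k [/andP[j0 jJ] jk]]] := dirichlet t J0.
have jR : j%:R <= J%:R :> R by rewrite ler_nat.
have d1 : 1 <= d%:R :> R by rewrite ler1n; case: (d) (i0) => // -[].
pose U := W *~ j%:Z - V *~ k.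
have Uc i : (U.1 i)%:~R = j%:R * tl V W i + (j%:R * t - k%:~R) * (V.1 i)%:~R :> R.
  by rewrite /U coefB !coefMz intrB !intrM /tl -/t -pmulrn; ring.
have Ux : ev U x = j%:R * ev W x by rewrite /U evB !evMz Vx mulr0 subr0.
pose del := J%:R * (Y * d%:R) + P / J%:R.
have del0 : 0 < del by rewrite ltr_wpDl ?divr_gt0 // !mulr_ge0.
have Ubox : box (fun i => del * h i) (del / \prod_i h i) x U.
  split=> [i|].
    rewrite Uc; apply: le_trans (ler_normD _ _) _; rewrite !normrM.
    have e1 : `|j%:R| * `|tl V W i| <= J%:R * (Y * d%:R) * h i.
      rewrite normr_nat -mulrA; apply: ler_pM => //.
      have [->|ii0] := eqVneq i i0.
        by rewrite tl0 ?gt_eqF // normr0 !mulr_ge0 // ltW.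
      by apply: le_trans (Wtl i ii0) _; rewrite ler_wpM2r ?(ltW (h0 i)) // ler_peMr.
    have e2 : `|j%:R * t - k%:~R| * `|(V.1 i)%:~R| <= P / J%:R * h i.
      rewrite [P / _]mulrC -mulrA; exact: ler_pM.
    by rewrite /del mulrDl; apply: lerD.
  rewrite Ux normrM normr_nat.
  apply: le_trans (_ : _ <= J%:R * (Y * d%:R / \prod_i h i)) _; first exact: ler_pM.
  rewrite /del !mulrA mulrDl lerDl ?divr_ge0 ?mulr_ge0 ?invr_ge0 ?ltW //.
have U0 : U = 0.
  apply/eqP; apply: contraT => U0.
  by have := cov_first_min h1 K1 Vcov del0 U0 Ubox; rewrite leNgt cJ.
have j0R : j%:R != 0 :> R by rewrite pnatr_eq0 -lt0n.
split; last by move: Ux; rewrite U0 ev0 => /esym/eqP; rewrite mulf_eq0 (negbTE j0R) /= => /eqP.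
have jW i : j%:R * (W.1 i)%:~R = k%:~R * (V.1 i)%:~R :> R.
  have := Uc i; rewrite U0 coef0 /tl -/t => e; apply/eqP; rewrite -subr_eq0.
  by apply/eqP; rewrite [RHS]e; ring.
have tk : t = k%:~R / j%:R.
  rewrite /t; apply: (mulfI j0R); rewrite mulrA jW -/(lead V) mulfK ?gt_eqF //.
  by rewrite mulrC divfK.
by move=> i; rewrite tk; apply: (mulfI j0R); rewrite jW; field.
Qed.

End Nodes.

(** * The grid of points near the hyperplane *)

Section Grid.
Variables (R : realType) (d : nat) (i0 : 'I_d).
Implicit Types (x h : 'I_d -> R) (V W : form d).

Definition frac M (g : {ffun 'I_d -> 'I_M}) i : R := (g i)%:R / M%:R.

Definition slope V x h M (g : {ffun 'I_d -> 'I_M}) : R :=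
  \sum_(i | i != i0) (V.1 i)%:~R * (frac g i / (\prod_i h i * h i)).

(* A grid in the part of the box around [x] where [V] takes values between
   [s / (2 T')] and [s / T']: the coordinates other than [i0] range over a box
   and the coordinate [i0] is then determined by the value of [V]. *)
Definition pt V x h (T' s : R) M (g : {ffun 'I_d -> 'I_M}) i : R :=
  x i + if i == i0
        then (s * (1 + frac g i0) / 2 / T' - slope V x h g) / lead R i0 V
        else frac g i / (\prod_i h i * h i).

Lemma frac_bounds M (g : {ffun 'I_d -> 'I_M}) i : 0 <= frac g i < 1.
Proof.
rewrite /frac divr_ge0 //= ltr_pdivrMr ?mul1r ?ltr_nat ?ltr0n //.
by apply: leq_ltn_trans (ltn_ord (g i)).
Qed.

Lemma ev_ptV V x h T' s M (g : {ffun 'I_d -> 'I_M}) : lead R i0 V != 0 ->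
  ev V (pt V x h T' s g) = ev V x + s * (1 + frac g i0) / 2 / T'.
Proof.
move=> n0; rewrite (ev_move V x); congr (_ + _).
rewrite (bigD1 i0) //= /pt eqxx addrAC subrr add0r mulrC divfK //.
rewrite [X in _ + X](eq_bigr (fun i => (V.1 i)%:~R * (frac g i / (\prod_i h i * h i)))); last first.
  by move=> i /negbTE ->; rewrite addrAC subrr add0r.
by rewrite subrK.
Qed.

Lemma ev_pt V W x h T' s M (g : {ffun 'I_d -> 'I_M}) : lead R i0 V != 0 ->
  ev W (pt V x h T' s g) = ev W x +
    (W.1 i0)%:~R / lead R i0 V * (s * (1 + frac g i0) / 2 / T') +
    \sum_(i | i != i0) tl R i0 V W i * (frac g i / (\prod_i h i * h i)).
Proof.
move=> n0; rewrite (ev_tl_move i0 V W x) ev_ptV // [_ - ev V x]addrAC subrr add0r.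
congr (_ + _); rewrite (bigD1 i0) //= tl0 // mul0r add0r.
by apply: eq_bigr => i /negbTE ii; rewrite /pt ii addrAC subrr add0r.
Qed.

Lemma ev_pt_line V W x h T' s M (g g' : {ffun 'I_d -> 'I_M}) k :
    lead R i0 V != 0 -> k != i0 -> (forall i, i != k -> g i = g' i) ->
  ev W (pt V x h T' s g) - ev W (pt V x h T' s g') =
  tl R i0 V W k * ((g k)%:R - (g' k)%:R) / (M%:R * (\prod_i h i * h k)).
Proof.
move=> n0 kk gg; have gi0 : g i0 = g' i0 by rewrite gg // eq_sym.
rewrite !ev_pt // /frac gi0 opprD addrACA subrr add0r -sumrB (bigD1 k) //=.
rewrite [X in _ + X]big1 ?addr0; last by move=> i /andP[_ ik]; rewrite gg // subrr.
by rewrite [in RHS]invfM; ring.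
Qed.

End Grid.

(** * Union bound over the forms that are short at height [C * T] *)

Section BadPoints.
Variables (R : realType) (d : nat) (i0 i2 : 'I_d).
Hypothesis i20 : i2 != i0.
Variables (x h lam : 'I_d -> R) (V : form d) (P K A P1 Y1 beta : R).
Variables (J M E : nat).
Hypothesis h1 : forall i, 1 <= h i.
Hypothesis K1 : 1 <= K.
Hypothesis P_ge1 : 1 <= P.
Hypothesis nodeV : node i0 x V h P K.
Hypothesis A2 : 2 < A.
Hypothesis lam1 : forall i, 1 <= lam i.
Hypothesis P1P : P <= P1.
Hypothesis P1K : K <= P1.
Hypothesis Y10 : 0 < Y1.
Hypothesis J0 : (0 < J)%N.
Hypothesis thin : (J%:R * (Y1 * d%:R) + P / J%:R) * (5 ^+ d * 31 * K ^+ d) < 1.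
Let T := \prod_i h i.
Let C := \prod_i lam i.
Hypothesis lamK : forall i, K * A <= lam i.
Hypothesis Y1C : (lam i0 * P + 1) / C <= Y1.
Hypothesis E_big : 2 * P ^+ 2 * C < P1 * A ^+ E.
Hypothesis M_big : 2 * P ^+ 2 * C ^+ 2 * A <= M%:R.
Hypothesis beta0 : (2 * (lam i0 * P) + 2) *
  (5 ^+ d * 30 * (2 ^+ d * P1 ^+ d * (d%:R * P1))) * (3 / (C * Y1)) <= beta.
Hypothesis beta1 : 5 ^+ d * 90 * d%:R * A^-1 ^+ d <= beta.

Let h' i := lam i * h i.
Let q (g : {ffun 'I_d -> 'I_M}) := pt i0 V x h (C * T) 1 g.

Definition bad_point (g : {ffun 'I_d -> 'I_M}) := exists W : form d,
  W != 0 /\ box (fun i => A^-1 * h' i) (A^-1 / (C * T)) (q g) W.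

Let T1 : 1 <= T. Proof. exact: prod_ge1. Qed.
Let C1 : 1 <= C. Proof. exact: prod_ge1. Qed.
Let T0 : 0 < T := lt_le_trans ltr01 T1.
Let C0 : 0 < C := lt_le_trans ltr01 C1.
Let A0 : 0 < A. Proof. by apply: lt_trans A2. Qed.
Let Ainv1 : A^-1 <= 1. Proof. by rewrite invf_le1 // ltW // (lt_trans _ A2) // ltr1n. Qed.
Let P0 : 0 < P := lt_le_trans ltr01 P_ge1.
Let P10 : 0 < P1 := lt_le_trans P0 P1P.
Let h0 i : 0 < h i. Proof. exact: lt_le_trans ltr01 (h1 i). Qed.
Let lam0 i : 0 < lam i. Proof. exact: lt_le_trans ltr01 (lam1 i). Qed.
Let n0 : 0 < lead R i0 V. Proof. by rewrite /lead ltr0z; case: nodeV. Qed.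
Let n_ne : lead R i0 V != 0. Proof. by rewrite gt_eqF. Qed.
Let Vx : ev V x = 0. Proof. by case: nodeV. Qed.
Let Vle i : `|(V.1 i)%:~R : R| <= P * h i. Proof. by case: nodeV. Qed.
Let M0 : 0 < M%:R :> R.
Proof. by apply: lt_le_trans M_big; rewrite !mulr_gt0 ?exprn_gt0. Qed.
Let d1 : 1 <= d%:R :> R.
Proof. by rewrite ler1n; case: (d) (i0) => // -[]. Qed.
Let th (W : form d) : R := (W.1 i0)%:~R / lead R i0 V.

Let lamC i : lam i <= C.
Proof.
rewrite /C (bigD1 i) //= ler_peMr ?(le_trans ler01) //.
by elim/big_rec: _ => // j y _ y1; rewrite mulr_ege1.
Qed.

Lemma th_bound (W : form d) : `|(W.1 i0)%:~R : R| <= A^-1 * h' i0 -> `|th W| <= A^-1 * lam i0 * P.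
Proof.
move=> W0; rewrite /th normrM normfV (gtr0_norm n0) ler_pdivrMr //.
apply: le_trans W0 _; rewrite /h' [leLHS]mulrA -[leRHS]mulrA ler_pM2l ?mulr_gt0 ?invr_gt0 ?lam0 //.
by case: nodeV.
Qed.

(** If every [tl] were below [Y1], then [node_thin] would make [W] a multiple of [V], by a factor at
    least 1 in absolute value because [V] is primitive; but [V] is at least [1 / (2 * C * T)] at the
    grid points, more than a short form may be. The bound at [x] comes from expanding the small
    value at [q g]. *)
Lemma bad_witness g : bad_point g -> exists W i,
  [/\ i != i0, box (fun i => A^-1 * h' i) (A^-1 / (C * T)) (q g) W,
      Y1 <= `|tl R i0 V W i| / h i,
      forall j, j != i0 -> `|tl R i0 V W j| / h j <= `|tl R i0 V W i| / h i &
      `|ev W x| <= d%:R * (`|tl R i0 V W i| / h i) / T].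
Proof.
move=> [W [W0 Wbox]]; have [Wa Wv] := Wbox.
pose i := [arg max_(i > i2 | i != i0) (`|tl R i0 V W i| / h i)]%O.
have [i_ne imax] : i != i0 /\ forall j, j != i0 -> `|tl R i0 V W j| / h j <= `|tl R i0 V W i| / h i.
  by rewrite /i; case: arg_maxP.
exists W, i; set Y := `|tl R i0 V W i| / h i in imax *.
have Ybd j : j != i0 -> `|tl R i0 V W j| <= Y * h j.
  by move=> jj; rewrite -ler_pdivrMr // imax.
have Y0 : 0 <= Y by rewrite divr_ge0 // ltW.
have evx : `|ev W x| <= ((lam i0 * P + 1) / C + (d%:R - 1) * Y) / T.
  move: Wv; rewrite /q ev_pt //; set a := th W * _; set b := \sum_(j | _) _ => Wv.
  have -> : ev W x = (ev W x + a + b) - a - b by ring.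
  have ab : `|a| <= lam i0 * P / C / T.
    have /andP[? ?] := frac_bounds R g i0.
    have -> : a = th W * ((1 + frac R g i0) / 2) / C / T by rewrite /a; field; rewrite !gt_eqF.
    have [u [-> f0 f1]] : exists u, [/\ (1 + frac R g i0) / 2 = u, 0 <= u & u <= 1].
      by exists ((1 + frac R g i0) / 2); split=> //; lra.
    have : `|th W| <= lam i0 * P.
      by apply: le_trans (th_bound (Wa i0)) _; rewrite ler_pM2r // ler_piMl ?(ltW (lam0 i0)).
    move: (th W) => t tb.
    rewrite !normrM !normfV (gtr0_norm C0) (gtr0_norm T0) (ger0_norm f0).
    rewrite ler_pM2r ?invr_gt0 // ler_pM2r ?invr_gt0 // -[leRHS]mulr1; exact: ler_pM.
  have bb : `|b| <= (d%:R - 1) * Y / T.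
    apply: le_trans (ler_norm_sum _ _ _) _.
    apply: le_trans (_ : _ <= \sum_(j | j != i0) Y / T) _.
      apply: ler_sum => j jj; rewrite normrM.
      have /andP[f0 f1] := frac_bounds R g j.
      have Th0 : 0 < T * h j by rewrite mulr_gt0.
      have fge : 0 <= frac R g j / (T * h j) by rewrite divr_ge0 // ltW.
      rewrite -/T (ger0_norm fge).
      apply: le_trans (_ : _ <= (Y * h j) * (1 / (T * h j))) _.
        apply: ler_pM => //; first exact: Ybd.
        by rewrite ler_pM2r ?invr_gt0 // ltW.
      by rewrite le_eqVlt; apply/orP; left; apply/eqP; field; rewrite !gt_eqF.
    rewrite sumr_const cardC1 card_ord -mulrA -[X in X <= _]mulr_natl.
    have dn : (1 <= d)%N by rewrite -(ler_nat R).
    by rewrite -subn1 natrB.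
  have e1 : A^-1 / (C * T) <= 1 / C / T.
    by rewrite invfM !mulrA ler_pM2r ?invr_gt0 // ler_pM2r ?invr_gt0.
  apply: le_trans (ler_normB _ _) _; apply: le_trans (lerD (ler_normB _ _) (lexx _)) _.
  have := le_trans Wv e1; rewrite !mulrDl; lra.
have notthin : Y1 <= Y.
  rewrite leNgt; apply/negP => YY1.
  have Ysm j : j != i0 -> `|tl R i0 V W j| <= Y1 * h j.
    by move=> jj; apply: le_trans (Ybd j jj) _; rewrite ler_pM2r // ltW.
  have Wx : `|ev W x| <= Y1 * d%:R / T.
    apply: le_trans evx _; rewrite ler_pM2r ?invr_gt0 //.
    have : (d%:R - 1) * Y <= (d%:R - 1) * Y1 by rewrite ler_wpM2l ?subr_ge0 // ltW.
    by move: Y1C; lra.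
  have [Wpar Wx0] := node_thin h1 K1 nodeV J0 (ltW Y10) P0 thin Ysm Wx.
  have W2 : (W.2)%:~R = th W * (V.2)%:~R.
    have : ev W x - th W * ev V x = 0 by rewrite Wx0 Vx mulr0 subr0.
    rewrite /ev mulrDr mulr_sumr opprD addrACA -sumrB big1 ?add0r; last first.
      by move=> j _; rewrite Wpar -/(th W); ring.
    by move/eqP; rewrite subr_eq0 => /eqP.
  case: nodeV => _ _ _ _ prV _; have [t0|t1] := prV W (th W) Wpar W2.
    case/eqP: W0; apply: (form_eqP (x := x)); last by rewrite Wx0 ev0.
    move=> j; apply: (@intr_inj R); rewrite Wpar -/(th W) t0 mul0r coef0.
    by [].
  have evW : ev W (q g) = th W * ev V (q g).
    by rewrite /ev mulrDr mulr_sumr W2; congr (_ + _); apply: eq_bigr => j _; rewrite Wpar -/(th W) mulrA.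
  move: Wv; rewrite evW ev_ptV // Vx add0r normrM leNgt => /negP; apply.
  have /andP[f0 f1] := frac_bounds R g i0.
  have g0 : 0 < 1 * (1 + frac R g i0) / 2 / (C * T) by rewrite divr_gt0 ?mulr_gt0 //; lra.
  apply: lt_le_trans (_ : 1 * (1 * (1 + frac R g i0) / 2 / (C * T)) <= _); last first.
    by rewrite (gtr0_norm g0) ler_pM2r.
  rewrite mul1r ltr_pM2r ?invr_gt0 ?mulr_gt0 //.
  have : A^-1 < 2^-1 by rewrite ltf_pV2 ?posrE.
  lra.
split => //.
apply: le_trans evx _; rewrite ler_pM2r ?invr_gt0 //.
by move: Y1C notthin; lra.
Qed.

(** Across the grid in direction [i], at constant [V], the value of [W] varies by [Y / T], so [W] is
    short only on a proportion about [1 / (A * C * Y)] of each line. [M_big] makes the mesh finer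
    than that. *)
Lemma slab_count (W : form d) i (Y : R) : i != i0 ->
    `|tl R i0 V W i| = Y * h i -> 0 < Y -> Y <= 2 * P ^+ 2 * C ->
  #|[set g | `|ev W (q g)| <= A^-1 / (C * T)]|%:R <= M%:R ^+ d * (3 / (A * (C * Y))).
Proof.
move=> ii tY Y0 Ybig; have Th0 : 0 < T * h i by rewrite mulr_gt0.
have ACY : 0 < A * (C * Y) by rewrite !mulr_gt0.
pose l j := if j == i then 2 * (M%:R / (A * (C * Y))) else M%:R - 1.
have M1 : 1 <= M%:R :> R by rewrite ler1n -(ltr_nat R).
have l0 j : 0 <= l j.
  by rewrite /l; case: eqP => _; rewrite ?subr_ge0 // !mulr_ge0 ?invr_ge0 // ltW.
have gM (g : {ffun 'I_d -> 'I_M}) j : 0 <= (g j)%:R :> R /\ (g j)%:R <= M%:R - 1 :> R.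
  by rewrite ler0n lerBrDr natr1 ler_nat.
apply: le_trans (grid_count (k := i) l0 _ _) _.
- move=> g g' j _ _ ji; rewrite /l (negbTE ji).
  by have [? ?] := gM g j; have [? ?] := gM g' j; rewrite ler_norml; apply/andP; split; lra.
- move=> g g'; rewrite !inE => Wg Wg' gg.
  have := ev_pt_line W x h (C * T) 1 n_ne ii gg; rewrite -/(q g) -/(q g') => e.
  have : `|ev W (q g) - ev W (q g')| <= 2 * (A^-1 / (C * T)).
    by apply: le_trans (ler_normB _ _) _; lra.
  rewrite e !normrM normfV -/T tY (gtr0_norm (_ : 0 < M%:R * (T * h i))) ?mulr_gt0 //.
  rewrite ler_pdivrMr ?mulr_gt0 // mulrC -ler_pdivlMr ?mulr_gt0 // => /le_trans; apply.
  rewrite /l eqxx le_eqVlt; apply/orP; left; apply/eqP; field.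
  by rewrite !gt_eqF.
rewrite (bigD1 i) //= /l eqxx (eq_bigr (fun=> M%:R)); last first.
  by move=> j /negbTE->; rewrite subrK.
rewrite prodr_const cardC1 card_ord -[in X in _ <= X](prednK (_ : (0 < d)%N)) ?(leq_ltn_trans _ (ltn_ord i)) //.
rewrite exprS mulrAC ler_pM2r ?exprn_gt0 //.
suff : 1 <= M%:R / (A * (C * Y)) by lra.
rewrite ler_pdivlMr // mul1r; apply: le_trans M_big.
have -> : 2 * P ^+ 2 * C ^+ 2 * A = A * (C * (2 * P ^+ 2 * C)) by ring.
by rewrite !ler_pM2l.
Qed.

(** Multiplied by the proportion of [slab_count] for [Y] at least [Z / A], the factors [C] and [Z]
    disappear and [A^-1 ^+ d] remains up to a constant: this is [beta1]. *)
Lemma class_count (s : seq (form d)) (Z : R) : P1 <= Z -> uniq s ->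
    (forall W, W \in s -> box (fun i => A^-1 * h' i) (d%:R * Z / T) x W) ->
  (size s)%:R <= 5 ^+ d * 30 * (A^-1 ^+ d * C * (d%:R * Z)).
Proof.
move=> PZ us sbox; have covV : cov x h K by case: nodeV.
have Z0 : 0 < Z := lt_le_trans P10 PZ.
apply: le_trans (cov_count h1 K1 covV _ _ us sbox) _.
- by move=> i; rewrite /h' mulrA ler_pM2r // mulrC ler_pdivlMr // lamK.
- rewrite -/T ler_pM2r ?invr_gt0 //; apply: le_trans P1K _; apply: le_trans PZ _.
  by rewrite ler_peMl // ltW.
rewrite le_eqVlt; apply/orP; left; apply/eqP; rewrite prod_scale /h' big_split /=.
by rewrite -/C -/T; field; rewrite gt_eqF.
Qed.

(** These forms fill a tube around the real multiples of [V], long in one direction only, which a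
    box would overcount. It is cut according to the integer part [k] of [th W], and each piece is
    brought back to a box of sides [2 * P1 * h i] by subtracting [V *~ k]. *)
Lemma tube_count (s : seq (form d)) : uniq s ->
    (forall W, W \in s -> `|(W.1 i0)%:~R : R| <= A^-1 * h' i0) ->
    (forall W, W \in s -> forall j, j != i0 -> `|tl R i0 V W j| <= P1 * h j) ->
    (forall W, W \in s -> `|ev W x| <= d%:R * P1 / T) ->
  (size s)%:R <= (2 * (lam i0 * P) + 2) *
    (5 ^+ d * 30 * (2 ^+ d * P1 ^+ d * (d%:R * P1))).
Proof.
move=> us sa stl sev; have covV : cov x h K by case: nodeV.
pose N := Num.truncn (lam i0 * P).
have lP0 : 0 <= lam i0 * P by rewrite mulr_ge0 // ltW.
have [N1 N2] := truncn_bounds lP0; rewrite -/N in N1 N2.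
pose ks := [seq k%:Z - N.+1%:Z | k <- iota 0 (2 * N).+2].
pose key (W : form d) := Num.floor (th W).
have sks : (size ks)%:R <= 2 * (lam i0 * P) + 2.
  by rewrite size_map size_iota -addn2 natrD natrM; lra.
set F := 5 ^+ d * 30 * _.
have F0 : 0 <= F by rewrite /F !mulr_ge0 ?exprn_ge0 // ltW.
have keyin : {in s, forall W, key W \in ks}.
  move=> W Ws; have tb : `|th W| <= lam i0 * P.
    apply: le_trans (th_bound (sa W Ws)) _; rewrite -mulrA ler_piMl //.
  have [f1 f2] := floor_bounds (th W).
  have b1 : - N.+1%:Z <= key W.
    rewrite -ltzD1 -(ltr_int R) intrD1 mulrNz -pmulrn -natr1.
    by move: tb; rewrite ler_norml /key => /andP[? ?]; lra.
  have b2 : key W <= N%:Z.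
    rewrite -ltzD1 -(ltr_int R) intrD1 -pmulrn.
    by move: tb; rewrite ler_norml /key => /andP[? ?]; lra.
  apply/mapP; exists (`|(key W + N.+1%:Z)%R|%N).
    by rewrite mem_iota add0n; clear -b1 b2; move: (key W) b1 b2 => k; lia.
  by clear -b1; move: (key W) b1 => k; lia.
apply: le_trans (size_le_fibersR F0 keyin _) _; last by rewrite ler_wpM2r.
move=> k _; set sk := [seq W <- s | _].
have usk : uniq [seq W - V *~ k | W <- sk].
  by rewrite map_inj_uniq ?filter_uniq // => W W' /addIr.
have skbox U : U \in [seq W - V *~ k | W <- sk] ->
    box (fun i => 2 * P1 * h i) (d%:R * P1 / T) x U.
  move=> /mapP[W]; rewrite mem_filter => /andP[/eqP kW Ws] ->.
  have [f1 f2] := floor_bounds (th W); rewrite -/(key W) kW in f1 f2.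
  split=> [i|]; last by rewrite evB evMz Vx mulr0 subr0 sev.
  have -> : ((W - V *~ k).1 i)%:~R = tl R i0 V W i + (th W - k%:~R) * (V.1 i)%:~R :> R.
    by rewrite coefB coefMz intrB intrM /tl -/(th W); ring.
  apply: le_trans (ler_normD _ _) _; rewrite normrM -mulrA mulr2n mulrDl mul1r.
  have e1 : `|tl R i0 V W i| <= P1 * h i.
    have [->|/stl] := eqVneq i i0; last by apply.
    by rewrite tl0 // normr0 mulr_ge0 // ltW.
  apply: lerD => //; rewrite -[leRHS]mul1r; apply: ler_pM => //.
    by rewrite ler_norml; apply/andP; split; lra.
  by apply: le_trans (Vle i) _; rewrite ler_pM2r.
rewrite -(size_map (fun W => W - V *~ k)).
have KP : K <= 2 * P1 by have := P1K; have := P10; lra.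
apply: le_trans (cov_count h1 K1 covV _ _ usk skbox) _.
- by move=> i; rewrite ler_pM2r.
- rewrite -/T ler_pM2r ?invr_gt0 //; apply: le_trans P1K _.
  by rewrite ler_peMl // ltW.
rewrite le_eqVlt; apply/orP; left; apply/eqP; rewrite prod_scale exprMn /F -/T.
by field; rewrite gt_eqF.
Qed.

Lemma bad_count (Bad : {set {ffun 'I_d -> 'I_M}}) :
  (forall g, g \in Bad -> bad_point g) -> #|Bad|%:R <= E.+1%:R * (beta * M%:R ^+ d).
Proof.
move=> badP.
pose Yw (p : form d * 'I_d) := `|tl R i0 V p.1 p.2| / h p.2.
pose good (p : form d * 'I_d) g :=
  [/\ p.2 != i0, box (fun i => A^-1 * h' i) (A^-1 / (C * T)) (q g) p.1,
      Y1 <= Yw p, forall j, j != i0 -> `|tl R i0 V p.1 j| / h j <= Yw p &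
      `|ev p.1 x| <= d%:R * Yw p / T].
have /choice[w wP] g : exists p, g \in Bad -> good p g.
  have [/badP/bad_witness[W [i [? ? ? ? ?]]]|_] := boolP (g \in Bad).
    by exists (W, i).
  by exists (0, i0).
(* Class 0 is the range from [Y1] to [P1], left to [tube_count]; the others are geometric of ratio
   [A], and [E_big] makes [E] of them enough. *)
pose incls p c := match c with
  | 0%N => Yw p <= P1
  | j.+1 => P1 * A ^+ j <= Yw p <= P1 * A ^+ j.+1 end.
have Ymax g : g \in Bad -> Yw (w g) <= 2 * P ^+ 2 * C.
  move=> /wP; case: (w g) => W i [/= ii [Wa _] _ _ _].
  rewrite /Yw /= ler_pdivrMr // /tl -/(th W).
  apply: le_trans (ler_normB _ _) _; rewrite normrM.
  have P2 : 1 <= P ^+ 2 by rewrite exprn_ege1.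
  have e1 : `|(W.1 i)%:~R : R| <= P ^+ 2 * C * h i.
    apply: le_trans (Wa i) _; rewrite /h' mulrA ler_pM2r //.
    apply: le_trans (_ : lam i <= _); first by rewrite ler_piMl // ltW.
    by apply: le_trans (lamC i) _; rewrite ler_peMl // ltW.
  have e2 : `|th W| * `|(V.1 i)%:~R| <= P ^+ 2 * C * h i.
    have -> : P ^+ 2 * C * h i = (C * P) * (P * h i) by ring.
    apply: ler_pM => //; apply: le_trans (th_bound (Wa i0)) _; rewrite ler_pM2r //.
    by apply: le_trans (lamC i0); rewrite ler_piMl // ltW.
  by lra.
have /choice[cls clsP] g : exists c, g \in Bad -> (c < E.+1)%N /\ incls (w g) c.
  have [gB|_] := boolP (g \in Bad); last by exists 0%N.
  have [YP|PY] := leP (Yw (w g)) P1; first by exists 0%N.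
  have [||j jE /andP[Aj Aj1]] := @log_class _ A (Yw (w g) / P1) E.
  - by rewrite ler_pdivlMr // mul1r ltW.
  - by rewrite ltr_pdivrMr // [_ * P1]mulrC; apply: le_lt_trans (Ymax g gB) E_big.
  exists j.+1 => _; split=> //=; move: Aj Aj1.
  by rewrite ler_pdivlMr // ltr_pdivrMr // ![P1 * _]mulrC => -> /ltW->.
have bM0 : 0 <= beta * M%:R ^+ d.
  rewrite mulr_ge0 ?exprn_ge0 //; apply: le_trans beta1.
  by rewrite !mulr_ge0 ?exprn_ge0 ?invr_ge0 // ltW.
rewrite -[X in X%:R * _](size_iota 0).
apply: (card_le_fibersR (f := cls)) => // [g gB|c cE].
  by rewrite mem_iota; have [] := clsP g gB.
set Yc := [set g in Bad | _].
have YcP g : g \in Yc -> [/\ g \in Bad, good (w g) g & incls (w g) c].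
  by rewrite inE => /andP[gB /eqP gc]; have [_] := clsP g gB; rewrite gc; split=> //; apply: wP.
pose ks := undup [seq (w g).1 | g <- enum Yc].
have uks : uniq ks by rewrite undup_uniq.
have ksP W : W \in ks -> exists2 g, g \in Yc & W = (w g).1.
  by rewrite mem_undup => /mapP[g]; rewrite mem_enum => gY ->; exists g.
have ksin : {in Yc, forall g, (w g).1 \in ks}.
  by move=> g gY; rewrite mem_undup; apply/mapP; exists g; rewrite ?mem_enum.
pose Ylow := if c is j.+1 then P1 * A ^+ j else Y1.
have Ylow0 : 0 < Ylow by rewrite /Ylow; case: (c) => // j; rewrite mulr_gt0 ?exprn_gt0.
have Ylowle g : g \in Yc -> Ylow <= Yw (w g).
  by move=> /YcP[_ [_ _ ? _ _]]; rewrite /Ylow /incls; case: (c) => // j /andP[].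
pose F := M%:R ^+ d * (3 / (A * (C * Ylow))).
have F0 : 0 <= F by rewrite mulr_ge0 ?exprn_ge0 // divr_ge0 // !mulr_ge0 // ltW.
have fibF W : W \in ks -> #|[set g in Yc | (w g).1 == W]|%:R <= F.
  move=> /ksP[g0 g0Y ->]; have [g0B [ii _ Y1w _ _] _] := YcP _ g0Y.
  have Yw0 : 0 < Yw (w g0) := lt_le_trans Y10 Y1w.
  apply: le_trans (_ : _ <= M%:R ^+ d * (3 / (A * (C * Yw (w g0))))) _; last first.
    have e1 : 0 < A * (C * Ylow) by apply: mulr_gt0 => //; apply: mulr_gt0.
    have e2 : 0 < A * (C * Yw (w g0)) by apply: mulr_gt0 => //; apply: mulr_gt0.
    rewrite ler_pM2l ?exprn_gt0 // ler_pM2l // lef_pV2 ?posrE //.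
    by rewrite !ler_pM2l // Ylowle.
  have tY : `|tl R i0 V (w g0).1 (w g0).2| = Yw (w g0) * h (w g0).2.
    by rewrite /Yw divfK // gt_eqF.
  apply: le_trans (slab_count ii tY Yw0 (Ymax _ g0B)).
  rewrite ler_nat; apply: subset_leq_card; apply/fintype.subsetP => g; rewrite !inE => /andP[gYc /eqP gW].
  have [] := YcP g; first by rewrite inE.
  by move=> _ [_ [_ +] _ _ _] _; rewrite gW.
apply: le_trans (card_le_fibersR F0 ksin fibF) _.
have Md : 0 < M%:R ^+ d :> R by rewrite exprn_gt0.
have Fdef : F = M%:R ^+ d * (3 / (A * (C * Ylow))) by [].
have Ydef : Ylow = if c is j.+1 then P1 * A ^+ j else Y1 by [].
clearbody F Ylow; clear fibF ksin.
have d0 : 0 < d%:R :> R := lt_le_trans ltr01 d1.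
case: c {cE} Yc @ks uks ksP YcP Ydef Ylowle => [|j] Yc ks uks ksP YcP Ydef _.
  have tube : (size ks)%:R <= (2 * (lam i0 * P) + 2) *
    (5 ^+ d * 30 * (2 ^+ d * P1 ^+ d * (d%:R * P1))).
    apply: tube_count => // W /ksP[g /YcP[_ [ii [Wa _] _ Wmax Wx] YP] ->] //.
      move=> j jj; rewrite -ler_pdivrMr //; exact: le_trans (Wmax j jj) YP.
    by apply: le_trans Wx _; rewrite ler_pM2r ?invr_gt0 // ler_wpM2l.
  apply: le_trans (ler_wpM2r F0 tube) _.
  rewrite Fdef Ydef mulrCA [beta * _]mulrC ler_pM2l //; apply: le_trans beta0.
  apply: ler_wpM2l.
    rewrite !mulr_ge0 ?exprn_ge0 ?addr_ge0 ?mulr_ge0 // ?(ltW P0) ?(ltW P10) ?(ltW (lam0 i0)) //.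
  have CY0 : 0 < C * Y1 by apply: mulr_gt0.
  rewrite ler_pM2l // lef_pV2 ?posrE // ?mulr_gt0 // ler_peMl ?(ltW CY0) //.
  by rewrite ltW // (lt_trans _ A2) // ltr1n.
have PA : P1 <= P1 * A ^+ j.+1.
  rewrite ler_peMr ?(ltW P10) // exprn_ege1 // ltW // (lt_trans _ A2) // ltr1n //.
have kbox W : W \in ks -> box (fun i => A^-1 * h' i) (d%:R * (P1 * A ^+ j.+1) / T) x W.
  move=> /ksP[g /YcP[_ [ii [Wa _] _ _ Wx] /andP[_ YP]] ->]; split=> //.
  by apply: le_trans Wx _; rewrite ler_pM2r ?invr_gt0 // ler_wpM2l.
apply: le_trans (ler_wpM2r F0 (class_count PA uks kbox)) _.
rewrite [beta * _]mulrC Fdef Ydef mulrCA ler_pM2l //; apply: le_trans beta1.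
rewrite exprS le_eqVlt; apply/orP; left; apply/eqP; field.
by rewrite !gt_eqF ?exprn_gt0.
Qed.

End BadPoints.

(** * Choice of the next form; stability of the covering radius *)

Section NextForm.
Variables (R : realType) (d : nat) (i0 : 'I_d).
Implicit Types (x h : 'I_d -> R) (V W : form d).

(** [W] is an integer form on the real line of [V] with the least positive [i0]-th coefficient. *)
Lemma primitive_part V : 0 < V.1 i0 -> exists W (t : R),
  [/\ primitive R W, 0 < W.1 i0, 1 <= t,
      forall i, (V.1 i)%:~R = t * (W.1 i)%:~R & (V.2)%:~R = t * (W.2)%:~R].
Proof.
move=> V0.
pose par W := exists2 t : R, forall i, (W.1 i)%:~R = t * (V.1 i)%:~R &
  (W.2)%:~R = t * (V.2)%:~R.
pose Q : pred nat := fun m => `[< exists W : form d, W.1 i0 = m.+1%:Z /\ par W >].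
have exQ : exists m, Q m.
  exists (`|V.1 i0|.-1)%N; apply/asboolP; exists V; split.
    by clear -V0; move: (V.1 i0) V0 => -[[|m]|m].
  by exists 1 => [i|]; rewrite mul1r.
case: (ex_minnP exQ) => m /asboolP[W [W0 [t Wt Wt2]]] minm.
have V0R : 0 < (V.1 i0)%:~R :> R by rewrite ltr0z.
have W0R : 0 < (W.1 i0)%:~R :> R by rewrite ltr0z W0.
have t0 : 0 < t by have := W0R; rewrite Wt pmulr_lgt0.
have smaller (U : form d) (s : R) : (forall i, (U.1 i)%:~R = s * (W.1 i)%:~R :> R) ->
    (U.2)%:~R = s * (W.2)%:~R :> R -> 0 < s -> 1 <= s.
  move=> Us Us2 s0; rewrite leNgt; apply/negP => s1.
  have U0 : 0 < U.1 i0 by rewrite -(ltr0z R) Us mulr_gt0.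
  have Ulow : U.1 i0 < W.1 i0 by rewrite -(ltr_int R) Us gtr_pMl.
  have : Q (`|U.1 i0|.-1)%N.
    apply/asboolP; exists U; split.
      by clear -U0; move: (U.1 i0) U0 => -[[|k]|k].
    by exists (s * t) => [i|]; rewrite ?Us ?Us2 ?Wt ?Wt2 mulrA.
  move/minm; rewrite W0 in Ulow; clear -U0 Ulow.
  by move: (U.1 i0) U0 Ulow => -[[|k]|k] //=; lia.
exists W, t^-1; split => //.
- move=> U s Us Us2; have [s0|s0|->] := ltgtP s 0; [right|right|by left].
    rewrite ltr0_norm //; apply: (smaller (- U)) => [i||].
    - by rewrite -[(- U).1 i]/((fun_of_fin (- U.1)) i) ffunE rmorphN /= Us mulNr.
    - by rewrite rmorphN /= Us2 mulNr.
    - by rewrite oppr_gt0.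
  by rewrite gtr0_norm //; apply: smaller Us Us2 s0.
- by rewrite W0.
- apply: (smaller V); last by rewrite invr_gt0.
    by move=> i; rewrite Wt mulKf // gt_eqF.
  by rewrite Wt2 mulKf // gt_eqF.
- by move=> i; rewrite Wt mulKf // gt_eqF.
- by rewrite Wt2 mulKf // gt_eqF.
Qed.

(** The covering radius provides an integer form [U] near a target with large coefficients at [i0]
    and [i2]. Its primitive part [W] loses only a factor at most [P], since otherwise [W] would be
    short enough for [minA]. *)
Lemma good_next (y h : 'I_d -> R) V (A Ka : R) (i2 : 'I_d) :
    (forall i, 1 <= h i) -> 1 <= A -> 1 <= Ka -> cov y h Ka -> i2 != i0 ->
    0 < lead R i0 V ->
    (forall W, box (fun i => A^-1 * h i) (A^-1 / \prod_i h i) y W -> W = 0) ->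
  let P := (3 * Ka + 1) * A in
  exists W, [/\ primitive R W, 0 < W.1 i0, h i0 <= P * lead R i0 W,
    forall i, `|(W.1 i)%:~R : R| <= P * h i &
    `|ev W y| <= P / \prod_i h i /\ h i2 <= P * `|tl R i0 V W i2|].
Proof.
move=> h1 A1 Ka1 ycov i20 n0 minA P.
have A0 : 0 < A := lt_le_trans ltr01 A1.
have h0 i : 0 < h i := lt_le_trans ltr01 (h1 i).
have T0 : 0 < \prod_i h i by apply: prodr_gt0.
pose s : R := (V.1 i2)%:~R / lead R i0 V.
pose H := 2 * Ka + 1; have H0 : 0 < H by rewrite /H; lra.
(* The sign at [i2] is opposite to that of [s], so that the two terms of [tl] at [i2] reinforce each
   other; [H] exceeds the error [Ka] by [Ka + 1]. *)
pose tgt i := if i == i0 then H * h i0 else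
  if i == i2 then (if 0 <= s then - (H * h i2) else H * h i2) else 0.
have [U [Ua Uv]] := ycov tgt 0.
have U0 : (Ka + 1) * h i0 <= (U.1 i0)%:~R <= (3 * Ka + 1) * h i0.
  have := Ua i0; rewrite /tgt eqxx /H ler_norml => /andP[? ?].
  by apply/andP; split; lra.
have Ui i : `|(U.1 i)%:~R| <= (3 * Ka + 1) * h i.
  have tgti : `|tgt i| <= H * h i.
    have Hh : 0 < H * h i by rewrite mulr_gt0.
    rewrite /tgt; case: eqP => [->|_]; first by rewrite ger0_norm // mulr_ge0 // ltW.
    case: eqP => [<-|_]; last by rewrite normr0 ltW.
    by case: ifP => _; rewrite ?normrN (gtr0_norm Hh).
  have := Ua i; move: tgti; rewrite /H !ler_norml => /andP[? ?] /andP[? ?].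
  by apply/andP; split; lra.
have U0z : 0 < U.1 i0.
  rewrite -(ltr0z R); case/andP: U0 => /(lt_le_trans _) + _; apply.
  by rewrite mulr_gt0 //; lra.
have Utl : (Ka + 1) * h i2 <= `|tl R i0 V U i2|.
  have tlE : tl R i0 V U i2 = (U.1 i2)%:~R - (U.1 i0)%:~R * s.
    by rewrite /tl /s; congr (_ - _); rewrite mulrAC mulrA.
  have U0r : 0 <= (U.1 i0)%:~R :> R by rewrite ler0z ltW.
  have := Ua i2; rewrite /tgt (negbTE i20) eqxx tlE /H.
  case: (leP 0 s) => s0; rewrite ler_norml => /andP[? ?].
    have : 0 <= (U.1 i0)%:~R * s by rewrite mulr_ge0.
    by move=> ?; rewrite -normrN; apply: le_trans (ler_norm _); lra.
  have : 0 <= (U.1 i0)%:~R * - s by rewrite mulr_ge0 // oppr_ge0 ltW.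
  by rewrite mulrN => ?; apply: le_trans (ler_norm _); lra.
have [W [t [Wprim W0 t1 Wt Wt2]]] := primitive_part U0z.
have t0 : 0 < t := lt_le_trans ltr01 t1.
have evU : ev U y = t * ev W y.
  by rewrite /ev Wt2 mulrDr mulr_sumr; congr (_ + _); apply: eq_bigr => i _; rewrite Wt mulrA.
have tlU : tl R i0 V U i2 = t * tl R i0 V W i2.
  by rewrite /tl !Wt mulrBr; congr (_ - _); ring.
have tP : t <= P.
  rewrite leNgt; apply/negP => Pt.
  have tA : (3 * Ka + 1) / t <= A^-1.
    by rewrite ler_pdivrMr // [A^-1 * t]mulrC ler_pdivlMr // ltW.
  have W00 : W = 0.
    apply: minA; split=> [i|].
      rewrite -(ler_pM2l t0) -{1}(gtr0_norm t0) -normrM -Wt.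
      apply: le_trans (Ui i) _; rewrite mulrA ler_pM2r //.
      by rewrite [t * _]mulrC -ler_pdivrMr.
    rewrite -(ler_pM2l t0) -{1}(gtr0_norm t0) -normrM -evU.
    move: Uv; rewrite subr0 => /le_trans; apply; rewrite mulrA ler_pM2r ?invr_gt0 //.
    by rewrite [t * _]mulrC; apply: le_trans (_ : 3 * Ka + 1 <= _); [lra|rewrite -ler_pdivrMr].
  by move: W0; rewrite W00 coef0.
have Ka0 : 0 < Ka by lra.
have tW (a b : R) : t * a = b -> 0 < b -> b <= P * a.
  move=> ab b0; have a0 : 0 < a by move: b0; rewrite -ab pmulr_rgt0.
  by rewrite -ab ler_pM2r.
have shrink (a : R) : `|a| <= `|t * a|.
  by rewrite normrM (gtr0_norm t0) ler_peMl.
have KP : 3 * Ka + 1 <= P by rewrite /P ler_peMr //; lra.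
exists W; split=> //.
- apply: le_trans (_ : (U.1 i0)%:~R <= _).
    by case/andP: U0 => /(le_trans _) + _; apply; rewrite ler_peMl ?(ltW (h0 _)) //; lra.
  by apply: tW; rewrite ?ltr0z // /lead Wt.
- move=> i; apply: le_trans (shrink _) _; rewrite -Wt; apply: le_trans (Ui i) _.
  by rewrite ler_pM2r.
split.
  apply: le_trans (shrink _) _; rewrite -evU; move: Uv; rewrite subr0 => /le_trans; apply.
  by rewrite ler_pM2r ?invr_gt0 //; lra.
apply: le_trans (_ : `|tl R i0 V U i2| <= _).
  by apply: le_trans Utl; rewrite ler_peMl ?(ltW (h0 _)) //; lra.
by rewrite tlU normrM (gtr0_norm t0) ler_wpM2r.
Qed.

Lemma cov_move (y y' h : 'I_d -> R) (K del : R) : 0 <= del -> 0 <= K ->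
    (forall i, 0 < h i) -> cov y h K ->
    (forall i, `|y' i - y i| <= del / (\prod_j h j * h i)) ->
  cov y' h (K * (1 + d%:R * del)).
Proof.
move=> del0 K0 h0 ycov yy a v.
have T0 : 0 < \prod_i h i by apply: prodr_gt0.
(* The target value anticipates the displacement of [a], so the move acts only on the error
   [W - a]. *)
have [W [Wa Wv]] := ycov a (v - \sum_i a i * (y' i - y i)).
have K1 : K <= K * (1 + d%:R * del).
  by rewrite ler_peMr // lerDl mulr_ge0.
exists W; split=> [i|]; first by apply: le_trans (Wa i) _; rewrite ler_pM2r.
rewrite (ev_move W y).
have -> : ev W y + \sum_i (W.1 i)%:~R * (y' i - y i) - v =
    (ev W y - (v - \sum_i a i * (y' i - y i))) +
    \sum_i ((W.1 i)%:~R - a i) * (y' i - y i).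
  rewrite [X in _ = _ + X](eq_bigr (fun i => (W.1 i)%:~R * (y' i - y i) - a i * (y' i - y i))); last first.
    by move=> i _; rewrite mulrBl.
  by rewrite sumrB; ring.
apply: le_trans (ler_normD _ _) _; rewrite mulrDr mulr1 mulrDl; apply: lerD => //.
apply: le_trans (ler_norm_sum _ _ _) _.
apply: le_trans (_ : _ <= \sum_(i < d) K * del / \prod_j h j) _; last first.
  by rewrite sumr_const card_ord -[X in X <= _]mulr_natl; rewrite le_eqVlt; apply/orP; left; apply/eqP; ring.
apply: ler_sum => i _; rewrite normrM.
apply: le_trans (ler_pM _ _ (Wa i) (yy i)) _ => //.
rewrite le_eqVlt; apply/orP; left; apply/eqP; field.
by rewrite !gt_eqF.
Qed.

End NextForm.

(* Subtracting real multiples of [V] and [V'] from the error of an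
   approximation at [y] cancels its value at [y'] and its [i0]-th coefficient;
   the multiples are then rounded. *)
Lemma cov_transfer (R : realType) (d : nat) (i0 i1 : 'I_d)
    (y y' h : 'I_d -> R) (V V' : form d) (Ka P e : R) :
    i1 != i0 -> (forall i, 0 < h i) ->
    0 < lead R i0 V -> 0 < lead R i0 V' ->
    (forall i, i != i0 -> i != i1 -> y' i = y i) ->
    0 <= Ka -> 1 <= P -> 0 < e -> e <= 1 -> cov y h Ka ->
    (forall i, `|(V.1 i)%:~R : R| <= h i) ->
    (forall i, `|(V'.1 i)%:~R : R| <= P * h i) ->
    h i0 <= P * lead R i0 V' ->
    (forall j, `|tl R i0 V V' j| * h i1 <= `|tl R i0 V V' i1| * h j) ->
    tl R i0 V V' i1 != 0 ->
    `|ev V y| <= 1 / \prod_i h i ->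
    e / 2 / \prod_i h i <= ev V y' <= e / \prod_i h i ->
    `|ev V' y| <= P / \prod_i h i -> `|ev V' y'| <= P / \prod_i h i ->
    lead R i0 V / lead R i0 V' * P <= e / 4 ->
  cov y' h (36 * Ka * P ^+ 2 / e + 1 + P).
Proof.
move=> i10 h0 n0 n0' yy Ka0 P1 e0 e1 ycov Vle V'le lead' tlmax tl1 Vy Vy' V'y V'y' rP a v.
have T0 : 0 < \prod_i h i by apply: prodr_gt0.
set T := \prod_i h i in T0 Vy Vy' V'y V'y' *.
have P0 : 0 < P := lt_le_trans ltr01 P1.
set n := lead R i0 V in n0 rP *; set n' := lead R i0 V' in n0' lead' rP *.
set r := n / n' in rP; have r0 : 0 < r by rewrite divr_gt0.
(* [Vs] has no [i0]-th coefficient, so its change of value from [y] to [y'] is due to the coordinate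
   [i1] alone. This bounds [Vs i1 * (y' i1 - y i1)], and with [tlmax] the effect of the move,
   whatever its size in coordinate [i0]. *)
pose Vs i : R := (V.1 i)%:~R - r * (V'.1 i)%:~R.
have Vs0 : Vs i0 = 0 by rewrite /Vs /r -/(lead R i0 V) -/(lead R i0 V') -/n -/n' divfK ?subrr ?gt_eqF.
have VsE i : Vs i = - r * tl R i0 V V' i.
  by rewrite /Vs /tl -/(lead R i0 V') -/n -/n' /r; field; rewrite !gt_eqF.
have Vs1 : Vs i1 != 0 by rewrite VsE mulf_neq0 // oppr_eq0 gt_eqF.
have Vsmax j : `|Vs j| * h i1 <= `|Vs i1| * h j.
  by rewrite !VsE !normrM -!mulrA ler_pM2l // normr_gt0 oppr_eq0 gt_eqF.
pose Vsv x := ev V x - r * ev V' x.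
have move1 (c : 'I_d -> R) : c i0 = 0 -> \sum_i c i * (y' i - y i) = c i1 * (y' i1 - y i1).
  move=> c0; rewrite (bigD1 i1) //= [X in _ + X]big1 ?addr0 // => i ii.
  by have [->|ii0] := eqVneq i i0; rewrite ?c0 ?mul0r // yy // subrr mulr0.
have VsvD : Vsv y' = Vsv y + Vs i1 * (y' i1 - y i1).
  rewrite -move1 // /Vsv (ev_move V y) (ev_move V' y).
  rewrite [\sum_i Vs i * _](eq_bigr (fun i => (V.1 i)%:~R * (y' i - y i) - r * ((V'.1 i)%:~R * (y' i - y i)))).
    by rewrite sumrB -mulr_sumr; ring.
  by move=> i _; rewrite /Vs; ring.
have Vle' i : `|Vs i| <= 5 / 4 * h i.
  apply: le_trans (ler_normB _ _) _; rewrite normrM (gtr0_norm r0).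
  have : r * `|(V'.1 i)%:~R| <= r * P * h i by rewrite -mulrA ler_pM2l // V'le.
  have : r * P * h i <= 1 / 4 * h i by rewrite ler_pM2r //; lra.
  by have := Vle i; lra.
have rV' x : `|ev V' x| <= P / T -> `|r * ev V' x| <= e / 4 / T.
  move=> vx; rewrite normrM (gtr0_norm r0).
  apply: le_trans (_ : r * (P / T) <= _); first by rewrite ler_pM2l.
  by rewrite mulrA ler_pM2r ?invr_gt0.
have Ti0 : 0 < T^-1 by rewrite invr_gt0.
have eT : e / T <= T^-1 by rewrite ler_piMl // ltW.
have Vsy' : e / 4 / T <= Vsv y'.
  have := rV' _ V'y'; rewrite ler_norml /Vsv => /andP[? ?].
  by case/andP: Vy' => ? ?; lra.
have Vsy'0 : 0 < Vsv y' by apply: lt_le_trans Vsy'; rewrite !divr_gt0.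
have Dbd : `|Vs i1 * (y' i1 - y i1)| <= 3 / T.
  have -> : Vs i1 * (y' i1 - y i1) = Vsv y' - Vsv y by rewrite VsvD; ring.
  have := rV' _ V'y'; have := rV' _ V'y; move: Vy; rewrite !ler_norml /Vsv.
  move=> /andP[? ?] /andP[? ?] /andP[? ?]; case/andP: Vy' => ? ?.
  by apply/andP; split; lra.
pose v0 := v + \sum_i a i * (y i - y' i).
have [W [Wa Wv]] := ycov a v0.
pose D i : R := (W.1 i)%:~R - a i.
have Dv : ev W y' - v = ev W y - v0 + \sum_i D i * (y' i - y i).
  rewrite (ev_move W y) /v0.
  rewrite [\sum_i D i * _](eq_bigr (fun i => (W.1 i)%:~R * (y' i - y i) + a i * (y i - y' i))).
    by rewrite big_split /=; ring.
  by move=> i _; rewrite /D; ring.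
pose t := D i0 / n'.
have tbd : `|t| * P <= Ka * P ^+ 2.
  rewrite expr2 mulrA ler_pM2r // /t normrM normfV (gtr0_norm n0') ler_pdivrMr //.
  apply: le_trans (Wa i0) _; rewrite -mulrA; exact: ler_wpM2l.
pose D1 := 2 * Ka * P ^+ 2.
have KaP : Ka <= Ka * P ^+ 2 by rewrite ler_peMr // exprn_ege1.
have D10 : 0 <= D1 by rewrite !mulr_ge0 // ltW.
pose Ds i := D i - t * (V'.1 i)%:~R.
have Ds0 : Ds i0 = 0 by rewrite /Ds /t -/(lead R i0 V') -/n' divfK ?subrr ?gt_eqF.
have Dsle i : `|Ds i| <= D1 * h i.
  apply: le_trans (ler_normB _ _) _; rewrite normrM.
  have e2 : `|t| * `|(V'.1 i)%:~R| <= Ka * P ^+ 2 * h i.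
    apply: le_trans (_ : `|t| * (P * h i) <= _); first by apply: ler_wpM2l.
    by rewrite mulrA ler_pM2r.
  have e3 : Ka * h i <= Ka * P ^+ 2 * h i by rewrite ler_pM2r.
  by have := Wa i; rewrite -/(D i) /D1; lra.
pose Dsy := ev W y - v0 - t * ev V' y.
have Dsyle : `|Dsy| <= D1 / T.
  apply: le_trans (ler_normB _ _) _; rewrite normrM.
  have e2 : `|t| * `|ev V' y| <= Ka * P ^+ 2 / T.
    apply: le_trans (_ : `|t| * (P / T) <= _); first by apply: ler_wpM2l.
    by rewrite mulrA ler_pM2r.
  have e3 : Ka / T <= Ka * P ^+ 2 / T by rewrite ler_pM2r.
  by move: Wv; rewrite /D1 -/T; lra.
pose Dsy' := Dsy + Ds i1 * (y' i1 - y i1).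
have Dsy'E : ev W y' - v = Dsy' + t * ev V' y'.
  rewrite Dv /Dsy' -move1 // (ev_move V' y y') /Dsy.
  rewrite [\sum_i Ds i * _](eq_bigr (fun i => D i * (y' i - y i) - t * ((V'.1 i)%:~R * (y' i - y i)))).
    by rewrite sumrB -mulr_sumr; ring.
  by move=> i _; rewrite /Ds; ring.
(* The multiple of [Vs] that cancels the remaining value at [y']. There [Vs] is at least
   [e / (4 * T)], whence the division by [e] in the radius. *)
pose b := Dsy' / Vsv y'.
have bV i : `|b * Vs i| <= 17 * D1 / e * h i.
  have Dsy'le : `|Dsy'| * `|Vs i| <= 17 / 4 * D1 / T * h i.
    apply: le_trans (ler_wpM2r (normr_ge0 _) (ler_normD _ _)) _.
    rewrite mulrDl (_ : 17 / 4 * D1 / T * h i = 5 / 4 * D1 / T * h i + 3 * D1 / T * h i); last by field; rewrite gt_eqF.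
    apply: lerD.
      apply: le_trans (ler_pM _ _ Dsyle (Vle' i)) _ => //.
      by rewrite le_eqVlt; apply/orP; left; apply/eqP; field; rewrite gt_eqF.
    rewrite normrM.
    apply: le_trans (_ : D1 * (`|y' i1 - y i1| * (`|Vs i| * h i1)) <= _).
      have -> : D1 * (`|y' i1 - y i1| * (`|Vs i| * h i1)) = (D1 * h i1) * `|y' i1 - y i1| * `|Vs i| by ring.
      by do 2 apply: ler_wpM2r => //.
    apply: le_trans (_ : D1 * (`|y' i1 - y i1| * (`|Vs i1| * h i)) <= _).
      by apply: ler_wpM2l => //; apply: ler_wpM2l.
    have -> : D1 * (`|y' i1 - y i1| * (`|Vs i1| * h i)) = D1 * `|Vs i1 * (y' i1 - y i1)| * h i by rewrite normrM; ring.
    rewrite ler_pM2r //; apply: le_trans (ler_wpM2l D10 Dbd) _.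
    by rewrite le_eqVlt; apply/orP; left; apply/eqP; field; rewrite gt_eqF.
  rewrite /b mulrAC normrM normfV (gtr0_norm Vsy'0) normrM ler_pdivrMr //.
  apply: le_trans Dsy'le _.
  apply: le_trans (_ : 17 * D1 / e * h i * (e / 4 / T) <= _).
    by rewrite le_eqVlt; apply/orP; left; apply/eqP; field; rewrite !gt_eqF.
  by apply: ler_wpM2l => //; rewrite mulr_ge0 ?(ltW (h0 i)) // divr_ge0 ?mulr_ge0 // ltW.
(* In terms of [V] and [V'], the two corrections are [b] and [th] times; rounding them adds the
   [1 + P] of the radius. *)
pose th := t - b * r.
have fl (u : R) : `|u - (Num.floor u)%:~R| <= 1.
  by clear; have [? ?] := floor_bounds u; rewrite ler_norml; apply/andP; split; lra.
have fb := fl b; have ft := fl th.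
exists (W - V *~ Num.floor b - V' *~ Num.floor th); split=> [i|].
  rewrite !coefB !coefMz !intrB !intrM.
  have -> : (W.1 i)%:~R - (V.1 i)%:~R * (Num.floor b)%:~R - (V'.1 i)%:~R * (Num.floor th)%:~R - a i =
     Ds i - b * Vs i + (b - (Num.floor b)%:~R) * (V.1 i)%:~R + (th - (Num.floor th)%:~R) * (V'.1 i)%:~R.
    by rewrite /Ds /D /Vs /th; ring.
  have g1 : `|(b - (Num.floor b)%:~R) * (V.1 i)%:~R| <= h i.
    by rewrite normrM -[leRHS]mul1r; apply: ler_pM.
  have g2 : `|(th - (Num.floor th)%:~R) * (V'.1 i)%:~R| <= P * h i.
    by rewrite normrM -[leRHS]mul1r; apply: ler_pM.
  have D1e : D1 <= D1 / e by rewrite ler_peMr // invf_ge1.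
  have D1eh : D1 * h i <= D1 / e * h i by rewrite ler_pM2r.
  apply: le_trans (ler_normD _ _) _; apply: le_trans (lerD (ler_normD _ _) (lexx _)) _.
  apply: le_trans (lerD (lerD (ler_normB _ _) (lexx _)) (lexx _)) _.
  have := Dsle i; have := bV i.
  have -> : 36 * Ka * P ^+ 2 / e = 18 * (D1 / e) by rewrite /D1; ring.
  rewrite -[17 * D1 / e]mulrA; lra.
rewrite !evB !evMz.
have -> : ev W y' - (Num.floor b)%:~R * ev V y' - (Num.floor th)%:~R * ev V' y' - v =
   (b - (Num.floor b)%:~R) * ev V y' + (th - (Num.floor th)%:~R) * ev V' y'.
  have bE : b * Vsv y' = Dsy' by rewrite /b divfK // gt_eqF.
  move: Dsy'E; rewrite -bE /Vsv /th => E.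
  have -> : ev W y' = v + (b * (ev V y' - r * ev V' y') + t * ev V' y') by rewrite -E; ring.
  by ring.
apply: le_trans (ler_normD _ _) _; rewrite !normrM.
have Vy'1 : `|ev V y'| <= T^-1.
  rewrite ger0_norm; last by case/andP: Vy' => + _; apply: le_trans; rewrite !divr_ge0 // ltW.
  by case/andP: Vy' => _ /le_trans; apply.
have g1 : `|b - (Num.floor b)%:~R| * `|ev V y'| <= T^-1 by rewrite -[leRHS]mul1r; apply: ler_pM.
have g2 : `|th - (Num.floor th)%:~R| * `|ev V' y'| <= P / T by rewrite -[leRHS]mul1r; apply: ler_pM.
have g3 : 0 <= 36 * Ka * P ^+ 2 / e / T.
  by rewrite divr_ge0 ?(ltW T0) // divr_ge0 ?(ltW e0) // !mulr_ge0 // ltW.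
by clear -g1 g2 g3; rewrite !mulrDl mul1r; lra.
Qed.

(** * Transference from a small form to simultaneous approximation *)

Section Transference.
Variables (R : realType) (d : nat).

(* Dirichlet's pigeonhole in the sublattice of the [(p, q)] on which the form
   [V] vanishes: the coordinate [k] with the largest [|V_k| t_k] is recovered
   from the others, at the price of a congruence modulo [V_k]. *)
Lemma dual_to_primal (z t : 'I_d -> R) (V : form d) (tau : R) (i0 : 'I_d) :
    (forall i, 0 < t i <= 1) -> V.1 i0 != 0 ->
    (forall i, `|(V.1 i)%:~R| * t i * 2 ^+ d <= tau * \prod_i t i) ->
    `|ev V z| * 2 ^+ d <= \prod_i t i ->
  exists (p : 'I_d -> int) (q : nat), [/\ (0 < q)%N, q%:R <= tau &
    forall i, `|q%:R * z i - (p i)%:~R| <= d%:R * t i].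
Proof.
move=> t01 V0 Vt Vz.
have t0 i : 0 < t i by case/andP: (t01 i).
have t1 i : t i <= 1 by case/andP: (t01 i).
have ti0 i : 0 <= (t i)^-1 by rewrite invr_ge0 ltW.
have pt0 : 0 < \prod_i t i by apply: prodr_gt0.
have p2 : 0 < 2 ^+ d :> R by rewrite exprn_gt0.
pose k := [arg max_(i > i0) (`|(V.1 i)%:~R : R| * t i)]%O.
have kmax i : `|(V.1 i)%:~R : R| * t i <= `|(V.1 k)%:~R : R| * t k.
  by rewrite /k; case: arg_maxP => // j _; apply.
set m := `|(V.1 k)%:~R| * t k in kmax.
have m0 : 0 < m by apply: lt_le_trans (kmax i0); rewrite mulr_gt0 // normr_gt0 intr_eq0.
have Vk0 : V.1 k != 0 by apply/negP => /eqP e; move: m0; rewrite /m e normr0 mul0r ltxx.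
set ga := ev V z in Vz *.
(* An upper bound for the number of cells [\prod_i D i] of the pigeonhole; the two smallness
   hypotheses say that [cl <= tau] and [cl * |ga| <= m]. *)
pose cl := 2 ^+ d * m / \prod_i t i.
have cl0 : 0 < cl by rewrite divr_gt0 // mulr_gt0.
have [Q [Q0 Qtau Qga clQ]] : exists Q : R, [/\ 0 <= Q, Q <= tau, Q * `|ga| <= m & cl <= Q].
  exists cl; split=> //; first exact: ltW.
    by rewrite /cl ler_pdivrMr // mulrC; apply: Vt.
  rewrite /cl mulrAC ler_pdivrMr // -mulrA mulrCA ler_pM2l //.
  by rewrite mulrC.
have [N1 N2] := truncn_bounds Q0; set N := Num.truncn Q in N1 N2.
pose D i : nat := if i == k then `|V.1 k|%N else (Num.truncn (t i)^-1).+1.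
have D0 i : (0 < D i)%N by rewrite /D; case: eqP => // _; rewrite absz_gt0.
have Dt i : i != k -> (D i)%:R^-1 <= t i.
  move=> ik; rewrite /D (negbTE ik) -[leRHS]invrK lef_pV2 ?posrE ?invr_gt0 ?ltr0n //.
  have [_ ?] := truncn_bounds (ti0 i).
  by rewrite -natr1 ltW.
pose fl (q : nat) i := Num.floor (q%:R * z i).
pose fr (q : nat) i : R := q%:R * z i - (fl q i)%:~R.
have frb q i : 0 <= fr q i < 1.
  by have [? ?] := floor_bounds (q%:R * z i); rewrite /fr; apply/andP; split; lra.
(* If [V.1 k] divides the difference of two such values, the missing [p k] can be chosen so that [V]
   vanishes on the difference of the two approximations. Hence the [k]-th component of the key is a
   residue. *)
pose kk (q : nat) : int := \sum_(i | i != k) V.1 i * fl q i + V.2 * q%:Z.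
pose key (q : nat) : {dffun forall i : 'I_d, 'I_((D i).-1.+1)} :=
  [ffun i => inord (if i == k then `|(kk q %% V.1 k)%Z|%N else Num.truncn (fr q i * (D i)%:R))].
have [q1 [q2 [q12 q2N kq]]] : exists q1 q2, [/\ (q1 < q2)%N, (q2 <= N)%N & key q1 = key q2].
  apply: contrapT => H.
  have inj : {in iota 0 N.+1 &, injective key}.
    move=> a b; rewrite !mem_iota !add0n !ltnS => /= aN bN e.
    case: (ltngtP a b) => // ab; exfalso; apply: H; first by exists a, b.
    by exists b, a.
  have := size_le_card (iota_uniq 0 N.+1) inj; rewrite size_iota card_dep_ffun foldrE big_map big_enum /=.
  rewrite leqNgt => /negP; apply; rewrite -(ltr_nat R).
  apply: le_lt_trans (_ : cl < _); last by apply: le_lt_trans clQ _; rewrite -natr1.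
  have -> : cl = m * \prod_i (2 / t i).
    by rewrite /cl big_split /= prodr_const card_ord prodfV; ring.
  rewrite natr_prod.
  rewrite (bigD1 k) //= [X in _ <= m * X](bigD1 k) //= mulrA.
  apply: ler_pM => //; first by rewrite prodr_ge0.
    rewrite card_ord prednK // /D eqxx natr_absz /m -mulrA [t k * _]mulrC divfK ?gt_eqF //.
    by rewrite intr_norm ler_peMr ?ler1n.
  apply: ler_prod => i ik; rewrite card_ord prednK // ler0n /D (negbTE ik) /= -natr1.
  have [? _] := truncn_bounds (ti0 i).
  have : 1 <= (t i)^-1 by rewrite invf_ge1.
  by rewrite -[2 / _]/(2 * _); lra.
have small i : i != k -> `|fr q2 i - fr q1 i| <= t i.
  move=> ik; apply: le_trans (Dt i ik).
  have D0R : 0 < (D i)%:R :> R by rewrite ltr0n.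
  move/ffunP/(_ i): kq; rewrite !ffunE (negbTE ik) => /(congr1 val).
  have bd q : (Num.truncn (fr q i * (D i)%:R) < (D i).-1.+1)%N /\
     (Num.truncn (fr q i * (D i)%:R))%:R <= fr q i * (D i)%:R < (Num.truncn (fr q i * (D i)%:R))%:R + 1.
    have /andP[f0 f1] := frb q i; have [e1 e2] := truncn_bounds (mulr_ge0 f0 (ltW D0R)).
    rewrite e1 e2 prednK // -(ltr_nat R); split=> //; apply: le_lt_trans e1 _.
    by rewrite gtr_pMl.
  have [b1 /andP[? ?]] := bd q1; have [b2 /andP[? ?]] := bd q2.
  rewrite /= !inordK // => e; rewrite e in b1 *.
  rewrite -[_^-1]div1r ler_pdivlMr // -[X in _ * X](gtr0_norm D0R) -normrM mulrBl ler_norml.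
  by move: (congr1 (fun n => n%:R : R) e) => /= eR; apply/andP; split; lra.
have kkdvd : (V.1 k %| kk q2 - kk q1)%Z.
  move/ffunP/(_ k): kq; rewrite !ffunE eqxx => /(congr1 val).
  have bd q : (`|(kk q %% V.1 k)%Z|%N < (D k).-1.+1)%N.
    rewrite prednK // /D eqxx -ltz_nat gez0_abs ?modz_ge0 //.
    by rewrite abszE ltz_mod.
  rewrite /= !inordK ?bd // => /(congr1 Posz).
  rewrite !gez0_abs ?modz_ge0 // => e.
  by rewrite -eqz_mod_dvd e.
pose q := (q2 - q1)%N.
have qR : q%:R = q2%:R - q1%:R :> R by rewrite natrB // ltnW.
have q0 : (0 < q)%N by rewrite subn_gt0.
have qQ : q%:R <= Q.
  by apply: le_trans N1; rewrite ler_nat; apply: leq_trans q2N; rewrite leq_subr.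
pose p i : int := if i == k then - ((kk q2 - kk q1) %/ V.1 k)%Z else fl q2 i - fl q1 i.
have pk : (V.1 k)%:~R * (p k)%:~R = - ((kk q2)%:~R - (kk q1)%:~R) :> R.
  by rewrite /p eqxx -intrM mulrN mulrC divzK // rmorphN rmorphB.
have offk i : i != k -> q%:R * z i - (p i)%:~R = fr q2 i - fr q1 i.
  by move=> ik; rewrite /p (negbTE ik) /fr qR intrB; ring.
exists p, q; split=> // [|i]; first exact: le_trans qQ Qtau.
have d1 : 1 <= d%:R :> R by rewrite ler1n; case: (d) (i0) => // -[].
have [->|ik] := eqVneq i k; last first.
  by rewrite offk //; apply: le_trans (small i ik) _; rewrite ler_peMl // ltW.
have Vk0R : 0 < `|(V.1 k)%:~R : R| by rewrite normr_gt0 intr_eq0.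
rewrite -(ler_pM2l Vk0R) -normrM.
have -> : (V.1 k)%:~R * (q%:R * z k - (p k)%:~R) =
    q%:R * ga - \sum_(i | i != k) (V.1 i)%:~R * (fr q2 i - fr q1 i).
  rewrite mulrBr pk /ga /ev (bigD1 k) //= /kk !intrD !intrM !rmorph_sum /=.
  rewrite [X in _ = _ - X](eq_bigr (fun i => q%:R * ((V.1 i)%:~R * z i) - ((V.1 i * fl q2 i)%:~R - (V.1 i * fl q1 i)%:~R))).
    by rewrite !sumrB -mulr_sumr qR -!pmulrn; ring.
  by move=> j _; rewrite !intrM /fr qR; ring.
apply: le_trans (ler_normB _ _) _.
have e1 : `|q%:R * ga| <= m.
  by rewrite normrM normr_nat; apply: le_trans Qga; rewrite ler_wpM2r.
have e2 : `|\sum_(i | i != k) (V.1 i)%:~R * (fr q2 i - fr q1 i)| <= (d%:R - 1) * m.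
  apply: le_trans (ler_norm_sum _ _ _) _.
  apply: le_trans (_ : _ <= \sum_(j | j != k) m) _.
    apply: ler_sum => j jk; rewrite normrM; apply: le_trans (kmax j).
    by rewrite ler_wpM2l // small.
  rewrite sumr_const cardC1 card_ord -[X in X <= _]mulr_natl.
  by case: (d) (i0) => [[]//|d' _]; rewrite -natr1 /=; lra.
by apply: le_trans (lerD e1 e2) _; rewrite [leRHS]mulrCA -/m; lra.
Qed.

End Transference.

(** * The children of a node *)

Section Step.
Variables (R : realType) (d : nat) (i0 i2 : 'I_d).
Hypothesis i20 : i2 != i0.
Variables (x h lam : 'I_d -> R) (V : form d) (P K A e K2 : R) (M' : nat).
Notation M := (4 * M')%N.
Notation T := (\prod_i h i).
Notation C := (\prod_i lam i).
Notation h' := (fun i => lam i * h i).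
Notation n := (lead R i0 V).
Hypothesis h1 : forall i, 1 <= h i.
Hypothesis P_ge1 : 1 <= P.
Hypothesis nodeV : node i0 x V h P K.
Hypothesis A1 : 1 <= A.
Hypothesis A_big : 2 ^+ d.+1 * (3 * d.+1%:R) ^+ d < A.
Hypothesis A_C : A ^+ d.+1 <= C.
Hypothesis P_A : (3 * A ^+ cov_exp d + 1) * A <= P.
Hypothesis lam_P : forall i, 8 * P ^+ 3 <= lam i.
Hypothesis lam_e : 4 * P ^+ 2 * (P + 1) <= e * lam i0.
Hypothesis e0 : 0 < e.
Hypothesis e1 : e <= 1.
Hypothesis K2E : 36 * A ^+ cov_exp d * (P + 1) ^+ 2 / e + 1 + (P + 1) <= K2.
Hypothesis M_8 : 8 <= M%:R :> R.
Hypothesis M_C : 2 * P ^+ 3 * C ^+ 2 <= M%:R.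
Hypothesis bad_small : forall Bad : {set {ffun 'I_d -> 'I_M}},
  (forall g, g \in Bad -> bad_point i0 x h lam V A g) ->
  #|Bad|%:R * 2 ^+ d.+1 <= (M%:R : R) ^+ d.

Implicit Types (g : {ffun 'I_d -> 'I_M}) (W : form d).

Let P0 : 0 < P. Proof. exact: lt_le_trans P_ge1. Qed.
Let P3 : 1 <= P ^+ 3. Proof. exact: exprn_ege1. Qed.
Let lam8 i : 8 <= lam i.
Proof. by apply: le_trans (lam_P i); rewrite ler_peMr. Qed.
Let lam1 i : 1 <= lam i. Proof. by apply: le_trans (lam8 i); rewrite ler1n. Qed.
Let lamP i : P <= lam i.
Proof.
apply: le_trans (lam_P i); rewrite exprS mulrCA ler_peMr ?(ltW P0) //.
by rewrite mulr_ege1 ?ler1n // exprn_ege1.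
Qed.
Let lam0 i : 0 < lam i. Proof. exact: lt_le_trans (lam1 i). Qed.
Let h0 i : 0 < h i. Proof. exact: lt_le_trans (h1 i). Qed.
Let T1 : 1 <= T. Proof. exact: prod_ge1. Qed.
Let C1 : 1 <= C. Proof. exact: prod_ge1. Qed.
Let T0 : 0 < T. Proof. exact: lt_le_trans T1. Qed.
Let C0 : 0 < C. Proof. exact: lt_le_trans C1. Qed.
Let h'1 i : 1 <= h' i. Proof. by rewrite mulr_ege1. Qed.
Let h'0 i : 0 < h' i. Proof. by rewrite mulr_gt0. Qed.
Let CT0 : 0 < C * T. Proof. by rewrite mulr_gt0. Qed.
Let prodh' : \prod_i h' i = C * T. Proof. by rewrite big_split. Qed.
Let n0 : 0 < n. Proof. by rewrite /lead ltr0z; case: nodeV. Qed.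
Let n_ne : n != 0. Proof. by rewrite gt_eqF. Qed.
Let Vx : ev V x = 0. Proof. by case: nodeV. Qed.
Let Vle i : `|(V.1 i)%:~R : R| <= P * h i. Proof. by case: nodeV. Qed.
Let h0n : h i0 <= P * n. Proof. by case: nodeV. Qed.
Let M0 : 0 < M%:R :> R. Proof. exact: lt_le_trans M_8. Qed.
Let M'0 : 0 < M'%:R :> R. Proof. by have := M0; rewrite natrM pmulr_rgt0. Qed.
Let lamC i : lam i <= C.
Proof.
rewrite (bigD1 i) //= ler_peMr ?(ltW (lam0 i)) //.
by elim/big_rec: _ => // j y _ y1; rewrite mulr_ege1.
Qed.

Let Q s g := pt i0 V x h (C * T) s g.

(** The conditions on the next form that do not involve the point where it is evaluated. *)
Definition cand W := [/\ primitive R W, 0 < W.1 i0, h' i0 <= P * lead R i0 W,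
  forall i, `|(W.1 i)%:~R : R| <= P * h' i & h' i2 <= P * `|tl R i0 V W i2|].

Lemma good_cand g : ~ bad_point i0 x h lam V A g ->
  cov (Q 1 g) h' (A ^+ cov_exp d) /\
  exists W, cand W /\ `|ev W (Q 1 g)| <= P / (C * T).
Proof.
move=> ngood.
have minA W : box (fun i => A^-1 * h' i) (A^-1 / \prod_i h' i) (Q 1 g) W -> W = 0.
  rewrite prodh' => Wbox; apply/eqP; apply/negP => /negP W0.
  by apply: ngood; exists W.
have AT : A ^+ d.+1 <= \prod_i h' i.
  by rewrite prodh'; apply: le_trans A_C _; rewrite ler_peMr // ltW.
have ycov := min_cov h'1 A_big AT minA.
split=> //.
have Ka1 : 1 <= A ^+ cov_exp d by rewrite exprn_ege1.
have [W [Wp W0 Wl Wi [Wx Wt]]] := good_next h'1 A1 Ka1 ycov i20 n0 minA.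
move: Wx; rewrite prodh' => Wx.
have PP b : 0 <= b -> (3 * A ^+ cov_exp d + 1) * A * b <= P * b by move=> ?; rewrite ler_wpM2r.
have lW : 0 <= lead R i0 W by rewrite /lead ler0z ltW.
exists W; split; first split=> //.
- exact: le_trans Wl (PP _ lW).
- by move=> i; apply: le_trans (Wi i) (PP _ (ltW (h'0 i))).
- exact: le_trans Wt (PP _ (normr_ge0 _)).
- by apply: le_trans Wx _; rewrite ler_pM2r ?invr_gt0.
Qed.

(** The direction of motion: relative to the sides, the one in which [W] varies most while [V] is
    constant, as [tlmax] of [cov_transfer] asks. *)
Definition top W := [arg max_(i > i2 | i != i0) (`|tl R i0 V W i| / h' i)]%O.

Lemma topP W : cand W -> [/\ top W != i0, h' (top W) <= P * `|tl R i0 V W (top W)|,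
  forall j, `|tl R i0 V W j| * h' (top W) <= `|tl R i0 V W (top W)| * h' j &
  0 < `|tl R i0 V W (top W)|].
Proof.
move=> [_ _ _ _ Wt].
have [tne tmax] : top W != i0 /\ forall j, j != i0 -> `|tl R i0 V W j| / h' j <= `|tl R i0 V W (top W)| / h' (top W).
  by rewrite /top; case: arg_maxP.
have tl_le : h' (top W) <= P * `|tl R i0 V W (top W)|.
  have q1 : 1 <= P * (`|tl R i0 V W i2| / h' i2) by rewrite mulrA ler_pdivlMr // mul1r.
  have : 1 <= P * (`|tl R i0 V W (top W)| / h' (top W)).
    by apply: le_trans q1 _; rewrite ler_pM2l // tmax.
  by rewrite mulrA ler_pdivlMr // mul1r.
split=> //; last first.
  by have := lt_le_trans (h'0 (top W)) tl_le; rewrite pmulr_rgt0.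
move=> j; have [->|jj] := eqVneq j i0.
  by rewrite tl0 // normr0 mul0r mulr_ge0 // ltW.
by have := tmax _ jj; rewrite ler_pdivrMr // mulrAC ler_pdivlMr.
Qed.

(* The translation of the coordinate [top W], in units of the grid, which keeps
   the value of [W] while that of [V] is multiplied by [e]. *)
Definition shift W g : R :=
  lead R i0 W / n * (1 - e) * ((1 + frac R g i0) / 2) *
  (h (top W) / (C * tl R i0 V W (top W))).

Lemma lead_le W : cand W -> lead R i0 W / n <= P ^+ 2 * lam i0.
Proof.
move=> [W1 W2 W3 W4 _]; rewrite ler_pdivrMr //.
apply: le_trans (ler_norm _) _; apply: le_trans (W4 i0) _.
have -> : P ^+ 2 * lam i0 * n = P * (lam i0 * (P * n)) by ring.
by rewrite !ler_pM2l.
Qed.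

Lemma shift_le W g : cand W -> `|shift W g| <= 1 / 8.
Proof.
move=> cW; have [W1 W2 W3 W4 _] := cW; have [t1 t2 _ t4] := topP cW.
have lW : 0 < lead R i0 W by rewrite /lead ltr0z.
have f01 : 0 <= (1 - e) * ((1 + frac R g i0) / 2) <= 1.
  have /andP[? ?] := frac_bounds R g i0.
  rewrite mulr_ge0 ?subr_ge0 ?divr_ge0 ?addr_ge0 //=.
  rewrite -[leRHS]mulr1; apply: ler_pM; rewrite ?subr_ge0 ?divr_ge0 ?addr_ge0 //; have := e0; lra.
have e3 : h (top W) / (C * `|tl R i0 V W (top W)|) <= P / (C * lam (top W)).
  rewrite ler_pdivrMr ?mulr_gt0 // mulrAC ler_pdivlMr ?mulr_gt0 //.
  have -> : h (top W) * (C * lam (top W)) = C * (lam (top W) * h (top W)) by ring.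
  by rewrite [leRHS]mulrCA ler_pM2l.
rewrite /shift -[_ / n * _ * _]mulrA normrM [X in _ * X]normrM normfV [`|C * _|]normrM (gtr0_norm C0) (gtr0_norm (h0 _)).
have l0 : 0 < lead R i0 W / n by rewrite divr_gt0.
have -> : `|lead R i0 W / n * ((1 - e) * ((1 + frac R g i0) / 2))| = lead R i0 W / n * ((1 - e) * ((1 + frac R g i0) / 2)).
  by rewrite ger0_norm // mulr_ge0 ?(ltW l0) //; case/andP: f01.
apply: le_trans (_ : P ^+ 2 * lam i0 * 1 * (P / (C * lam (top W))) <= _).
  case/andP: f01 => f0 f1; apply: ler_pM => //.
  - by apply: mulr_ge0 => //; apply: ltW.
  - by rewrite divr_ge0 ?(ltW (h0 _)) // mulr_ge0 // ltW.
  - by apply: ler_pM; rewrite ?(ltW l0) ?lead_le.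
rewrite mulrA ler_pdivrMr ?mulr_gt0 //.
have := lam_P (top W); have := lamC i0 => a b.
have : lam i0 * (8 * P ^+ 3) <= C * lam (top W).
  by apply: ler_pM => //; [exact: ltW|rewrite mulr_ge0 // exprn_ge0 // ltW].
by rewrite exprS expr2 => ?; lra.
Qed.

(** The shift is rounded down to the grid. The default [g i] of [insubd] is never taken on points of
    [margin] when [W] is a candidate. *)
Definition phi W g : {ffun 'I_d -> 'I_M} :=
  [ffun i => if i == top W
    then insubd (g i) `|((g i)%:Z + Num.floor (M%:R * shift W g))%R|%N else g i].

(** The middle half of the grid in each coordinate: the shift is at most an eighth of the grid, plus
    the rounding. *)
Definition margin g := [forall i, (M' <= g i < 3 * M')%N].

Lemma phi_off W g i : i != top W -> phi W g i = g i.
Proof. by move=> /negbTE ii; rewrite ffunE ii. Qed.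

Lemma phi_top W g : cand W -> margin g ->
  (phi W g (top W))%:Z = (g (top W))%:Z + Num.floor (M%:R * shift W g).
Proof.
move=> cW /forallP/(_ (top W)) mg; have sh := shift_le g cW.
have [f1 f2] := floor_bounds (M%:R * shift W g).
have Mb : `|M%:R * shift W g| <= M%:R / 8.
  by rewrite normrM gtr0_norm // ler_pM2l //; lra.
set F := Num.floor _ in f1 f2 *.
have FM : - (M'%:Z) <= F <= M'%:Z.
  have M4 : M%:R = 4 * M'%:R :> R by rewrite natrM.
  move: Mb; rewrite ler_norml => /andP[? ?].
  have m2 : 2 <= M'%:R :> R by have := M_8; rewrite M4; lra.
  rewrite -!(ler_int R) rmorphN /= -pmulrn; apply/andP; split.
    lra.
  lra.
rewrite ffunE eqxx val_insubd; move: (g (top W)) mg FM => [a aM] /= mg FM.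
case: ifP; clear -mg FM; lia.
Qed.

Lemma tl_le W i : cand W -> `|tl R i0 V W i| <= 2 * P ^+ 3 * C * h i.
Proof.
move=> cW; have [_ W2 _ W4 _] := cW.
have l0 : 0 < lead R i0 W / n by rewrite divr_gt0 // /lead ltr0z.
apply: le_trans (ler_normB _ _) _; rewrite normrM -/(lead R i0 W) (gtr0_norm l0).
have a1 : `|(W.1 i)%:~R| <= P ^+ 3 * C * h i.
  apply: le_trans (W4 i) _; rewrite mulrA ler_pM2r // ler_pM //; try exact: ltW.
  by rewrite exprS ler_peMr ?(ltW P0) // exprn_ege1.
have a2 : lead R i0 W / n * `|(V.1 i)%:~R| <= P ^+ 3 * C * h i.
  have -> : P ^+ 3 * C * h i = (P ^+ 2 * C) * (P * h i) by ring.
  apply: ler_pM => //; first exact: ltW.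
  by apply: le_trans (lead_le cW) _; rewrite ler_pM2l ?exprn_gt0.
by lra.
Qed.

Lemma frac_phi0 W g : cand W -> frac R (phi W g) i0 = frac R g i0.
Proof. by move=> /topP[t _ _ _]; rewrite /frac phi_off // eq_sym. Qed.

(** The exact shift would keep the value of [W]; what remains is the rounding by less than one mesh,
    which [M_C] makes harmless. *)
Lemma ev_phi W g : cand W -> margin g ->
  `|ev W (Q e (phi W g)) - ev W (Q 1 g)| <= 1 / (C * T).
Proof.
move=> cW mg; have [t1 _ _ t4] := topP cW; have phiE := phi_top cW mg.
have [f1 f2] := floor_bounds (M%:R * shift W g).
have tne : tl R i0 V W (top W) != 0 by rewrite -normr_gt0.
have sE : tl R i0 V W (top W) * shift W g / (T * h (top W)) =
    lead R i0 W / n * (1 - e) * ((1 + frac R g i0) / 2) / (C * T).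
  by rewrite /shift; field; rewrite tne !gt_eqF.
have -> : ev W (Q e (phi W g)) - ev W (Q 1 g) =
    tl R i0 V W (top W) / (T * h (top W)) / M%:R *
    ((Num.floor (M%:R * shift W g))%:~R - M%:R * shift W g).
  rewrite /Q !ev_pt // frac_phi0 // -/(lead R i0 W).
  have -> : \sum_(i | i != i0) tl R i0 V W i * (frac R (phi W g) i / (T * h i)) =
      \sum_(i | i != i0) tl R i0 V W i * (frac R g i / (T * h i)) +
      tl R i0 V W (top W) * ((Num.floor (M%:R * shift W g))%:~R / M%:R / (T * h (top W))).
    rewrite (bigD1 (top W)) //= [in RHS](bigD1 (top W)) //= [RHS]addrAC -mulrDr.
    congr (_ * _ + _); last by apply: eq_bigr => i /andP[_ it]; rewrite /frac phi_off.
    have := congr1 (fun z : int => z%:~R : R) phiE; rewrite intrD -!pmulrn => E.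
    by rewrite /frac E -mulrDl -mulrDl.
  set b := \sum_(_ | _) _; set w := tl R i0 V W (top W) * _.
  have E2 : lead R i0 W / n * (1 - e) * ((1 + frac R g i0) / 2) / (C * T) =
    tl R i0 V W (top W) * shift W g / (T * h (top W)) by rewrite sE.
  move: E2; set z := lead R i0 W / n => E2.
  have -> : forall a : R, a + z * (e * (1 + frac R g i0) / 2 / (C * T)) + (b + w) -
     (a + z * (1 * (1 + frac R g i0) / 2 / (C * T)) + b) = w - z * (1 - e) * ((1 + frac R g i0) / 2) / (C * T).
    by move=> a; ring.
  by rewrite E2 /w; field; rewrite !gt_eqF.
rewrite normrM -[leRHS]mulr1; apply: ler_pM => //; last first.
  by rewrite ler_norml; apply/andP; split; lra.
rewrite !normrM !normfV (gtr0_norm M0) (gtr0_norm (_ : 0 < T * h (top W))) ?mulr_gt0 //.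
rewrite ler_pdivrMr // ler_pdivrMr ?mulr_gt0 //.
apply: le_trans (tl_le _ cW) _.
have -> : 1 / (C * T) * M%:R * (T * h (top W)) = M%:R / C * h (top W) by field; rewrite !gt_eqF.
rewrite ler_pM2r // ler_pdivlMr //; apply: le_trans M_C.
by rewrite expr2 mulrA.
Qed.

Lemma ev_phi_le W g : cand W -> margin g -> `|ev W (Q 1 g)| <= P / (C * T) ->
  `|ev W (Q e (phi W g))| <= (P + 1) / (C * T).
Proof.
move=> cW mg Wx; have -> : ev W (Q e (phi W g)) =
  ev W (Q 1 g) + (ev W (Q e (phi W g)) - ev W (Q 1 g)) by ring.
by apply: le_trans (ler_normD _ _) _; rewrite mulrDl; apply: lerD Wx (ev_phi cW mg).
Qed.

Lemma evQ s g : ev V (Q s g) = s * ((1 + frac R g i0) / 2) / (C * T).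
Proof. by rewrite /Q ev_ptV // Vx add0r mulrA. Qed.

(** For fixed [W] the shift depends on [g i0] alone, which [phi] does not change. *)
Lemma phi_inj W g1 g2 : cand W -> margin g1 -> margin g2 ->
  phi W g1 = phi W g2 -> g1 = g2.
Proof.
move=> cW m1 m2 e12; have [t1 _ _ _] := topP cW.
have off i : i != top W -> g1 i = g2 i by move=> it; rewrite -(phi_off g1 it) e12 phi_off.
have sh : shift W g1 = shift W g2 by rewrite /shift /frac off // eq_sym.
apply/ffunP => i; have [->|/off//] := eqVneq i (top W).
have := phi_top cW m1; rewrite e12 (phi_top cW m2) sh => /addIr[] ee.
exact/val_inj.
Qed.

Lemma lead_ratio W : cand W -> n / lead R i0 W * (P + 1) <= e / 4.
Proof.
move=> [_ W2 W3 _ _]; have l0 : 0 < lead R i0 W by rewrite /lead ltr0z.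
have P10 : 0 <= P + 1 by rewrite addr_ge0 // ltW.
have nl : n / lead R i0 W <= P ^+ 2 / lam i0.
  rewrite ler_pdivrMr // mulrAC ler_pdivlMr //.
  have a1 : n <= P * h i0 by apply: le_trans (ler_norm _) (Vle i0).
  apply: le_trans (_ : P * (lam i0 * h i0) <= _); last by rewrite expr2 -mulrA ler_pM2l.
  by rewrite [leRHS]mulrCA [leRHS]mulrC ler_pM2r.
apply: le_trans (ler_wpM2r P10 nl) _.
by rewrite mulrAC ler_pdivrMr //; have := lam_e; lra.
Qed.

Lemma cov_phi W g : cand W -> margin g -> cov (Q 1 g) h' (A ^+ cov_exp d) ->
  `|ev W (Q 1 g)| <= P / (C * T) -> cov (Q e (phi W g)) h' K2.
Proof.
move=> cW mg ycov Wx; have [t1 _ t3 t4] := topP cW; have [_ W2 W3 W4 _] := cW.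
have l0 : 0 < lead R i0 W by rewrite /lead ltr0z.
have P10 : 0 <= P + 1 by rewrite addr_ge0 // ltW.
have PP1 : P <= P + 1 by rewrite lerDl.
have /andP[f0 f1] := frac_bounds R g i0.
have CTi : 0 < (C * T)^-1 by rewrite invr_gt0.
have tr : cov (Q e (phi W g)) h' (36 * A ^+ cov_exp d * (P + 1) ^+ 2 / e + 1 + (P + 1)).
  apply: (cov_transfer (i0 := i0) (i1 := top W) (y := Q 1 g) (V := V) (V' := W)) => //.
  - move=> i ii it; rewrite /Q /pt (negbTE ii); congr (_ + _ / _).
    by rewrite /frac phi_off.
  - by rewrite exprn_ge0 // (le_trans ler01).
  - by rewrite lerDr ltW.
  - by move=> i; apply: le_trans (Vle i) _; rewrite ler_pM2r // lamP.
  - by move=> i; apply: le_trans (W4 i) _; rewrite ler_pM2r.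
  - by apply: le_trans W3 _; rewrite ler_pM2r.
  - by rewrite -normr_gt0.
  - rewrite prodh' evQ mul1r normrM [`|_^-1|]gtr0_norm // ler_pM2r // ger0_norm; lra.
  - rewrite prodh' evQ frac_phi0 // !ler_pM2r //.
    have ef0 : 0 <= e * frac R g i0 by rewrite mulr_ge0 // ltW.
    have ef1 : e * frac R g i0 <= e by rewrite ler_piMr ?(ltW e0) ?(ltW f1).
    by apply/andP; split; lra.
  - by rewrite prodh'; apply: le_trans Wx _; rewrite ler_pM2r.
  - by rewrite prodh'; apply: ev_phi_le.
  - exact: lead_ratio.
move=> a v; have [U [Ua Ux]] := tr a v; exists U; split=> [i|].
  by apply: le_trans (Ua i) _; rewrite ler_pM2r.
by apply: le_trans Ux _; rewrite ler_pM2r // prodh'.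
Qed.

Lemma card_margin : (M%:R / 2) ^+ d <= #|[set g | margin g]|%:R :> R.
Proof.
have -> : #|[set g | margin g]| = #|(ffun_on [pred j : 'I_M | (M' <= j < 3 * M')%N] : pred {ffun 'I_d -> 'I_M})|.
  apply: eq_card => g; rewrite inE; apply/idP/ffun_onP => [/forallP H i|H]; first exact: H.
  by apply/forallP => i; apply: H.
rewrite card_ffun_on card_ord natrX; apply: lerXn2r; rewrite ?nnegrE ?divr_ge0 //.
have lt (j : 'I_(2 * M')) : (M' + j < M)%N by case: j => j /= jM; clear -jM; lia.
pose f (j : 'I_(2 * M')) : 'I_M := Ordinal (lt j).
have finj : injective f by move=> j j' [] /addnI ?; apply/val_inj.
have -> : M%:R / 2 = #|'I_(2 * M')|%:R :> R by rewrite card_ord !natrM; field.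
rewrite ler_nat -(card_codom finj); apply: subset_leq_card; apply/fintype.subsetP => j /codomP[k ->].
by rewrite inE /=; case: k => k /= kM; clear -kM; lia.
Qed.

Lemma step : exists (X : {set {ffun 'I_d -> 'I_M}})
    (c : {ffun 'I_d -> 'I_M} -> 'I_d -> R) (F : {ffun 'I_d -> 'I_M} -> form d),
  [/\ M%:R ^+ d <= 2 ^+ d.+1 * (5 ^+ d * 30 * K2 ^+ d.+1) * #|X|%:R,
  forall g, g \in X -> node i0 (c g) (F g) h' P (K2 * (1 + d%:R * (P * (P + 1)))),
  forall g, g \in X -> `|ev V (c g)| <= 2 * e / (C * T) &
  forall g i, g \in X -> `|c g i - Q e g i| <=
    if i == i0 then P * (P + 1) / (C * T * h' i0) else 0].
Proof.
have K21 : P + 1 <= K2.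
  apply: le_trans K2E; rewrite lerDr addr_ge0 // divr_ge0 ?(ltW e0) //.
  by rewrite !mulr_ge0 ?exprn_ge0 ?addr_ge0 ?(ltW P0) ?(le_trans ler01) // mulr_ge0.
have K2_1 : 1 <= K2 by apply: le_trans K21; rewrite lerDr ltW.
have K20 : 0 < K2 := lt_le_trans ltr01 K2_1.
pose Bad := [set g : {ffun 'I_d -> 'I_M} | `[< bad_point i0 x h lam V A g >]].
pose Good := [set g | margin g] :\: Bad.
have goodP g : g \in Good -> margin g /\ ~ bad_point i0 x h lam V A g.
  by rewrite !inE => /andP[/asboolP ? ?].
(* [margin] holds on a proportion at least [2 ^- d] of the grid and bad points take at most half of
   that. *)
have card_good : M%:R ^+ d <= 2 ^+ d.+1 * #|Good|%:R :> R.
  have Bs : #|Bad|%:R * 2 ^+ d.+1 <= M%:R ^+ d :> R.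
    by apply: bad_small => g; rewrite inE => /asboolP.
  have : #|[set g | margin g]|%:R <= #|Good|%:R + #|Bad|%:R :> R.
    rewrite -natrD ler_nat -(cardsID Bad [set g | margin g]) addnC leq_add2l.
    by apply: subset_leq_card; apply: subsetIr.
  have p20 : 0 < 2 ^+ d :> R by rewrite exprn_gt0.
  move=> /(le_trans card_margin); rewrite expr_div_n ler_pdivrMr // => H.
  by move: Bs; rewrite exprS; lra.
have /choice[w wP] (g : {ffun 'I_d -> 'I_M}) : exists W, g \in Good ->
  [/\ cand W, `|ev W (Q 1 g)| <= P / (C * T) & cov (Q 1 g) h' (A ^+ cov_exp d)].
  have [gG|gG] := boolP (g \in Good); last by exists 0.
  by have [_ /good_cand[? [W [? ?]]]] := goodP g gG; exists W.
pose f g := phi (w g) g.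
pose X := f @: Good.
have /choice[pre preP] g : exists g', g \in X -> g' \in Good /\ f g' = g.
  have [gX|gX] := boolP (g \in X); last by exists g.
  by case/imsetP: gX => g' gG ->; exists g'.
pose F g := w (pre g).
(* A final correction along [i0] puts the center exactly on the hyperplane of the new form. *)
pose c g i := Q e g i - if i == i0 then ev (F g) (Q e g) / lead R i0 (F g) else 0.
have FP g : g \in X -> [/\ cand (F g), `|ev (F g) (Q e g)| <= (P + 1) / (C * T) & cov (Q e g) h' K2].
  move=> gX; have [] := preP g gX; rewrite /F; move: (pre g) => g' g'G fg'.
  have [cW Wx ycov] := wP _ g'G; have [mg _] := goodP _ g'G; rewrite -fg'; split=> //.
    exact: (ev_phi_le cW mg Wx).
  exact: (cov_phi cW mg ycov Wx).
have cQ g i : g \in X -> `|c g i - Q e g i| <= if i == i0 then P * (P + 1) / (C * T * h' i0) else 0.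
  move=> gX; have [[_ W2 W3 _ _] Fx _] := FP g gX.
  rewrite /c addrAC subrr add0r; case: eqP => _; last by rewrite oppr0 normr0.
  have l0 : 0 < lead R i0 (F g) by rewrite /lead ltr0z.
  rewrite normrN normrM normfV (gtr0_norm l0) ler_pdivrMr //; apply: le_trans Fx _.
  have -> : P * (P + 1) / (C * T * h' i0) * lead R i0 (F g) = (P + 1) / (C * T) * (P * lead R i0 (F g) / h' i0).
    by field; rewrite !gt_eqF.
  rewrite ler_peMr //; last by rewrite ler_pdivlMr // mul1r.
  by rewrite divr_ge0 ?(ltW CT0) // addr_ge0 // ltW.
exists X, c, F; split=> //.
- apply: le_trans card_good _; rewrite -mulrA ler_pM2l ?exprn_gt0 // mulrC.
  have NV0 : 0 <= 5 ^+ d * 30 * K2 ^+ d.+1 by rewrite !mulr_ge0 ?exprn_ge0 // ltW.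
  rewrite [#|X|]cardE; apply: (card_le_fibersR (f := f)) NV0 _ _ => [g gG|g].
    by rewrite mem_enum; apply/imsetP; exists g.
  rewrite mem_enum => gX; have [_ _ ycov] := FP g gX.
  set Fib := [set g' in Good | f g' == g].
  have FibP g' : g' \in Fib -> [/\ g' \in Good, margin g', f g' = g & cand (w g')].
    rewrite inE => /andP[gG /eqP fg]; split=> //; first by have [] := goodP _ gG.
    by have [] := wP _ gG.
  (* Points with the same image carry distinct forms, by [phi_inj], and these forms all lie in one
     box at [Q e g], so [cov_count] bounds the fibre. *)
  pose s := [seq w g' | g' <- enum Fib].
  have us : uniq s.
    rewrite map_inj_in_uniq ?enum_uniq // => g1 g2; rewrite !mem_enum => /FibP[_ m1 f1 c1] /FibP[_ m2 f2 c2] ww.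
    by apply: (phi_inj c1 m1 m2); move: f2; rewrite /f -ww => f2; rewrite f2 -f1.
  have sz : size s = #|Fib| by rewrite size_map -cardE.
  have K20' : 0 <= K2 := ltW K20.
  have := @cov_count R d (Q e g) h' K2 (fun i => K2 * h' i) (K2 / \prod_i h' i) s h'1 K2_1 ycov (fun i => lexx _) (lexx _) us.
  rewrite sz prod_scale => /(_ _)/le_trans -> //.
    move=> W /mapP[g' +  ->]; rewrite mem_enum => /FibP[gG mg fg cW].
    have [_ Wx _] := wP _ gG; have [_ _ _ W4 _] := cW; split=> [i|].
      apply: le_trans (W4 i) _; rewrite ler_pM2r //; apply: le_trans K21.
      by rewrite lerDl.
    rewrite prodh' -fg; apply: le_trans (ev_phi_le cW mg Wx) _.
    by rewrite ler_pM2r ?invr_gt0.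
  rewrite le_eqVlt; apply/orP; left; apply/eqP; rewrite [K2 ^+ d.+1]exprSr prodh'.
  by field; rewrite !gt_eqF.
- move=> g gX; have [[W1 W2 W3 W4 _] Fx ycov] := FP g gX.
  have l0 : 0 < lead R i0 (F g) by rewrite /lead ltr0z.
  split=> //.
    rewrite (ev_move (F g) (Q e g)) (bigD1 i0) //= [X in _ + (_ + X)]big1 ?addr0.
      by rewrite /c eqxx -/(lead R i0 (F g)); field; rewrite gt_eqF.
    by move=> i /negbTE ii; rewrite /c ii subr0 subrr mulr0.
  apply: (cov_move (y := Q e g)) => //; first by rewrite mulr_ge0 ?addr_ge0 // ltW.
    exact: ltW.
  move=> i; apply: le_trans (cQ g i gX) _; rewrite prodh'.
  case: eqP => [->|_] //; rewrite divr_ge0 ?mulr_ge0 ?addr_ge0 // ?(ltW P0) ?(ltW T0) ?(ltW C0) ?(ltW (h0 i)) ?(ltW (lam0 i)) //.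
move=> g gX; have [cW Fx _] := FP g gX; have [_ W2 W3 _ _] := cW.
have l0 : 0 < lead R i0 (F g) by rewrite /lead ltr0z.
have /andP[f0 f1] := frac_bounds R g i0.
have -> : ev V (c g) = ev V (Q e g) - n / lead R i0 (F g) * ev (F g) (Q e g).
  rewrite (ev_move V (Q e g)) (bigD1 i0) //= [X in _ + (_ + X)]big1 ?addr0.
    by rewrite /c eqxx -/(lead R i0 V); ring.
  by move=> i /negbTE ii; rewrite /c ii subr0 subrr mulr0.
have r0 : 0 <= n / lead R i0 (F g) by rewrite divr_ge0 // ltW.
have CTi : 0 < (C * T)^-1 by rewrite invr_gt0.
have b1 : `|ev V (Q e g)| <= e / (C * T).
  rewrite evQ !normrM (gtr0_norm CTi) (gtr0_norm e0) ler_pM2r // ler_piMr ?(ltW e0) //.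
  by rewrite -normrM ger0_norm; lra.
have b2 : `|n / lead R i0 (F g) * ev (F g) (Q e g)| <= e / (C * T).
  rewrite normrM (ger0_norm r0); apply: le_trans (ler_wpM2l r0 Fx) _.
  rewrite mulrA ler_pM2r //; apply: le_trans (lead_ratio cW) _.
  by rewrite ler_pdivrMr // ler_peMr ?(ltW e0) // ler1n.
by apply: le_trans (ler_normB _ _) _; rewrite mulr_natl mulr2n mulrDl lerD.
Qed.

End Step.

(** * Positions of the grid points in space *)

Section Geometry.
Variables (R : realType) (d : nat) (i0 : 'I_d).
Variables (x h : 'I_d -> R) (V : form d) (P K e T' : R) (M : nat).
Notation T := (\prod_i h i).
Notation n := (lead R i0 V).
Hypothesis h1 : forall i, 1 <= h i.
Hypothesis P_ge1 : 1 <= P.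
Hypothesis nodeV : node i0 x V h P K.
Hypothesis e0 : 0 < e.
Hypothesis e1 : e <= 1.
Hypothesis T'T : T <= T'.

Let P0 : 0 < P. Proof. exact: lt_le_trans P_ge1. Qed.
Let h0 i : 0 < h i. Proof. exact: lt_le_trans (h1 i). Qed.
Let T0 : 0 < T. Proof. exact: lt_le_trans (prod_ge1 h1). Qed.
Let T'0 : 0 < T'. Proof. exact: lt_le_trans T'T. Qed.
Let n0 : 0 < n. Proof. by rewrite /lead ltr0z; case: nodeV. Qed.
Let Vle i : `|(V.1 i)%:~R : R| <= P * h i. Proof. by case: nodeV. Qed.
Let h0n : h i0 <= P * n. Proof. by case: nodeV. Qed.

Lemma pt_near (g : {ffun 'I_d -> 'I_M}) i :
  `|pt i0 V x h T' e g i - x i| <= d%:R * P ^+ 2 / (T * h i).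
Proof.
have d1 : 1 <= d%:R :> R by rewrite ler1n; case: (d) (i0) => // -[].
have P21 : 1 <= d%:R * P ^+ 2 by rewrite mulr_ege1 // exprn_ege1.
have Th0 j : 0 < T * h j by rewrite mulr_gt0.
rewrite /pt addrAC subrr add0r; case: eqP => [->|_]; last first.
  have /andP[f0 f1] := frac_bounds R g i.
  rewrite ger0_norm ?divr_ge0 ?(ltW (Th0 _)) // ler_pM2r ?invr_gt0 //.
  by apply: le_trans (ltW f1) _.
have /andP[f0 f1] := frac_bounds R g i0.
have s1 : `|slope i0 V x h g : R| <= (d%:R - 1) * (P / T).
  apply: le_trans (ler_norm_sum _ _ _) _.
  apply: le_trans (_ : _ <= \sum_(j | j != i0) P / T) _.
    apply: ler_sum => j _; have /andP[g0 g1] := frac_bounds R g j.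
    have ge : 0 <= frac R g j / (T * h j) by rewrite divr_ge0 // ltW.
    rewrite normrM (ger0_norm ge).
    apply: le_trans (_ : _ <= (P * h j) * (1 / (T * h j))) _.
      by apply: ler_pM => //; rewrite ler_pM2r ?invr_gt0 // ltW.
    by rewrite le_eqVlt; apply/orP; left; apply/eqP; field; rewrite !gt_eqF.
  rewrite sumr_const cardC1 card_ord -[X in X <= _]mulr_natl.
  have dn : (1 <= d)%N by rewrite -(ler_nat R).
  by rewrite -subn1 natrB.
have s2 : `|e * (1 + frac R g i0) / 2 / T'| <= P / T.
  rewrite !normrM !normfV (gtr0_norm e0) (gtr0_norm T'0) (ger0_norm (_ : 0 <= 1 + _)) ?addr_ge0 //.
  rewrite (gtr0_norm (_ : 0 < 2)) //.
  apply: le_trans (_ : 1 / T' <= _).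
    rewrite ler_pM2r ?invr_gt0 //.
    have := frac_bounds R g i0; move: (frac R g i0) => f /andP[? ?].
    have : e * (1 + f) <= 1 * 2 by apply: ler_pM => //; [exact: ltW|rewrite addr_ge0|lra].
    lra.
  apply: ler_pM => //; rewrite ?invr_ge0 ?(ltW T'0) // lef_pV2 ?posrE //.
rewrite normrM normfV (gtr0_norm n0) ler_pdivrMr //.
apply: le_trans (ler_normB _ _) _; apply: le_trans (lerD s2 s1) _.
have -> : P / T + (d%:R - 1) * (P / T) = d%:R * P / T * 1 by ring.
have -> : d%:R * P ^+ 2 / (T * h i0) * n = d%:R * P / T * (P * n / h i0) by field; rewrite !gt_eqF.
by rewrite ler_pM2l ?divr_gt0 ?mulr_gt0 ?(lt_le_trans ltr01 d1) // ler_pdivlMr // mul1r.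
Qed.

(** With the other coordinates fixed, the whole grid occupies only about [e / (T' * h i0)] in
    coordinate [i0]. Hence [T'] replaces [T] there: this is the concentration near the
    hyperplane. *)
Lemma pt_count (Y : {set {ffun 'I_d -> 'I_M}}) (D : 'I_d -> R) :
    (0 < M)%N -> (forall i, 0 <= D i) ->
    (forall g g' i, g \in Y -> g' \in Y ->
      `|pt i0 V x h T' e g i - pt i0 V x h T' e g' i| <= D i) ->
  #|Y|%:R <= \prod_i (M%:R * Num.min 1
    (if i == i0 then 2 * P / e * T' * h i0 * D i0 else T * h i * D i) + 1).
Proof.
move=> Mn D0 YD; have M0 : 0 < M%:R :> R by rewrite ltr0n.
have grid (g g' : {ffun 'I_d -> 'I_M}) i (B : R) : `|frac R g i - frac R g' i| <= B ->
    `|(g i)%:R - (g' i)%:R : R| <= M%:R * Num.min 1 B.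
  move=> fB; rewrite minr_pMr ?(ltW M0) // mulr1 le_min; apply/andP; split.
    have := ltn_ord (g i); have := ltn_ord (g' i); rewrite -!(ltr_nat R) => ? ?.
    have := ler0n R (g i); have := ler0n R (g' i) => ? ?.
    by rewrite ler_norml; apply/andP; split; lra.
  rewrite mulrC -ler_pdivrMr // -[X in _ / X](gtr0_norm M0) -normfV -normrM mulrBl.
  exact: fB.
have Th0 j : 0 < T * h j by rewrite mulr_gt0.
apply: (@grid_count _ _ _ i0) => [i|g g' i gY g'Y ii|g g' gY g'Y gg'].
- rewrite mulr_ge0 // le_min ler01 /=; case: ifP => _; rewrite !mulr_ge0 ?(ltW (h0 _)) ?(ltW T0) ?invr_ge0 ?(ltW T'0) ?(ltW P0) ?(ltW e0) //.
- rewrite (negbTE ii); apply: grid; have := YD g g' i gY g'Y.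
  rewrite /pt (negbTE ii) opprD addrACA subrr add0r -mulrBl normrM normfV (gtr0_norm (Th0 i)).
  by rewrite ler_pdivrMr // mulrC.
- rewrite eqxx; apply: grid; have := YD g g' i0 gY g'Y.
  have -> : pt i0 V x h T' e g i0 - pt i0 V x h T' e g' i0 =
     e / 2 / T' / n * (frac R g i0 - frac R g' i0).
    rewrite /pt eqxx; have -> : slope i0 V x h g = slope i0 V x h g' :> R.
      by apply: eq_bigr => i ii; rewrite /frac gg'.
    by field; rewrite !gt_eqF.
  have c0 : 0 < e / 2 / T' / n by rewrite !divr_gt0.
  rewrite normrM (gtr0_norm c0) mulrC -ler_pdivlMr // => /le_trans; apply.
  have -> : D i0 / (e / 2 / T' / n) = (2 / e * T') * (n * D i0) by field; rewrite !gt_eqF.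
  have -> : 2 * P / e * T' * h i0 * D i0 = (2 / e * T') * (P * h i0 * D i0) by ring.
  have c1 : 0 < 2 / e * T' by rewrite mulr_gt0 // divr_gt0.
  rewrite ler_pM2l // ler_wpM2r //.
  by apply: le_trans (ler_norm _) (Vle i0).
Qed.

End Geometry.

(** * One step with all parameters powers of [A] *)

Section OneStep.
Variables (R : realType) (d : nat) (i0 i2 : 'I_d).
Hypothesis i20 : i2 != i0.
Variables (a p q k2 k j y mu m b c : nat).
Notation A := (a%:R : R).
(** Each exponent exceeds what it must dominate by a surplus that absorbs constants: [p] comes from
    [good_next], [k2] from [cov_transfer], [k] from [cov_move], [j] and [y] from the two terms of
    [node_thin], [b] from [pt_near]. [mu] is the least growth of a side, and [c] collects the losses
    of the grid count and of the fibres in [step]. *)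
Hypothesis pE : p = (cov_exp d + 2)%N.
Hypothesis k2E : k2 = (cov_exp d + 2 * p + q + 1)%N.
Hypothesis kE : k = (k2 + 2 * p + 1)%N.
Hypothesis jE : j = (p + k * d + 1)%N.
Hypothesis yE : y = (j + k * d + 1)%N.
Hypothesis bE : b = (2 * p + 1)%N.
Hypothesis muE : mu = (3 * p + q + k * d.+1 + y + b + 2)%N.
Hypothesis cE : c = ((2 * b + 2 * p + 2) * d + p + q + k2 * d.+1 + 2)%N.
Hypothesis md : (d < m)%N.

(** What a single factor [A] has to absorb. The number of classes of the union bound brings in [m],
    so [A] is chosen after [m]. *)
Definition consts : seq R :=
  [:: 147; 2 ^+ d.+1 * (3 * d.+1%:R) ^+ d; 1 + 2 * d%:R;
      4 * d%:R * 5 ^+ d * 31; (m + 2 * p + 2)%:R * (360 * 10 ^+ d * d%:R) * 2 ^+ d.+1;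
      2 ^+ d.+1 * (5 ^+ d * 30); 2 * (d%:R + 2); 2 ^+ d * 4].
Hypothesis A_consts : forall u, u \in consts -> u < A.

Let A147 : 147 < A. Proof. by apply: A_consts; rewrite !inE eqxx ?orbT. Qed.
Let A0 : 0 < A. Proof. by apply: lt_trans A147; rewrite ltr0n. Qed.
Let A1 : 1 <= A. Proof. by apply: le_trans (ltW A147); rewrite ler1n. Qed.

Let pw_le (u v : nat) : (u <= v)%N -> A ^+ u <= A ^+ v.
Proof. by move=> uv; rewrite ler_weXn2l. Qed.
Let pw0 (u : nat) : 0 < A ^+ u. Proof. exact: exprn_gt0. Qed.
Let pwge0 (u : nat) : 0 <= A ^+ u. Proof. exact: ltW. Qed.
Let pw1 (u : nat) : 1 <= A ^+ u. Proof. exact: exprn_ege1. Qed.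
Let pwc (w : R) (u v : nat) : w <= A -> (u < v)%N -> w * A ^+ u <= A ^+ v.
Proof.
move=> wA uv; apply: le_trans (_ : A ^+ u.+1 <= _); last exact: pw_le.
by rewrite exprS ler_pM2r.
Qed.

Variables (x h lam : 'I_d -> R) (V : form d).
Notation T := (\prod_i h i).
Notation C := (\prod_i lam i).
Notation h' := (fun i => lam i * h i).
Hypothesis h1 : forall i, 1 <= h i.
Hypothesis nodeV : node i0 x V h (A ^+ p) (A ^+ k).
Hypothesis lam_mu : forall i, A ^+ mu <= lam i.
Hypothesis CE : C = A ^+ m.

Let d1 : 1 <= d%:R :> R. Proof. by rewrite ler1n; case: (d) (i0) => // -[]. Qed.
Let lam_ge (v : nat) i : (v <= mu)%N -> A ^+ v <= lam i.
Proof. by move=> vm; apply: le_trans (lam_mu i); apply: pw_le. Qed.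
Let lam1 i : 1 <= lam i. Proof. exact: le_trans (lam_mu i). Qed.
Let lam0 i : 0 < lam i. Proof. exact: lt_le_trans (lam1 i). Qed.
Let C0 : 0 < C. Proof. by rewrite CE. Qed.
(** The second coordinate [i2] makes [C] much larger than [lam i0]; without this the tube of near
    multiples of [V] would not be negligible. *)
Let C_i0 : lam i0 * A ^+ mu <= C.
Proof.
rewrite (bigD1 i0) //= ler_pM2l // (bigD1 i2) //= -[leLHS]mulr1.
apply: ler_pM => //.
by elim/big_rec: _ => // u v _ v1; rewrite mulr_ege1.
Qed.

Lemma Step_bad (M : nat) : 2 * (A ^+ p) ^+ 2 * C ^+ 2 * A <= M%:R ->
  forall Bad : {set {ffun 'I_d -> 'I_M}},
  (forall g, g \in Bad -> bad_point i0 x h lam V A g) ->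
  #|Bad|%:R * 2 ^+ d.+1 <= (M%:R : R) ^+ d.
Proof.
move=> MC Bad badP; pose B : R := 360 * 10 ^+ d * d%:R.
have B0 : 0 < B by rewrite !mulr_gt0 ?exprn_gt0 // (lt_le_trans ltr01).
(* Each class contributes a proportion about [1 / A]; the number of classes is linear in [m], and
   one of the [consts] covers it. *)
have := @bad_count R d i0 i2 i20 x h lam V (A ^+ p) (A ^+ k) A (A ^+ k) (A ^+ y)^-1 (B / A) (a ^ j) M (m + 2 * p + 1).
move=> /(_ h1 (pw1 _) (pw1 _) nodeV) H.
have {}H : #|Bad|%:R <= (m + 2 * p + 1).+1%:R * (B / A * M%:R ^+ d).
  apply: H => //.
  - by apply: lt_trans A147; rewrite ltr_nat.
  - by apply: pw_le; clear -kE k2E; lia.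
  - by rewrite invr_gt0.
  - by rewrite expn_gt0 -(ltr_nat R) A0.
  - have K4 : 4 * d%:R * 5 ^+ d * 31 < A by apply: A_consts; rewrite !inE eqxx ?orbT.
    have p5 : 1 <= 5 ^+ d :> R by rewrite exprn_ege1 // ler1n.
    rewrite natrX mulrDl.
    have -> : A ^+ j * ((A ^+ y)^-1 * d%:R) * (5 ^+ d * 31 * (A ^+ k) ^+ d) = (d%:R * 5 ^+ d * 31) * A ^+ (j + k * d) / A ^+ y.
      by rewrite exprD exprM; field; rewrite !gt_eqF.
    have -> : A ^+ p / A ^+ j * (5 ^+ d * 31 * (A ^+ k) ^+ d) = (5 ^+ d * 31) * A ^+ (p + k * d) / A ^+ j.
      by rewrite exprD exprM; field; rewrite !gt_eqF.
    have t1 : d%:R * 5 ^+ d * 31 * A ^+ (j + k * d) / A ^+ y <= 1 / 4.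
      rewrite ler_pdivrMr // -(ler_pM2l (_ : 0 < 4)) // [leRHS]mulrA.
      have -> : 4 * (1 / 4) = 1 :> R by field.
      rewrite mul1r !mulrA; apply: pwc; first exact: ltW.
      by clear -yE; lia.
    have t2 : 5 ^+ d * 31 * A ^+ (p + k * d) / A ^+ j <= 1 / 4.
      rewrite ler_pdivrMr // -(ler_pM2l (_ : 0 < 4)) // [leRHS]mulrA.
      have -> : 4 * (1 / 4) = 1 :> R by field.
      rewrite mul1r !mulrA; apply: pwc; last by clear -jE; lia.
      apply: le_trans (ltW K4); rewrite ler_pM2r // ler_pM2r ?(lt_le_trans ltr01 p5) //.
      by rewrite ler_peMr.
    lra.
  - by move=> i; rewrite -exprSr; apply: lam_ge; clear -muE; lia.
  - rewrite ler_pdivrMr //; apply: le_trans (_ : (2 * A ^+ p) * lam i0 <= _).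
      by have := mulr_ege1 (lam1 i0) (pw1 p); lra.
    rewrite mulrC; apply: le_trans (_ : lam i0 * (A ^+ mu / A ^+ y) <= _).
      rewrite ler_pM2l // ler_pdivlMr // -mulrA -exprD; apply: pwc.
        by apply: le_trans (ltW A147); rewrite ler_nat.
      by clear -muE; lia.
    by rewrite mulrA mulrC ler_pM2l ?invr_gt0.
  - rewrite CE -exprM -mulrA -!exprD; apply: le_lt_trans (_ : A * A ^+ (p * 2 + m) < _).
      by rewrite ler_pM2r // (le_trans _ (ltW A147)) // ler_nat.
    by rewrite -exprS; rewrite ltr_eXn2l; [clear -kE; lia|apply: lt_trans A147; rewrite ltr1n].
  - apply: le_trans (_ : (4 * (lam i0 * A ^+ p)) * (5 ^+ d * 30 * (2 ^+ d * (A ^+ k) ^+ d * (d%:R * A ^+ k))) * (3 / (C * (A ^+ y)^-1)) <= _).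
      rewrite ler_pM2r ?divr_gt0 ?mulr_gt0 ?invr_gt0 // ler_pM2r.
        by have := mulr_ege1 (lam1 i0) (pw1 p); lra.
      by rewrite !mulr_gt0 ?exprn_gt0 // (lt_le_trans ltr01).
    have -> : 4 * (lam i0 * A ^+ p) * (5 ^+ d * 30 * (2 ^+ d * (A ^+ k) ^+ d * (d%:R * A ^+ k))) * (3 / (C * (A ^+ y)^-1)) =
       B * ((lam i0 * A ^+ (p + k * d.+1 + y)) / C).
      have t10 : 10 ^+ d = 5 ^+ d * 2 ^+ d :> R by rewrite -exprMn; congr (_ ^+ _); ring.
      by rewrite /B t10 !exprD exprM [(A ^+ k) ^+ d.+1]exprSr; field; rewrite !gt_eqF.
    rewrite ler_pM2l // ler_pdivrMr // [leRHS]mulrC ler_pdivlMr // -mulrA -exprSr.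
    apply: le_trans C_i0; rewrite ler_pM2l //; apply: pw_le; clear -muE; lia.
  - apply: ler_pM; rewrite ?mulr_ge0 ?exprn_ge0 ?invr_ge0 ?(ltW A0) //.
      have e5 : 5 ^+ d <= 10 ^+ d :> R by apply: lerXn2r; rewrite ?nnegrE // ler_nat.
      have e50 : 0 <= 5 ^+ d :> R by apply: exprn_ge0.
      by rewrite /B ler_pM2r ?(lt_le_trans ltr01) //; lra.
    case: (d) (i0) => [[]//|d' _]; rewrite exprS ler_piMr ?invr_ge0 ?(ltW A0) //.
    by rewrite exprn_ile1 ?invr_ge0 ?(ltW A0) // invf_le1.
have Md : 0 <= M%:R ^+ d :> R by rewrite exprn_ge0.
apply: le_trans (ler_wpM2r _ H) _; first exact: exprn_ge0.
have K5 : (m + 2 * p + 2)%:R * B * 2 ^+ d.+1 <= A.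
  by apply/ltW/A_consts; rewrite !inE eqxx ?orbT.
have -> : (m + 2 * p + 1).+1%:R * (B / A * M%:R ^+ d) * 2 ^+ d.+1 =
   ((m + 2 * p + 2)%:R * B * 2 ^+ d.+1 / A) * M%:R ^+ d.
  rewrite (_ : (m + 2 * p + 1).+1 = (m + 2 * p + 2)%N); last by clear; lia.
  by ring.
by rewrite ler_piMl // ler_pdivrMr // mul1r.
Qed.

Notation s u := ((T * h u)^-1).
Notation s' u := ((C * T * (lam u * h u))^-1).

Let C1 : 1 <= C. Proof. by rewrite CE. Qed.
Let h0 i : 0 < h i. Proof. exact: lt_le_trans (h1 i). Qed.
Let T0 : 0 < T. Proof. exact: lt_le_trans (prod_ge1 h1). Qed.
Let lamC i : lam i <= C.
Proof.
rewrite (bigD1 i) //= ler_peMr ?(ltW (lam0 i)) //.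
by elim/big_rec: _ => // u v _ v1; rewrite mulr_ege1.
Qed.

Let s0 i : 0 < s i. Proof. by rewrite invr_gt0 mulr_gt0. Qed.
Let s'0 i : 0 < s' i. Proof. by rewrite invr_gt0 !mulr_gt0. Qed.
Let s's i : s' i = s i / (C * lam i).
Proof. by field; rewrite !gt_eqF. Qed.
Let s'_le i : s' i <= s i.
Proof. by rewrite s's ler_pdivrMr ?mulr_gt0 // ler_peMr ?(ltW (s0 i)) // mulr_ege1. Qed.

(* The factor [C] at the coordinate [i0] accounts for the children lying in a
   neighbourhood of the hyperplane [V = 0]. *)
Lemma one_step : exists (G : finType) (X : {set G}) (cen : G -> 'I_d -> R)
    (F : G -> form d), [/\ (0 < #|X|)%N,
  forall g, g \in X -> node i0 (cen g) (F g) h' (A ^+ p) (A ^+ k),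
  forall g, g \in X -> `|ev V (cen g)| <= 2 / A ^+ q / (C * T),
  forall g i, g \in X -> `|cen g i - x i| <= A ^+ b / 2 * s i &
  forall (rho : R) (Y : {set G}), 0 <= rho -> Y \subset X ->
    (forall g g' i, g \in Y -> g' \in Y ->
       `|cen g i - cen g' i| <= A ^+ (2 * b + 1) * Num.max rho (s' i)) ->
    #|Y|%:R <= #|X|%:R * (A ^+ c *
      \prod_i Num.min 1 ((if i == i0 then C else 1) * Num.max rho (s' i) / s i))].
Proof.
pose L : R := 8 + 2 * (A ^+ p) ^+ 3 * C ^+ 2 + 2 * (A ^+ p) ^+ 2 * C ^+ 2 * A + C ^+ 2.
have Lpos : [/\ 0 <= 2 * (A ^+ p) ^+ 3 * C ^+ 2, 0 <= 2 * (A ^+ p) ^+ 2 * C ^+ 2 * A & 0 <= C ^+ 2].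
  by split; rewrite ?mulr_ge0 ?exprn_ge0 ?(ltW C0) ?(ltW A0) ?(ltW (pw0 p)).
have [Lp1 Lp2 Lp3] := Lpos.
have L0 : 0 <= L by rewrite /L !addr_ge0.
have [_ L2] := truncn_bounds L0; set M' := (Num.truncn L).+1.
have LM : L <= (4 * M')%:R by rewrite natrM /M' -natr1; have := ler0n R (Num.truncn L); lra.
have M8 : 8 <= (4 * M')%:R :> R by rewrite /L in LM; lra.
have MC : 2 * (A ^+ p) ^+ 3 * C ^+ 2 <= (4 * M')%:R by rewrite /L in LM; lra.
have MC2 : 2 * (A ^+ p) ^+ 2 * C ^+ 2 * A <= (4 * M')%:R by rewrite /L in LM; lra.
have MC3 : C ^+ 2 <= (4 * M')%:R by rewrite /L in LM; lra.
clearbody M'; clear L Lpos Lp1 Lp2 Lp3 L0 L2 LM.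
have bad := Step_bad MC2.
set M := (4 * M')%N in M8 MC MC2 MC3 bad.
have A8 (u : R) : u <= 147 -> u <= A by move=> u147; apply: le_trans u147 (ltW A147).
have q0 : 0 < (A ^+ q)^-1 by rewrite invr_gt0.
have q1 : (A ^+ q)^-1 <= 1 by rewrite invf_le1.
have pp : A ^+ p * (A ^+ p + 1) <= 2 * A ^+ (2 * p).
  have := pw1 p; have : A ^+ p <= A ^+ (2 * p) by apply: pw_le; clear; lia.
  by rewrite mulrDr mulr1 -exprD addnn -mul2n; lra.
have K2E : 36 * A ^+ cov_exp d * (A ^+ p + 1) ^+ 2 / (A ^+ q)^-1 + 1 + (A ^+ p + 1) <= A ^+ k2.
  have e1 : (A ^+ p + 1) ^+ 2 <= 4 * A ^+ (2 * p).
    have := pw1 p; have := pw0 p; rewrite mul2n -addnn exprD => ? ?; nra.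
  have -> : A ^+ k2 = A * A ^+ (cov_exp d + 2 * p + q) by rewrite k2E addn1 exprS.
  have e2 : 36 * A ^+ cov_exp d * (A ^+ p + 1) ^+ 2 / (A ^+ q)^-1 <= 144 * A ^+ (cov_exp d + 2 * p + q).
    rewrite invrK (exprD _ (cov_exp d + 2 * p) q) (exprD _ (cov_exp d) (2 * p)); apply: le_trans (_ : 36 * A ^+ cov_exp d * (4 * A ^+ (2 * p)) * A ^+ q <= _).
      by rewrite ler_pM2r //; apply: ler_wpM2l => //; rewrite mulr_ge0 // ltW //.
    by rewrite le_eqVlt; apply/orP; left; apply/eqP; ring.
  have e3 : A ^+ p <= A ^+ (cov_exp d + 2 * p + q) by apply: pw_le; clear; lia.
  have e4 := pw1 (cov_exp d + 2 * p + q).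
  have e5 : 147 * A ^+ (cov_exp d + 2 * p + q) <= A * A ^+ (cov_exp d + 2 * p + q).
    by rewrite ler_pM2r // ltW.
  lra.
have PA : (3 * A ^+ cov_exp d + 1) * A <= A ^+ p.
  rewrite pE addn2 exprSr ler_pM2r // exprS.
  have e1 : 4 * A ^+ cov_exp d <= A * A ^+ cov_exp d.
    by rewrite ler_pM2r // A8 // ler_nat.
  by have := pw1 (cov_exp d); lra.
have AC : A ^+ d.+1 <= C by rewrite CE; apply: pw_le.
have lamP i : 8 * (A ^+ p) ^+ 3 <= lam i.
  rewrite -exprM; apply: le_trans (_ : A ^+ (p * 3).+1 <= _).
    by apply: pwc => //; apply: A8; rewrite ler_nat.
  by apply: lam_ge; clear -muE; lia.
have lame : 4 * (A ^+ p) ^+ 2 * (A ^+ p + 1) <= (A ^+ q)^-1 * lam i0.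
  rewrite mulrC ler_pdivlMl //.
  apply: le_trans (_ : A ^+ (q + p * 3).+1 <= _); last by apply: lam_ge; clear -muE; lia.
  apply: le_trans (_ : 8 * A ^+ (q + p * 3) <= _); last by apply: pwc => //; apply: A8; rewrite ler_nat.
  rewrite exprD exprM [in leRHS]exprS -exprM; have e1 := pw1 p.
  have -> : 8 * (A ^+ q * (A ^+ p * A ^+ (p * 2))) = A ^+ q * (2 * A ^+ p * (4 * A ^+ (p * 2))) by ring.
  rewrite ler_pM2l // ler_pM2r ?mulr_gt0 //; lra.
have A_min : 2 ^+ d.+1 * (3 * d.+1%:R) ^+ d < A by apply: A_consts; rewrite !inE eqxx ?orbT.
have [X [cen [F [XM Xnode Xev Xcen]]]] := @step R d i0 i2 i20 x h lam V (A ^+ p) (A ^+ k) A (A ^+ q)^-1 (A ^+ k2) M'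
  h1 (pw1 p) nodeV A1 A_min AC PA lamP lame q0 q1 K2E M8 MC bad.
exists {ffun 'I_d -> 'I_M}, X, cen, F.
have C2 := exprn_ege1 2 C1.
have M0 : 0 < M%:R :> R by lra.
have Md0 : 0 < M%:R ^+ d :> R by rewrite exprn_gt0.
have X0 : (0 < #|X|)%N.
  rewrite lt0n; apply/eqP => X0; move: XM; rewrite X0 mulr0.
  by rewrite leNgt Md0.
have TC : T <= C * T by rewrite ler_peMl // ltW.
have near i : A ^+ p * (A ^+ p + 1) / (C * T * (lam i * h i)) <= 2 * A ^+ (2 * p) * s' i.
  by rewrite ler_pM2r // s'0.
have pp2 : (A ^+ p) ^+ 2 = A ^+ (2 * p) by rewrite -exprM mulnC.
split=> //.
- move=> g gX; have [? ? ? ? ? cov1] := Xnode g gX; split=> //.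
  move=> u v; have [W [Wa Wx]] := cov1 u v; exists W.
  have KK : A ^+ k2 * (1 + d%:R * (A ^+ p * (A ^+ p + 1))) <= A ^+ k.
    have -> : A ^+ k = A ^+ k2 * (A * A ^+ (2 * p)) by rewrite kE addn1 exprS exprD; ring.
    rewrite ler_pM2l //.
    have A3 : 1 + 2 * d%:R <= A by apply/ltW/A_consts; rewrite !inE eqxx ?orbT.
    apply: le_trans (_ : (1 + 2 * d%:R) * A ^+ (2 * p) <= _); last by rewrite ler_pM2r.
    rewrite mulrDl mul1r; apply: lerD => //.
    by rewrite mulrAC [leRHS]mulrC; apply: ler_wpM2l.
  have T'0 : 0 < \prod_i (lam i * h i) by apply: prodr_gt0 => i _; apply: mulr_gt0.
  split=> [i|]; first by apply: le_trans (Wa i) _; rewrite ler_pM2r // mulr_gt0.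
  by apply: le_trans Wx _; rewrite ler_pM2r ?invr_gt0.
- move=> g i gX.
  have -> : cen g i - x i = (cen g i - pt i0 V x h (C * T) (A ^+ q)^-1 g i) + (pt i0 V x h (C * T) (A ^+ q)^-1 g i - x i) by ring.
  apply: le_trans (ler_normD _ _) _.
  have := pt_near h1 (pw1 p) nodeV q0 q1 TC g i; rewrite pp2 => ptn.
  have := Xcen g i gX => xc.
  have xc' : `|cen g i - pt i0 V x h (C * T) (A ^+ q)^-1 g i| <= 2 * A ^+ (2 * p) * s i.
    apply: le_trans xc _; case: eqP => [->|_]; last by rewrite mulr_ge0 ?(ltW (s0 i)) // mulr_ge0.
    by apply: le_trans (near i0) _; rewrite ler_pM2l ?s'_le // mulr_gt0.
  apply: le_trans (lerD xc' ptn) _; rewrite -mulrDl -mulrDl ler_pM2r ?s0 //.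
  rewrite ler_pdivlMr // bE addn1 exprS mulrAC ler_pM2r //.
  have : 2 * (d%:R + 2) <= A by apply/ltW/A_consts; rewrite !inE eqxx ?orbT.
  lra.
move=> rho Y rho0 YX Yc.
(* Grid points differ from the centers by at most [2 * A ^+ (2 * p) * s' i], so closeness of centers
   passes to the grid. *)
pose D i := A ^+ (2 * b + 2 * p + 2) * Num.max rho (s' i).
have mx0 i : 0 < Num.max rho (s' i) by rewrite lt_max s'0 orbT.
have D0 i : 0 <= D i by rewrite mulr_ge0 // ltW.
have YD g g' i : g \in Y -> g' \in Y ->
    `|pt i0 V x h (C * T) (A ^+ q)^-1 g i - pt i0 V x h (C * T) (A ^+ q)^-1 g' i| <= D i.
  move=> gY g'Y.
  have gX : g \in X by apply: (fintype.subsetP YX).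
  have g'X : g' \in X by apply: (fintype.subsetP YX).
  have cc := Yc g g' i gY g'Y.
  have xc' u : u \in X -> `|cen u i - pt i0 V x h (C * T) (A ^+ q)^-1 u i| <= 2 * A ^+ (2 * p) * Num.max rho (s' i).
    move=> uX; apply: le_trans (Xcen u i uX) _.
    case: eqP => [->|_]; last by rewrite mulr_ge0 ?(ltW (mx0 i)) // mulr_ge0.
    by apply: le_trans (near i0) _; rewrite ler_pM2l ?mulr_gt0 // le_max lexx orbT.
  have -> : pt i0 V x h (C * T) (A ^+ q)^-1 g i - pt i0 V x h (C * T) (A ^+ q)^-1 g' i =
    (cen g i - cen g' i) - (cen g i - pt i0 V x h (C * T) (A ^+ q)^-1 g i) + (cen g' i - pt i0 V x h (C * T) (A ^+ q)^-1 g' i) by ring.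
  apply: le_trans (ler_normD _ _) _; apply: le_trans (lerD (ler_normB _ _) (lexx _)) _.
  apply: le_trans (lerD (lerD cc (xc' g gX)) (xc' g' g'X)) _.
  rewrite -!mulrDl /D ler_pM2r ?mx0 //.
  have u1 : A ^+ (2 * b + 1) <= A ^+ (2 * b + 2 * p + 1) by apply: pw_le; clear; lia.
  have u2 : 2 * A ^+ (2 * p) <= A ^+ (2 * b + 2 * p + 1).
    by apply: pwc; [apply: A8; rewrite ler_nat|clear; lia].
  have u3 : 3 * A ^+ (2 * b + 2 * p + 1) <= A ^+ (2 * b + 2 * p + 2).
    by apply: pwc; [apply: A8; rewrite ler_nat|clear; lia].
  lra.
pose Z i := (if i == i0 then C else 1) * Num.max rho (s' i) / s i.
pose ka i := (if i == i0 then 2 * A ^+ (p + q) else 1) * A ^+ (2 * b + 2 * p + 2).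
have ka1 i : 1 <= ka i.
  by rewrite /ka; case: ifP => _; rewrite !mulr_ege1 // ler1n.
have Z0 i : 0 < Z i.
  by apply: divr_gt0 (s0 i); apply: mulr_gt0 (mx0 i); case: ifP.
have ZC i : (C ^+ 2)^-1 <= Z i.
  apply: le_trans (_ : s' i / s i <= _).
    rewrite s's mulrAC divff ?gt_eqF // mul1r lef_pV2 ?posrE ?mulr_gt0 ?exprn_gt0 //.
    by rewrite expr2 ler_pM2l.
  rewrite /Z ler_pM2r ?invr_gt0 ?mulr_gt0 //; apply: le_trans (_ : Num.max rho (s' i) <= _).
    by rewrite le_max lexx orbT.
  by rewrite ler_peMl ?(ltW (mx0 i)) //; case: ifP.
have mz (u v : R) : 1 <= u -> 0 < v -> Num.min 1 (u * v) <= u * Num.min 1 v.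
  move=> u1 v0; have u0 : 0 <= u by apply: le_trans u1.
  by rewrite [leRHS]minr_pMr // mulr1 le_min !ge_min u1 lexx orbT.
have Mn : (0 < M)%N by rewrite -(ltr_nat R).
have Bkz i : (if i == i0 then 2 * A ^+ p / (A ^+ q)^-1 * (C * T) * h i0 * D i0 else T * h i * D i) = ka i * Z i.
  rewrite /ka /Z /D; case: eqP => [->|_]; last by field; rewrite !gt_eqF.
  by rewrite (exprD _ p q); field; rewrite !gt_eqF.
apply: le_trans (@pt_count R d i0 x h V (A ^+ p) (A ^+ k) (A ^+ q)^-1 (C * T) M h1 (pw1 p) nodeV q0 TC Y D Mn D0 YD) _.
apply: le_trans (_ : _ <= \prod_i (2 * M%:R * ka i * Num.min 1 (Z i))) _.
  apply: ler_prod => i _; rewrite Bkz.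
  have mn0 (u : R) : 0 < u -> 0 <= Num.min 1 u by move=> u0; rewrite le_min ler01 ltW.
  have ka0 : 0 < ka i := lt_le_trans ltr01 (ka1 i).
  rewrite addr_ge0 ?(mulr_ge0 _ (mn0 _ (mulr_gt0 ka0 (Z0 i)))) //=.
  (* The [+ 1] of the grid count is absorbed by a factor 2, because [Z i] is at least [1 / C ^+ 2]
     and [M] at least [C ^+ 2]. *)
  have big : 1 <= M%:R * (ka i * Num.min 1 (Z i)).
    apply: le_trans (_ : C ^+ 2 * (1 * (C ^+ 2)^-1) <= _); first by rewrite mul1r divff // gt_eqF // exprn_gt0.
    apply: ler_pM => //; rewrite ?mul1r ?exprn_ge0 ?invr_ge0 ?exprn_ge0 ?(ltW C0) //.
    apply: le_trans (_ : 1 * Num.min 1 (Z i) <= _); last by apply: ler_wpM2r => //; apply: mn0.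
    by rewrite mul1r le_min ZC invf_le1 ?exprn_gt0 // C2.
  have : M%:R * Num.min 1 (ka i * Z i) <= M%:R * (ka i * Num.min 1 (Z i)).
    by rewrite ler_pM2l //; apply: mz.
  lra.
have -> : \prod_i (2 * M%:R * ka i * Num.min 1 (Z i)) =
    (2 * M%:R) ^+ d * \prod_i ka i * \prod_i Num.min 1 (Z i).
  by rewrite -prod_scale -big_split.
set PZ := \prod_i Num.min 1 (Z i).
have PZ0 : 0 <= PZ by apply: prodr_ge0 => i _; rewrite le_min ler01 ltW.
rewrite mulrA; apply: ler_wpM2r => //.
have -> : \prod_i ka i = 2 * A ^+ (p + q) * A ^+ ((2 * b + 2 * p + 2) * d).
  rewrite big_split /= prodr_const card_ord -exprM (bigD1 i0) //= eqxx.
  by rewrite [X in _ * X * _]big1 ?mulr1 // => i /negbTE->.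
rewrite exprMn.
apply: le_trans (_ : 2 ^+ d * (2 ^+ d.+1 * (5 ^+ d * 30 * (A ^+ k2) ^+ d.+1) * #|X|%:R) * (2 * A ^+ (p + q) * A ^+ ((2 * b + 2 * p + 2) * d)) <= _).
  by rewrite ler_pM2r ?mulr_gt0 // ler_pM2l // exprn_gt0.
have K6 : 2 ^+ d.+1 * (5 ^+ d * 30) <= A by apply/ltW/A_consts; rewrite !inE eqxx ?orbT.
have K8 : 2 ^+ d * 4 <= A by apply/ltW/A_consts; rewrite !inE eqxx ?orbT.
have -> : A ^+ c = A * A * (A ^+ (p + q) * A ^+ ((2 * b + 2 * p + 2) * d) * A ^+ (k2 * d.+1)).
  rewrite (_ : c = (p + q + (2 * b + 2 * p + 2) * d + k2 * d.+1).+2); last by clear -cE; lia.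
  by rewrite 2!exprS (exprD _ (p + q + _) (k2 * _)) (exprD _ (p + q) (_ * d)) mulrA.
rewrite -exprM.
set w := A ^+ (p + q); set w2 := A ^+ (_ * d); set w3 := A ^+ (k2 * _).
have -> : 2 ^+ d * (2 ^+ d.+1 * (5 ^+ d * 30 * w3) * #|X|%:R) * (2 * w * w2) =
   ((2 ^+ d * 2) * (2 ^+ d.+1 * (5 ^+ d * 30))) * (#|X|%:R * (w * w2 * w3)) by ring.
have -> : #|X|%:R * (A * A * (w * w2 * w3)) = (A * A) * (#|X|%:R * (w * w2 * w3)) by ring.
apply: ler_wpM2r; first by rewrite !mulr_ge0 //; apply: pwge0.
apply: ler_pM; rewrite ?mulr_ge0 ?exprn_ge0 //.
by apply: le_trans K8; rewrite ler_pM2l ?exprn_gt0 // ler_nat.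
Qed.

End OneStep.

(** * The inequality between the potentials of two consecutive levels *)

Section Potential.
Variables (R : realType) (d : nat) (i0 : 'I_d).

(** One coordinate: the share of children that are met, times the share of a child that is filled,
    telescopes to the share of the parent, up to the concentration [C]. *)
Lemma min_max_le (C rho s s' : R) : 1 <= C -> 0 < rho -> 0 < s' -> s' <= s ->
  Num.min 1 (C * Num.max rho s' / s) * Num.min 1 (rho / s') <=
  C * Num.min 1 (rho / s).
Proof.
move=> C1 rho0 s'0 s's; have s0 : 0 < s := lt_le_trans s'0 s's.
have C0 : 0 < C := lt_le_trans ltr01 C1.
have [rs|sr] := leP s' rho.
  have -> : Num.min 1 (rho / s') = 1 by apply/min_idPl; rewrite ler_pdivlMr // mul1r.
  rewrite mulr1 (minr_pMr _ _ (ltW C0)) mulr1 le_min; apply/andP; split.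
    by apply: le_trans C1; rewrite ge_min lexx.
  by rewrite ge_min mulrA lexx orbT.
have -> : Num.min 1 (rho / s) = rho / s.
  by apply/min_idPr; rewrite ler_pdivrMr // mul1r ltW // (lt_le_trans sr).
have -> : Num.min 1 (rho / s') = rho / s'.
  by apply/min_idPr; rewrite ler_pdivrMr // mul1r ltW.
apply: le_trans (_ : (C * s' / s) * (rho / s') <= _).
  by rewrite ler_pM2r ?divr_gt0 // ge_min lexx orbT.
by rewrite le_eqVlt; apply/orP; left; apply/eqP; field; rewrite !gt_eqF.
Qed.

(* The factor [C] lost at [i0] is paid by [X] and the factor [B] by [Y]; when
   [X] or [Y] is too small to pay, [rho] is so large that nothing is lost. *)
Lemma potential_le (s s' : 'I_d -> R) (rho f B C T X Y eta : R) :
    0 < rho -> (forall i, 0 < s' i) -> (forall i, s' i <= s i) ->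
    1 <= C -> 1 <= T -> 0 < eta -> 0 < B -> B <= C `^ eta -> 0 <= X -> X <= Y ->
    (X < C * T -> s i0 <= rho) -> (Y < C * T -> forall i, s i <= rho) ->
    0 <= f -> f <= 1 ->
    f <= B * \prod_i Num.min 1 ((if i == i0 then C else 1) * Num.max rho (s' i) / s i) ->
  f * (\prod_i Num.min 1 (rho / s' i) * Num.max 1 (X / (C * T)) *
       (Num.max 1 (Y / (C * T))) `^ eta) <=
  \prod_i Num.min 1 (rho / s i) * Num.max 1 (X / T) * (Num.max 1 (Y / T)) `^ eta.
Proof.
move=> rho0 s'0 s's C1 T1 eta0 B0 BC X0 XY XC YC f0 f1 fB.
have C0 : 0 < C := lt_le_trans ltr01 C1; have T0 : 0 < T := lt_le_trans ltr01 T1.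
have s0 i : 0 < s i := lt_le_trans (s'0 i) (s's i).
have CT0 : 0 < C * T by rewrite mulr_gt0.
have mn0 (u : R) : 0 < u -> 0 <= Num.min 1 u by move=> u0; rewrite le_min ler01 ltW.
have mn1 (u : R) : Num.min 1 u <= 1 by rewrite ge_min lexx.
have mx0 (u : R) : 0 <= Num.max 1 u by rewrite le_max ler01.
have rs0 i : 0 < rho / s i by rewrite divr_gt0.
have rs'0 i : 0 < rho / s' i by rewrite divr_gt0.
have pr0 : 0 <= \prod_i Num.min 1 (rho / s' i) by apply: prodr_ge0 => i _; apply: mn0.
have pr1 : \prod_i Num.min 1 (rho / s' i) <= 1.
  by apply: prodr_ile1 => i _; rewrite mn0 // mn1.
have Y0 : 0 <= Y := le_trans X0 XY.
have down (Z : R) : 0 <= Z -> Num.max 1 (Z / (C * T)) <= Num.max 1 (Z / T).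
  move=> Z0; rewrite ge_max !le_max lexx /=; apply/orP; right.
  by rewrite ler_wpM2l // lef_pV2 ?posrE // ler_peMl // ltW.
have [YCT|CTY] := ltP Y (C * T).
  have -> : \prod_i Num.min 1 (rho / s i) = 1.
    apply: big1 => i _; apply/min_idPl; rewrite ler_pdivlMr // mul1r; exact: YC.
  rewrite mul1r; apply: le_trans (_ : 1 * (1 * Num.max 1 (X / (C * T)) * (Num.max 1 (Y / (C * T))) `^ eta) <= _).
    by apply: ler_pM => //; rewrite ?mulr_ge0 ?powR_ge0 //; apply: ler_wpM2r; [exact: powR_ge0|apply: ler_wpM2r].
  rewrite !mul1r; apply: ler_pM; rewrite ?powR_ge0 ?down //.
  by apply: ge0_ler_powR; rewrite ?nnegrE ?down // ltW.
have YE : (Num.max 1 (Y / T)) `^ eta = C `^ eta * (Num.max 1 (Y / (C * T))) `^ eta.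
  have -> : Num.max 1 (Y / (C * T)) = Y / (C * T) by apply/max_idPr; rewrite ler_pdivlMr // mul1r.
  have -> : Num.max 1 (Y / T) = Y / T.
    by apply/max_idPr; rewrite ler_pdivlMr // mul1r; apply: le_trans CTY; rewrite ler_peMl // ltW.
  rewrite -powRM ?divr_ge0 ?(ltW C0) ?(ltW CT0) //; congr (_ `^ _); field.
  by rewrite !gt_eqF.
(* The part of [C] that the credit [X] really pays. *)
pose C' : R := if X < C * T then 1 else C.
have XE : C' * Num.max 1 (X / (C * T)) <= Num.max 1 (X / T).
  rewrite /C'; case: ltP => [_|CTX]; first by rewrite mul1r down.
  have -> : Num.max 1 (X / (C * T)) = X / (C * T) by apply/max_idPr; rewrite ler_pdivlMr // mul1r.
  by rewrite le_max; apply/orP; right; rewrite le_eqVlt; apply/orP; left; apply/eqP; field; rewrite !gt_eqF.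
have prE : (\prod_i Num.min 1 ((if i == i0 then C else 1) * Num.max rho (s' i) / s i)) * \prod_i Num.min 1 (rho / s' i)
    <= C' * \prod_i Num.min 1 (rho / s i).
  have mr0 i : 0 < Num.max rho (s' i) by rewrite lt_max rho0.
  have t0 i : 0 <= Num.min 1 ((if i == i0 then C else 1) * Num.max rho (s' i) / s i).
    by apply: mn0; apply: divr_gt0 => //; apply: mulr_gt0 => //; case: ifP.
  rewrite -big_split /= (bigD1 i0) //= [X in _ <= _ * X](bigD1 i0) //= mulrA.
  apply: ler_pM.
  - by rewrite mulr_ge0 // mn0.
  - by apply: prodr_ge0 => i _; rewrite mulr_ge0 // mn0.
  - rewrite eqxx /C'; case: ltP => [/XC sr|_]; last by apply: min_max_le.
    have -> : Num.min 1 (rho / s i0) = 1 by apply/min_idPl; rewrite ler_pdivlMr // mul1r.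
    rewrite mulr1 -[leRHS]mulr1; apply: ler_pM => //; last exact: mn0.
    by have := t0 i0; rewrite eqxx.
  apply: ler_prod => i /negbTE ii; rewrite mulr_ge0 ?t0 ?mn0 //=.
  by rewrite ii; apply: le_trans (min_max_le (lexx 1) rho0 (s'0 i) (s's i)) _; rewrite mul1r.
rewrite YE; set a := \prod_i Num.min 1 (rho / s' i) in pr0 pr1 prE *.
set b := \prod_i _ in prE fB *; set c := \prod_i _ in prE *.
set x' := Num.max 1 (X / (C * T)) in XE *; set x := Num.max 1 (X / T) in XE *.
set y := _ `^ eta; have y0 : 0 <= y by apply: powR_ge0.
have x'0 : 0 <= x' by apply: mx0.
have c0 : 0 <= c by apply: prodr_ge0 => i _; apply: mn0.
apply: le_trans (_ : (B * b) * (a * x' * y) <= _).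
  by apply: ler_wpM2r => //; rewrite !mulr_ge0.
have -> : B * b * (a * x' * y) = B * ((b * a) * x') * y by ring.
have -> : c * x * (C `^ eta * y) = C `^ eta * (c * x) * y by ring.
apply: ler_wpM2r => //.
have bax : b * a * x' <= c * x.
  apply: le_trans (ler_wpM2r x'0 prE) _.
  have -> : C' * c * x' = c * (C' * x') by ring.
  exact: ler_wpM2l.
apply: le_trans (_ : B * (c * x) <= _); first by rewrite ler_pM2l.
by apply: ler_wpM2r => //; rewrite mulr_ge0 // /x mx0.
Qed.

End Potential.

Lemma prod_powR (R : realType) (d : nat) (T : R) (w : 'I_d -> R) : 0 < T ->
  \prod_i (T `^ w i) = T `^ (\sum_i w i).
Proof.
move=> T0; elim/big_rec2: _ => [|i u v _ ->]; first by rewrite powRr0.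
by rewrite powRD // (gt_eqF T0) implybT.
Qed.

Lemma sume_le_exists (R : realType) (G : finType) (X : {set G})
    (Psi : G -> \bar R) (Phi : \bar R) :
    (0 < #|X|)%N -> (forall g, 0 <= Psi g)%E -> (0 <= Phi)%E -> (Phi < +oo)%E ->
    (\sum_(g in X) Psi g <= #|X|%:R%:E * Phi)%E ->
  exists2 g, g \in X & (Psi g <= Phi)%E.
Proof.
move=> X0 Psi0 Phi0 fin tot; apply: contrapT => H; move: (tot); apply/negP; rewrite -ltNge.
have Phifin : Phi \is a fin_num by rewrite ge0_fin_numE.
have Psifin g : g \in X -> Psi g \is a fin_num.
  move=> gX; rewrite ge0_fin_numE //.
  apply: (@le_lt_trans _ _ (#|X|%:R%:E * Phi)%E); last first.
    by rewrite -(fineK Phifin) -EFinM ltry.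
  apply: le_trans tot; rewrite (bigD1 g) //= leeDl //.
  by apply: sume_ge0.
have E1 : (\sum_(g in X) Psi g = \sum_(g in X) (fine (Psi g))%:E)%E.
  by apply: eq_bigr => g gX; rewrite fineK // Psifin.
have E2 : (#|X|%:R%:E * Phi = (\sum_(g in X) fine Phi)%:E)%E.
  by rewrite sumr_const -[in LHS](fineK Phifin) -EFinM mulr_natl.
rewrite E1 E2 sumEFin lte_fin; apply: ltr_sum.
  by have [g gX] := card_gt0P X0; apply/hasP; exists g; rewrite ?mem_index_enum.
move=> g gX; rewrite -lte_fin !fineK ?Psifin // ltNge; apply/negP => le.
by apply: H; exists g.
Qed.

Lemma nested_limit (R : realType) (x e : nat -> R) :
    (forall j, `|x j.+1 - x j| <= e j / 2) -> (forall j, e j.+1 <= e j / 2) ->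
  exists z, forall j, `|z - x j| <= e j.
Proof.
move=> xx ee; have e0 j : 0 <= e j.
  by have := le_trans (normr_ge0 _) (xx j); lra.
have lo j n : x j - e j <= x (j + n)%N - e (j + n)%N.
  elim: n => [|n IH]; rewrite ?addn0 // addnS; apply: le_trans IH _.
  by have := xx (j + n)%N; have := ee (j + n)%N; rewrite ler_norml => ? /andP[? ?]; lra.
have hi j n : x (j + n)%N + e (j + n)%N <= x j + e j.
  elim: n => [|n IH]; rewrite ?addn0 // addnS; apply: le_trans _ IH.
  by have := xx (j + n)%N; have := ee (j + n)%N; rewrite ler_norml => ? /andP[? ?]; lra.
pose S := [set x j - e j | j in setT]%classic.
have lohi j n : x n - e n <= x j + e j.
  have := lo n j; have := hi j n; rewrite [(n + j)%N]addnC.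
  by have := e0 (j + n)%N; lra.
have Sub j : ubound S (x j + e j) by move=> _ [n _ <-].
have S0 : (S !=set0)%classic by exists (x 0%N - e 0%N), 0%N.
exists (sup S) => j; rewrite ler_norml; apply/andP; split.
  have : x j - e j <= sup S by apply: ub_le_sup; [exists (x 0%N + e 0%N)|exists j].
  lra.
have : sup S <= x j + e j by apply: ge_sup.
lra.
Qed.

(** * The tree of nodes and the descent to a singular point *)

Section Levels.
Variables (R : realType) (d : nat) (i0 i2 : 'I_d).
Hypothesis i20 : i2 != i0.
Variable w : 'I_d -> R.
Hypothesis w_gt0 : forall i, 0 < w i.
Hypothesis w_sum1 : \sum_i w i = 1.
Variable r : nat.
Hypothesis rw : forall i, 1 <= r%:R * w i.
Variables (a p q k2 k j0 y mu m b c : nat).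
Hypothesis pE : p = (cov_exp d + 2)%N.
Hypothesis k2E : k2 = (cov_exp d + 2 * p + q + 1)%N.
Hypothesis kE : k = (k2 + 2 * p + 1)%N.
Hypothesis jE : j0 = (p + k * d + 1)%N.
Hypothesis yE : y = (j0 + k * d + 1)%N.
Hypothesis bE : b = (2 * p + 1)%N.
Hypothesis muE : mu = (3 * p + q + k * d.+1 + y + b + 2)%N.
Hypothesis cE : c = ((2 * b + 2 * p + 2) * d + p + q + k2 * d.+1 + 2)%N.
Hypothesis md : (d < m)%N.
Hypothesis mmu : (mu * r <= m)%N.
Hypothesis a_consts : forall u : R, u \in consts R d p m -> u < a%:R.

(** The exponent [j.+1] makes the base exceed the constants already at level 0; since
    [A_ j.+1 <= A_ j ^+ 2], bounds at the next level remain powers of [A_ j]. *)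
Definition A_ (j : nat) : R := (a ^ j.+1)%:R.
Fixpoint T_ (j : nat) : R := if j is i.+1 then A_ i ^+ m * T_ i else 1.
Definition hh j i : R := T_ j `^ w i.
Definition sc j i : R := (T_ j * hh j i)^-1.
(* A node of the tree: a point and an integer form vanishing at it. *)
Definition state := (('I_d -> R) * form d)%type.
Definition lnode j (st : state) := node i0 st.1 st.2 (hh j) (A_ j ^+ p) (A_ j ^+ k).
(** The enlargement by [A_ j ^+ b] makes the boxes nested: half of it holds the displacement of a
    child's center and half the child's own box. *)
Definition bx j (st : state) : set 'rV[R]_d :=
  [set z | forall i, `|z 0 i - st.1 i| <= A_ j ^+ b * sc j i]%classic.

Let a147 : 147 < a%:R :> R. Proof. by apply: a_consts; rewrite !inE eqxx ?orbT. Qed.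
Let a1 : 1 <= a%:R :> R. Proof. by apply: le_trans (ltW a147); rewrite ler1n. Qed.
Let a_gt0 : (0 < a)%N. Proof. by rewrite -(ler_nat R). Qed.

Lemma A_ge1 j : 1 <= A_ j. Proof. by rewrite /A_ natrX exprn_ege1. Qed.
Lemma A_gt0 j : 0 < A_ j. Proof. exact: lt_le_trans (A_ge1 j). Qed.
Lemma A_incr j : A_ j <= A_ j.+1.
Proof. by rewrite /A_ ler_nat leq_pexp2l. Qed.
Lemma A_sq j : A_ j.+1 <= A_ j ^+ 2.
Proof. by rewrite /A_ !natrX -exprM ler_weXn2l //; clear; lia. Qed.
Lemma A_consts j : forall u, u \in consts R d p m -> u < A_ j.
Proof.
move=> u /a_consts /lt_le_trans; apply.
by rewrite /A_ natrX exprS ler_peMr ?exprn_ege1 // (le_trans _ a1).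
Qed.

Lemma T_ge1 j : 1 <= T_ j.
Proof. by elim: j => //= j IH; rewrite mulr_ege1 // exprn_ege1 // A_ge1. Qed.
Lemma T_gt0 j : 0 < T_ j. Proof. exact: lt_le_trans (T_ge1 j). Qed.
Lemma hh_ge1 j i : 1 <= hh j i.
Proof.
rewrite /hh -(powRr0 (T_ j)); apply: ler_powR; first exact: T_ge1.
exact: ltW.
Qed.
Lemma hh_gt0 j i : 0 < hh j i. Proof. exact: lt_le_trans (hh_ge1 j i). Qed.
Lemma prod_hh j : \prod_i hh j i = T_ j.
Proof. by rewrite prod_powR ?T_gt0 // w_sum1 powRr1 // ltW // T_gt0. Qed.
Lemma sc_gt0 j i : 0 < sc j i.
Proof. by rewrite invr_gt0 mulr_gt0 ?T_gt0 ?hh_gt0. Qed.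

Let lam j i : R := (A_ j ^+ m) `^ w i.
Lemma hhS j i : hh j.+1 i = lam j i * hh j i.
Proof. by rewrite /hh /lam -powRM // ?exprn_ge0 // ltW // ?A_gt0 ?T_gt0. Qed.
Lemma prod_lam j : \prod_i lam j i = A_ j ^+ m.
Proof.
have Am : 0 < A_ j ^+ m by rewrite exprn_gt0 // A_gt0.
by rewrite prod_powR // w_sum1 powRr1 // ltW.
Qed.
Lemma lam_mu j i : A_ j ^+ mu <= lam j i.
Proof.
rewrite /lam -!powR_mulrn ?(ltW (A_gt0 j)) // -powRrM.
apply: ler_powR; first exact: A_ge1.
apply: le_trans (_ : mu%:R * (r%:R * w i) <= _); first by rewrite ler_peMr.
by rewrite mulrA -natrM ler_pM2r // ler_nat.
Qed.

Lemma lnode_le j st : node i0 st.1 st.2 (hh j.+1) (A_ j ^+ p) (A_ j ^+ k) ->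
  lnode j.+1 st.
Proof.
have AA n : A_ j ^+ n <= A_ j.+1 ^+ n.
  by apply: lerXn2r; rewrite ?nnegrE ?(ltW (A_gt0 _)) ?A_incr.
move=> [n1 n2 n3 n4 n5 n6]; split=> //.
- by apply: le_trans n2 _; rewrite ler_pM2r // ltr0z.
- by move=> i; apply: le_trans (n3 i) _; rewrite ler_pM2r // hh_gt0.
move=> u v; have [W [Wa Wx]] := n6 u v; exists W; split=> [i|].
  by apply: le_trans (Wa i) _; rewrite ler_pM2r // hh_gt0.
by apply: le_trans Wx _; rewrite prod_hh ler_pM2r ?invr_gt0 ?T_gt0.
Qed.

Lemma children j st : lnode j st -> exists (G : finType) (X : {set G}) (ch : G -> state),
  [/\ (0 < #|X|)%N, forall g, g \in X -> lnode j.+1 (ch g),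
  forall g, g \in X -> `|ev st.2 (ch g).1| <= 2 / A_ j ^+ q / T_ j.+1,
  forall g i, g \in X -> `|(ch g).1 i - st.1 i| <= A_ j ^+ b / 2 * sc j i &
  forall (rho : R) (Y : {set G}), 0 <= rho -> Y \subset X ->
    (forall g g' i, g \in Y -> g' \in Y ->
       `|(ch g).1 i - (ch g').1 i| <= A_ j ^+ (2 * b + 1) * Num.max rho (sc j.+1 i)) ->
    #|Y|%:R <= #|X|%:R * (A_ j ^+ c *
      \prod_i Num.min 1 ((if i == i0 then A_ j ^+ m else 1) * Num.max rho (sc j.+1 i) / sc j i))].
Proof.
move=> nst.
have [G [X [cen [F]]]] := one_step i20 pE k2E kE jE yE bE muE cE md (@A_consts j) (hh_ge1 j) nst (lam_mu j) (prod_lam j).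
have hhE : (fun i => lam j i * hh j i) = hh j.+1 by apply/funext => i; rewrite hhS.
rewrite hhE prod_lam prod_hh => -[X0 Xn Xe Xc XY].
exists G, X, (fun g => (cen g, F g)); split=> //= [g gX|rho Y rho0 YX Yc].
  by apply: lnode_le; apply: Xn.
have scS i : (A_ j ^+ m * T_ j * (lam j i * hh j i))^-1 = sc j.+1 i by rewrite /sc hhS.
have := XY rho Y rho0 YX; rewrite (eq_bigr (fun i => Num.min 1 ((if i == i0 then A_ j ^+ m else 1) * Num.max rho (sc j.+1 i) / sc j i))).
  by apply=> g g' i gY g'Y; rewrite scS; apply: Yc.
by move=> i _; rewrite scS.
Qed.

Lemma sc_nest j i : A_ j.+1 ^+ b * sc j.+1 i <= A_ j ^+ b / 2 * sc j i.
Proof.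
have Ab : A_ j.+1 ^+ b <= A_ j ^+ (b + b).
  by rewrite addnn -mul2n exprM; apply: lerXn2r; rewrite ?nnegrE ?exprn_ge0 ?(ltW (A_gt0 _)) ?A_sq.
have -> : sc j.+1 i = sc j i / (A_ j ^+ m * lam j i).
  rewrite /sc hhS /=; have := T_gt0 j; have := hh_gt0 j i; have := A_gt0 j.
  have : 0 < lam j i by apply: lt_le_trans (lam_mu j i); rewrite exprn_gt0 // A_gt0.
  by move=> ? ? ? ?; field; rewrite !gt_eqF // exprn_gt0.
have l1 : A_ j ^+ b.+1 <= A_ j ^+ m * lam j i.
  apply: le_trans (_ : lam j i <= _).
    by apply: le_trans (lam_mu j i); rewrite ler_weXn2l ?A_ge1 //; clear -muE; lia.
  by rewrite ler_peMl ?powR_ge0 // exprn_ege1 // A_ge1.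
have Al : 0 < A_ j ^+ m * lam j i by apply: lt_le_trans l1; rewrite exprn_gt0 // A_gt0.
rewrite mulrA ler_pdivrMr // mulrAC; apply: le_trans (ler_wpM2r (ltW (sc_gt0 j i)) Ab) _.
rewrite ler_pM2r ?sc_gt0 // exprD -[leRHS]mulrA ler_pM2l ?exprn_gt0 ?A_gt0 //.
rewrite mulrC ler_pdivlMr //; apply: le_trans l1; rewrite exprSr.
rewrite ler_pM2l ?exprn_gt0 ?A_gt0 //.
have : 147 < A_ j by apply: A_consts; rewrite !inE eqxx ?orbT.
by move=> ?; lra.
Qed.

Variables (del kap : R).
Hypothesis del0 : 0 < del.
Hypothesis kap1 : 1 <= kap.
Hypothesis kapC : forall j, A_ j ^+ m <= kap * T_ j `^ del.
Let al : R := 1 / (1 + w i0).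
(** Chosen so that [A_ j ^+ c] is the power [eta] of [A_ j ^+ m]. *)
Let eta : R := c%:R / m%:R.
Let kap0 : 0 < kap. Proof. exact: lt_le_trans kap1. Qed.
Let al0 : 0 < al. Proof. by rewrite divr_gt0 // addr_gt0. Qed.
Let al1 : al <= 1.
Proof. by rewrite ler_pdivrMr ?addr_gt0 // mul1r lerDl ltW. Qed.
Let eta0 : 0 < eta.
Proof.
apply: divr_gt0; rewrite ltr0n; last by apply: leq_ltn_trans md.
by rewrite cE addn2.
Qed.

(* A set of diameter [rho] met by a node of level [j] is charged [pot j rho];
   the first factor is the share of the box of the node that it can fill, and
   the others are credit for the losses of the later levels. *)
Definition pot j (rho : R) : R :=
  \prod_i Num.min 1 (rho / sc j i) *
  Num.max 1 (kap * rho `^ (- ((1 + del) * al)) / T_ j) *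
  (Num.max 1 (kap * rho `^ (- (1 + del)) / T_ j)) `^ eta.

Lemma pot_ge0 j rho : 0 < rho -> 0 <= pot j rho.
Proof.
move=> rho0; rewrite /pot !mulr_ge0 ?powR_ge0 ?le_max ?ler01 //.
by apply: prodr_ge0 => i _; rewrite le_min ler01 divr_ge0 // ltW // sc_gt0.
Qed.

Let powR_inv_le (u v e rho : R) : 0 < e -> 0 < rho -> rho <= u `^ (- v) ->
  u `^ (v * e) <= rho `^ (- e).
Proof.
move=> e0 rho0 ruv; rewrite powRN -[leLHS]invrK -powRN.
have r0 : 0 < rho `^ e by rewrite powR_gt0.
have le : rho `^ e <= u `^ (- (v * e)).
  rewrite -mulNr powRrM; apply: ge0_ler_powR; rewrite ?nnegrE ?powR_ge0 //; exact: ltW.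
by rewrite lef_pV2 ?posrE // (lt_le_trans r0).
Qed.

Let CkT j : A_ j ^+ m * T_ j <= kap * T_ j `^ (1 + del).
Proof.
rewrite powRD; last by rewrite (gt_eqF (T_gt0 j)) implybT.
by rewrite powRr1 ?(ltW (T_gt0 j)) // mulrCA [leRHS]mulrC ler_pM2r ?T_gt0 // kapC.
Qed.

Lemma pot_step j (rho f : R) : 0 < rho -> rho <= 1 -> 0 <= f -> f <= 1 ->
  f <= A_ j ^+ c * \prod_i Num.min 1
     ((if i == i0 then A_ j ^+ m else 1) * Num.max rho (sc j.+1 i) / sc j i) ->
  f * pot j.+1 rho <= pot j rho.
Proof.
move=> rho0 rho1 f0 f1 fB; rewrite /pot /=.
have Aj0 := A_gt0 j; have dl0 : 0 < 1 + del by rewrite addr_gt0.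
have Am1 : 1 <= A_ j ^+ m by rewrite exprn_ege1 // A_ge1.
apply: potential_le f0 f1 fB => //.
- exact: sc_gt0.
- move=> i; rewrite lef_pV2 ?posrE ?mulr_gt0 ?T_gt0 ?hh_gt0 ?exprn_gt0 //.
  apply: ler_pM; rewrite ?(ltW (T_gt0 _)) ?(ltW (hh_gt0 _ _)) //=.
    by rewrite ler_peMl // ltW // T_gt0.
  rewrite hhS ler_peMl ?(ltW (hh_gt0 _ _)) //; apply: le_trans (lam_mu j i).
  by rewrite exprn_ege1 // A_ge1.
- exact: T_ge1.
- by rewrite exprn_gt0.
- rewrite -(powR_mulrn m (ltW Aj0)) -powRrM /eta mulrC divfK; last first.
    by rewrite pnatr_eq0 -lt0n; apply: leq_ltn_trans md.
  by rewrite powR_mulrn // ltW.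
- by rewrite mulr_ge0 ?powR_ge0 // ltW.
- rewrite ler_pM2l //; apply: ger_powR; first by rewrite rho0.
  by rewrite lerN2 ler_piMr // ltW.
- move=> XT; rewrite leNgt; apply/negP => rs; move: XT; apply/negP; rewrite -leNgt.
  apply: le_trans (CkT j) _; rewrite ler_pM2l //.
  have -> : T_ j `^ (1 + del) = T_ j `^ ((1 + w i0) * ((1 + del) * al)).
    by congr (_ `^ _); rewrite /al; field; rewrite gt_eqF // addr_gt0.
  apply: powR_inv_le => //; first by rewrite mulr_gt0.
  apply: le_trans (ltW rs) _; rewrite /sc /hh powRN powRD; last by rewrite (gt_eqF (T_gt0 j)) implybT.
  by rewrite powRr1 // ltW // T_gt0.
move=> YT i; rewrite leNgt; apply/negP => rs; move: YT; apply/negP; rewrite -leNgt.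
apply: le_trans (CkT j) _; rewrite ler_pM2l // -[X in _ `^ X]mul1r.
apply: powR_inv_le => //; apply: le_trans (ltW rs) _.
rewrite powR_inv1 ?(ltW (T_gt0 j)) // lef_pV2 ?posrE ?mulr_gt0 ?T_gt0 ?hh_gt0 //.
by rewrite ler_peMr ?(ltW (T_gt0 j)) // hh_ge1.
Qed.

Definition meets (U : set 'rV[R]_d) j (st : state) := `[< exists2 z, U z & bx j st z >].
Definition wt (U : set 'rV[R]_d) (rho : R) j st : R := if meets U j st then pot j rho else 0.

Lemma wt_ge0 U rho j st : 0 < rho -> 0 <= wt U rho j st.
Proof. by move=> ?; rewrite /wt; case: ifP => // _; apply: pot_ge0. Qed.

Lemma bx_nest j (st st' : state) :
  (forall i, `|st'.1 i - st.1 i| <= A_ j ^+ b / 2 * sc j i) ->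
  (bx j.+1 st' `<=` bx j st)%classic.
Proof.
move=> ss z zb i; have -> : z 0 i - st.1 i = (z 0 i - st'.1 i) + (st'.1 i - st.1 i) by ring.
apply: le_trans (ler_normD _ _) _; apply: le_trans (lerD (zb i) (ss i)) _.
by have := sc_nest j i; lra.
Qed.

Lemma wt_step j st (G : finType) (X : {set G}) (ch : G -> state) U rho :
    0 < rho -> rho <= 1 ->
    (forall u v : 'rV[R]_d, U u -> U v -> forall i, `|u 0 i - v 0 i| <= rho) ->
    (0 < #|X|)%N ->
    (forall g i, g \in X -> `|(ch g).1 i - st.1 i| <= A_ j ^+ b / 2 * sc j i) ->
    (forall (Y : {set G}), Y \subset X ->
    (forall g g' i, g \in Y -> g' \in Y ->
       `|(ch g).1 i - (ch g').1 i| <= A_ j ^+ (2 * b + 1) * Num.max rho (sc j.+1 i)) ->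
    #|Y|%:R <= #|X|%:R * (A_ j ^+ c *
      \prod_i Num.min 1 ((if i == i0 then A_ j ^+ m else 1) * Num.max rho (sc j.+1 i) / sc j i))) ->
  \sum_(g in X) wt U rho j.+1 (ch g) <= #|X|%:R * wt U rho j st.
Proof.
move=> rho0 rho1 Udiam X0 Xnear XY; set Y := [set g in X | meets U j.+1 (ch g)].
have X0R : 0 < #|X|%:R :> R by rewrite ltr0n.
have -> : \sum_(g in X) wt U rho j.+1 (ch g) = #|Y|%:R * pot j.+1 rho.
  rewrite (bigID (fun g => meets U j.+1 (ch g))) /= [X in _ + X]big1 ?addr0; last first.
    by move=> g /andP[_ /negbTE gm]; rewrite /wt gm.
  rewrite (eq_bigr (fun=> pot j.+1 rho)); last by move=> g /andP[_ gm]; rewrite /wt gm.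
  rewrite sumr_const mulr_natl; congr (_ *+ _); apply: eq_card => g.
  by rewrite !inE.
have [Y0|] := posnP #|Y|; first by rewrite Y0 mul0r mulr_ge0 // wt_ge0.
move=> Y0.
have -> : wt U rho j st = pot j rho.
  have [g] := card_gt0P Y0; rewrite inE => /andP[gX /asboolP[z Uz zb]].
  rewrite /wt (_ : meets U j st) //; apply/asboolP; exists z => //.
  by apply: (bx_nest _ zb) => i; apply: Xnear.
have YX : Y \subset X by apply/fintype.subsetP => g; rewrite inE => /andP[].
have Yc : forall g g' i, g \in Y -> g' \in Y ->
       `|(ch g).1 i - (ch g').1 i| <= A_ j ^+ (2 * b + 1) * Num.max rho (sc j.+1 i).
  move=> g g' i; rewrite !inE => /andP[_ /asboolP[z Uz zb]] /andP[_ /asboolP[z' Uz' zb']].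
  have -> : (ch g).1 i - (ch g').1 i = (z 0 i - z' 0 i) - (z 0 i - (ch g).1 i) + (z' 0 i - (ch g').1 i) by ring.
  apply: le_trans (ler_normD _ _) _; apply: le_trans (lerD (ler_normB _ _) (lexx _)) _.
  apply: le_trans (lerD (lerD (Udiam _ _ Uz Uz' i) (zb i)) (zb' i)) _.
  set mx := Num.max rho _.
  have m1 : rho <= mx by rewrite le_max lexx.
  have m2 : sc j.+1 i <= mx by rewrite le_max lexx orbT.
  have mx0 : 0 < mx := lt_le_trans rho0 m1.
  have Ab : A_ j.+1 ^+ b <= A_ j ^+ (2 * b).
    by rewrite exprM; apply: lerXn2r; rewrite ?nnegrE ?exprn_ge0 ?(ltW (A_gt0 _)) ?A_sq.
  have m3 : A_ j.+1 ^+ b * sc j.+1 i <= A_ j ^+ (2 * b) * mx.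
    by apply: ler_pM; rewrite ?exprn_ge0 ?(ltW (sc_gt0 _ _)) ?(ltW (A_gt0 _)).
  have m4 : mx <= A_ j ^+ (2 * b) * mx by rewrite ler_peMl ?(ltW mx0) // exprn_ege1 // A_ge1.
  have m5 : 3 * (A_ j ^+ (2 * b) * mx) <= A_ j ^+ (2 * b + 1) * mx.
    rewrite addn1 exprS mulrA ler_pM2r // ler_pM2r ?exprn_gt0 ?A_gt0 //.
    have : 147 < A_ j by apply: A_consts; rewrite !inE eqxx ?orbT.
    by move=> ?; lra.
  lra.
have := pot_step rho0 rho1 (_ : 0 <= #|Y|%:R / #|X|%:R).
rewrite divr_ge0 // => /(_ j isT) ps.
have : #|Y|%:R / #|X|%:R * pot j.+1 rho <= pot j rho.
  apply: ps; first by rewrite ler_pdivrMr // mul1r ler_nat subset_leq_card.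
  by rewrite ler_pdivrMr // mulrC; apply: XY.
by rewrite mulrAC ler_pdivrMr // [pot j rho * _]mulrC.
Qed.

Lemma exists_child j st (U : nat -> set 'rV[R]_d) (rho : nat -> R) :
    (forall n, 0 < rho n <= 1) ->
    (forall n (u v : 'rV[R]_d), U n u -> U n v -> forall i, `|u 0 i - v 0 i| <= rho n) ->
    lnode j st -> (\sum_(0 <= n <oo) (wt (U n) (rho n) j st)%:E < +oo)%E ->
  exists st', [/\ lnode j.+1 st', `|ev st.2 st'.1| <= 2 / A_ j ^+ q / T_ j.+1,
    forall i, `|st'.1 i - st.1 i| <= A_ j ^+ b / 2 * sc j i &
    (\sum_(0 <= n <oo) (wt (U n) (rho n) j.+1 st')%:E <=
     \sum_(0 <= n <oo) (wt (U n) (rho n) j st)%:E)%E].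
Proof.
move=> rho01 Udiam nst fin.
have [G [X [ch [X0 Xn Xe Xc XY]]]] := children nst.
have rho0 n : 0 < rho n by case/andP: (rho01 n).
have rho1 n : rho n <= 1 by case/andP: (rho01 n).
set Phi := (\sum_(0 <= n <oo) _)%E in fin *.
have Phi0 : (0 <= Phi)%E by apply: nneseries_ge0 => n _ _; rewrite lee_fin wt_ge0.
pose Psi g := (\sum_(0 <= n <oo) (wt (U n) (rho n) j.+1 (ch g))%:E)%E.
have tot : (\sum_(g in X) Psi g <= #|X|%:R%:E * Phi)%E.
  rewrite /Psi -nneseries_sum; last by move=> g n _; rewrite lee_fin wt_ge0.
  rewrite /Phi -nneseriesZl; last by move=> n _; rewrite lee_fin wt_ge0.
  apply: lee_nneseries => [n _ _|n _].
    by apply: sume_ge0 => g _; rewrite lee_fin wt_ge0.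
  rewrite sumEFin -EFinM lee_fin; apply: wt_step => //; first exact: Udiam.
  by move=> Y; apply: XY; apply: ltW.
have Psi0 g : (0 <= Psi g)%E by apply: nneseries_ge0 => n _ _; rewrite lee_fin wt_ge0.
have [g gX gPhi] := sume_le_exists X0 Psi0 Phi0 fin tot.
exists (ch g); split=> //; [exact: Xn|exact: Xe|by move=> i; apply: Xc].
Qed.

Hypothesis qE : q = (2 * p * r + 1)%N.

(** The coordinate form at [i0], at the origin. All sides are 1 at level 0, so rounding the target
    gives the covering radius. *)
Definition root : state := (fun=> 0, ([ffun i => ((i == i0) : nat)%:Z], 0)).

Lemma lnode_root : lnode 0 root.
Proof.
have hh0 i : hh 0 i = 1 by rewrite /hh powR1.
have Ap n : 1 <= A_ 0 ^+ n by rewrite exprn_ege1 // A_ge1.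
split=> /=; rewrite ?ffunE ?eqxx ?hh0 ?mulr1 //.
- by move=> i; rewrite ffunE hh0 mulr1; case: eqP => _; rewrite ?normr1 ?normr0 // (le_trans ler01).
- by rewrite /ev /= addr0; apply: big1 => i _; rewrite mulr0.
- move=> W t Wt _; have := Wt i0; rewrite /= ffunE eqxx mulr1 => <-.
  have [->|W0] := eqVneq (W.1 i0) 0; [by left|right].
  by rewrite -intr_norm -[1]/(1%:~R) ler_int -gtz0_ge1 normr_gt0.
move=> u v; exists ([ffun i => Num.floor (u i)], Num.floor v); split=> [i|].
  rewrite /= ffunE hh0 mulr1; apply: le_trans (Ap k).
  by have [? ?] := floor_bounds (u i); rewrite ler_norml; apply/andP; split; lra.
rewrite prod_hh /= divr1 /ev big1 /= ?add0r; last by move=> i _; rewrite mulr0.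
apply: le_trans (Ap k).
by have [? ?] := floor_bounds v; rewrite ler_norml; apply/andP; split; lra.
Qed.

Lemma T_ge_nat j : j%:R <= T_ j.
Proof.
elim: j => [|j IH]; first exact: ler01.
rewrite -natr1 /=; apply: le_trans (_ : 2 * T_ j <= _).
  by have := T_ge1 j; lra.
rewrite ler_pM2r ?T_gt0 //; apply: le_trans (_ : A_ j ^+ 1 <= _).
  have : 147 < A_ j by apply: A_consts; rewrite !inE eqxx ?orbT.
  by move=> ?; lra.
by rewrite ler_weXn2l ?A_ge1 //; apply: leq_ltn_trans md.
Qed.

Lemma A_ge_nat j : j%:R <= A_ j.
Proof.
rewrite /A_ ler_nat; apply: leq_trans (leqnSn _) _.
apply: ltnW; apply: ltn_expl; rewrite -(ltr_nat R).
by apply: lt_trans a147; rewrite ltr1n.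
Qed.

Lemma pot_eq1 rho : 0 < rho -> exists j, pot j rho = 1.
Proof.
move=> rho0.
pose B := rho^-1 + kap * rho `^ (- ((1 + del) * al)) + kap * rho `^ (- (1 + del)).
have [r0 x0 y0] : [/\ 0 <= rho^-1, 0 <= kap * rho `^ (- ((1 + del) * al)) & 0 <= kap * rho `^ (- (1 + del))].
  by rewrite invr_ge0 !mulr_ge0 ?powR_ge0 ?(ltW rho0) ?(ltW kap0).
exists (Num.truncn B).+1; set j := _.+1.
have BT : B <= T_ j.
  apply: le_trans (T_ge_nat j); rewrite /j -natr1.
  have B0 : 0 <= B by rewrite /B !addr_ge0.
  by have [_ /ltW] := truncn_bounds B0.
clearbody j.
have mx (Z : R) : Z <= B -> Num.max 1 (Z / T_ j) = 1.
  by move=> ZB; apply/max_idPl; rewrite ler_pdivrMr ?T_gt0 // mul1r (le_trans ZB).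
rewrite /pot !mx ?powR1 ?mulr1; [|rewrite /B; lra|rewrite /B; lra].
apply: big1 => i _; apply/min_idPl; rewrite ler_pdivlMr ?sc_gt0 // mul1r.
rewrite -[leRHS]invrK lef_pV2 ?posrE ?invr_gt0 ?mulr_gt0 ?T_gt0 ?hh_gt0 //.
apply: le_trans (_ : T_ j <= _); first by apply: le_trans BT; rewrite /B; lra.
by rewrite ler_peMr ?hh_ge1 // ltW // T_gt0.
Qed.

Lemma ev_limit j (st st' : state) (z : 'rV[R]_d) : lnode j st ->
    `|ev st.2 st'.1| <= 2 / A_ j ^+ q / T_ j.+1 -> bx j.+1 st' z ->
  `|ev st.2 (fun i => z 0 i)| <= 3 / A_ j ^+ q / T_ j.+1.
Proof.
move=> [_ _ Vle _ _ _] Vx zb; rewrite (ev_move _ st'.1).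
have [T' T'E] : exists u, u = T_ j.+1 by exists (T_ j.+1).
have T'0 : 0 < T' by rewrite T'E T_gt0.
rewrite -!T'E in Vx *.
have Aq0 : 0 < A_ j ^+ q by rewrite exprn_gt0 // A_gt0.
apply: le_trans (ler_normD _ _) _.
have -> : 3 / A_ j ^+ q / T' = 2 / A_ j ^+ q / T' + d%:R * ((d%:R)^-1 / A_ j ^+ q / T').
  have d0 : d%:R != 0 :> R by rewrite pnatr_eq0; case: (d) (i0) => // -[].
  by field; rewrite d0 !gt_eqF // A_gt0.
apply: lerD => //; apply: le_trans (ler_norm_sum _ _ _) _.
rewrite -[X in _ <= X * _](_ : #|'I_d|%:R = _); last by rewrite card_ord.
rewrite mulr_natl -sumr_const; apply: ler_sum => i _; rewrite normrM.
apply: le_trans (ler_pM _ _ (Vle i) (zb i)) _ => //.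
have lam0 : 0 < lam j i by apply: lt_le_trans (lam_mu j i); rewrite exprn_gt0 // A_gt0.
have dA : d%:R * A_ j ^+ (p + 2 * b + q) <= lam j i.
  apply: le_trans (_ : A_ j ^+ (p + 2 * b + q).+1 <= _).
    rewrite exprS ler_pM2r ?exprn_gt0 ?A_gt0 //.
    have : 2 * (d%:R + 2) < A_ j by apply: A_consts; rewrite !inE eqxx ?orbT.
    by have := ler0n R d; lra.
  by apply: le_trans (lam_mu j i); rewrite ler_weXn2l ?A_ge1 //; clear -muE bE; lia.
have Ab : A_ j.+1 ^+ b <= A_ j ^+ (2 * b).
  by rewrite exprM; apply: lerXn2r; rewrite ?nnegrE ?exprn_ge0 ?(ltW (A_gt0 _)) ?A_sq.
rewrite /sc hhS -T'E; have hj := hh_gt0 j i.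
have d0 : 0 < d%:R :> R by rewrite ltr0n; case: (d) (i0) => // -[].
have -> : A_ j ^+ p * hh j i * (A_ j.+1 ^+ b * (T' * (lam j i * hh j i))^-1) =
   A_ j ^+ p * A_ j.+1 ^+ b / lam j i / T'.
  by field; rewrite !gt_eqF.
rewrite ler_pM2r ?invr_gt0 // ler_pdivrMr // mulrAC ler_pdivlMr // ler_pdivlMl //.
apply: le_trans dA; rewrite ler_pM2l // (exprD _ (p + 2 * b) q) (exprD _ p (2 * b)).
by rewrite ler_pM2r // ler_pM2l // exprn_gt0 // A_gt0.
Qed.

(** The form of level [j] serves the bounds [tau] from [T_ j * B j] to [T_ j.+1 * B j.+1]: its
    coefficients limit the lower end and its value at [z] the upper end. Since [q = 2 * p * r + 1],
    one factor [A_ j] is left at the upper end, and it beats every constant once [j] is large. *)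
Lemma singular_limit (st : nat -> state) (z : 'rV[R]_d) :
    (forall j, lnode j (st j)) ->
    (forall j, `|ev (st j).2 (st j.+1).1| <= 2 / A_ j ^+ q / T_ j.+1) ->
    (forall j, bx j (st j) z) ->
  singular w z.
Proof.
move=> nst est bst eps eps0.
have d1 : 1 <= d%:R :> R by rewrite ler1n; case: (d) (i0) => // -[].
have d0 : 0 < d%:R :> R := lt_le_trans ltr01 d1.
(* [d ^+ r] offsets the factor [d] of [dual_to_primal] raised to the power [1 / w i], which is at
   most [r]. *)
pose e' := Num.min 1 (eps / (4 * d%:R ^+ r)).
have e'0 : 0 < e' by rewrite lt_min ltr01 divr_gt0 // mulr_gt0 // exprn_gt0.
have e'1 : e' <= 1 by rewrite ge_min lexx.
have e'eps : 4 * d%:R ^+ r * e' <= eps.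
  by rewrite mulrC -ler_pdivlMr ?mulr_gt0 ?exprn_gt0 // ge_min lexx orbT.
clearbody e'.
have p20 : 0 < 2 ^+ d :> R by rewrite exprn_gt0.
pose K := 2 ^+ d / e'.
have K1 : 1 <= K by rewrite ler_pdivlMr // mul1r (le_trans e'1) // exprn_ege1 // ler1n.
have K0 : 0 < K := lt_le_trans ltr01 K1.
have KE : K * e' = 2 ^+ d by rewrite divfK // gt_eqF.
clearbody K.
have AK1 j : 1 <= A_ j ^+ p * K by rewrite mulr_ege1 // exprn_ege1 // A_ge1.
(* The power [r] ensures that [B j] raised to any [w i] is still at least [A_ j ^+ p * K], because
   [r * w i >= 1]. *)
pose B j := (A_ j ^+ p * K) ^+ r.
have B1 j : 1 <= B j by rewrite exprn_ege1.
have B0 j : 0 < B j := lt_le_trans ltr01 (B1 j).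
pose L := 3 * 2 ^+ d * K ^+ r / e'.
have L0 : 0 <= L by rewrite divr_ge0 ?(ltW e'0) // !mulr_ge0 ?exprn_ge0 // ltW.
pose J := (Num.truncn L).+1.
have AJ j : (J <= j)%N -> 3 * 2 ^+ d * K ^+ r <= e' * A_ j.
  move=> Jj; rewrite [e' * _]mulrC -ler_pdivrMr //; apply: le_trans (A_ge_nat j).
  apply: le_trans (_ : J%:R <= _); last by rewrite ler_nat.
  by rewrite /J -[leRHS]natr1; have [_ /ltW] := truncn_bounds L0.
clearbody J.
have TB1 : 1 <= T_ J * B J by rewrite mulr_ege1 // T_ge1.
exists (2 * (T_ J * B J)); split; first by lra.
(* Halving makes [q <= tau] a strict inequality [q < N]. *)
move=> N TN; pose tau := N / 2.
have tauJ : T_ J * B J <= tau by rewrite /tau; lra.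
have tau1 : 1 <= tau := le_trans TB1 tauJ.
have tau0 : 0 < tau := lt_le_trans ltr01 tau1.
have NE : N = 2 * tau by rewrite /tau; field.
clearbody tau; subst N.
have [j [Jj jtau tauj]] : exists j, [/\ (J <= j)%N, T_ j * B j <= tau & tau < T_ j.+1 * B j.+1].
  have exn : exists n, (J <= n)%N && (tau < T_ n * B n).
    exists (J + (Num.truncn tau).+1)%N; rewrite leq_addr /=.
    have [_ t2] := truncn_bounds (ltW tau0); apply: lt_le_trans t2 _.
    rewrite natr1; apply: le_trans (_ : T_ (J + (Num.truncn tau).+1) <= _).
      by apply: le_trans (T_ge_nat _); rewrite ler_nat leq_addl.
    by rewrite ler_peMr // ltW // T_gt0.
  case: (ex_minnP exn) => -[|n] /andP[Jn tn] minn.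
    by move: tn; rewrite ltNge; move: Jn; rewrite leqn0 => /eqP <-; rewrite tauJ.
  have [Jn'|Jn'] := leqP J n; last first.
    have JE : J = n.+1 by apply/eqP; rewrite eqn_leq Jn Jn'.
    by rewrite JE in tauJ; move: tn; rewrite ltNge tauJ.
  exists n; split=> //; rewrite leNgt; apply/negP => tn'.
  by have := minn n; rewrite Jn' tn' ltnn => /(_ isT).
have [T' T'E] : exists u, u = T_ j.+1 by exists (T_ j.+1).
have T'0 : 0 < T' by rewrite T'E T_gt0.
have evz : `|ev (st j).2 (fun i => z 0 i)| <= 3 / A_ j ^+ q / T'.
  by rewrite T'E; apply: ev_limit (nst j) (est j) (bst j.+1).
rewrite -T'E in tauj.
pose t i := (e' / tau) `^ w i.
have et0 : 0 < e' / tau by rewrite divr_gt0.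
have et1 : e' / tau <= 1 by rewrite ler_pdivrMr // mul1r (le_trans e'1).
have t0 i : 0 < t i by rewrite powR_gt0.
have t1 i : t i <= 1.
  have -> : 1 = 1 `^ w i by rewrite powR1.
  by apply: ge0_ler_powR; rewrite ?nnegrE ?ler01 // ltW.
have tE : \prod_i t i = e' / tau by rewrite prod_powR // w_sum1 powRr1 // ltW.
have [V0 _ Vle _ _ _] := nst j.
have Aq0 : 0 < A_ j ^+ q by rewrite exprn_gt0 // A_gt0.
have [pp [qq [q0 qtau close]]] : exists (p : 'I_d -> int) (q : nat), [/\ (0 < q)%N, q%:R <= tau &
    forall i, `|q%:R * z 0 i - (p i)%:~R| <= d%:R * t i].
  apply: (@dual_to_primal R d (fun i => z 0 i) t (st j).2 tau i0) => [i|||].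
  - by rewrite t0 t1.
  - by rewrite gt_eqF.
  - move=> i; rewrite tE [tau * _]mulrC divfK ?gt_eqF //.
    have c1 : hh j i * t i <= (A_ j ^+ p * K)^-1.
      rewrite /hh /t -powRM ?(ltW (T_gt0 j)) ?(ltW et0) //.
      apply: le_trans (_ : (B j)^-1 `^ w i <= _).
        have TeB : T_ j * (e' / tau) <= (B j)^-1.
          rewrite mulrA ler_pdivrMr // [leRHS]mulrC ler_pdivlMr //.
          apply: le_trans jtau; rewrite mulrAC ler_piMr //.
          by rewrite mulr_ge0 // ltW // T_gt0.
        apply: ge0_ler_powR TeB; rewrite ?nnegrE ?invr_ge0 ?(ltW (w_gt0 i)) ?(ltW (B0 j)) //.
        by rewrite mulr_ge0 ?(ltW (T_gt0 j)) ?(ltW et0).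
      have -> : (B j)^-1 `^ w i = ((A_ j ^+ p * K) `^ (r%:R * w i))^-1.
        rewrite -powR_inv1 ?(ltW (B0 j)) // -powRrM mulN1r powRN; congr (_^-1).
        by rewrite /B -powR_mulrn ?(le_trans ler01) // -powRrM.
      rewrite lef_pV2 ?posrE ?powR_gt0 ?(lt_le_trans ltr01 (AK1 j)) //.
      exact: le1r_powR.
    apply: le_trans (_ : A_ j ^+ p * (A_ j ^+ p * K)^-1 * 2 ^+ d <= _).
      rewrite ler_pM2r //; apply: le_trans (_ : (A_ j ^+ p * hh j i) * t i <= _).
        by rewrite ler_pM2r.
      by rewrite -mulrA ler_pM2l // exprn_gt0 // A_gt0.
    rewrite -KE le_eqVlt; apply/orP; left; apply/eqP; field.
    by rewrite !gt_eqF // ?exprn_gt0 ?A_gt0.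
  rewrite tE ler_pdivlMr //.
  apply: le_trans (_ : 3 / A_ j ^+ q / T' * 2 ^+ d * (T' * B j.+1) <= _).
    apply: ler_pM; rewrite ?mulr_ge0 ?(ltW tau0) ?(ltW tauj) ?(ltW p20) //.
    by rewrite ler_pM2r.
  have -> : 3 / A_ j ^+ q / T' * 2 ^+ d * (T' * B j.+1) = 3 * 2 ^+ d * B j.+1 / A_ j ^+ q.
    by field; rewrite !gt_eqF // ?exprn_gt0 ?A_gt0.
  rewrite ler_pdivrMr //.
  have BA : B j.+1 <= A_ j ^+ (2 * p * r) * K ^+ r.
    rewrite /B exprMn ler_pM2r ?exprn_gt0 // -exprM -mulnA (exprM (A_ j) 2).
    by apply: lerXn2r; rewrite ?nnegrE ?exprn_ge0 ?(ltW (A_gt0 _)) ?A_sq.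
  apply: le_trans (_ : 3 * 2 ^+ d * (A_ j ^+ (2 * p * r) * K ^+ r) <= _).
    by rewrite ler_pM2l // mulr_gt0.
  rewrite qE addn1 exprSr.
  have := AJ j Jj; have Ap : 0 < A_ j ^+ (2 * p * r) by rewrite exprn_gt0 // A_gt0.
  rewrite -(ler_pM2l Ap) => H; apply: le_trans (le_trans _ H) _; rewrite le_eqVlt; apply/orP; left; apply/eqP; ring.
exists pp, qq%:Z; split; last first.
  by rewrite ltr0n q0 /=; apply: le_lt_trans qtau _; lra.
apply: bigmax_lt => [|i _]; first by rewrite divr_gt0 // mulr_gt0.
apply: le_lt_trans (_ : (d%:R * t i) `^ (1 / w i) < _).
  apply: ge0_ler_powR (close i); rewrite ?nnegrE ?divr_ge0 ?(ltW (w_gt0 i)) //.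
  by rewrite mulr_ge0 // ltW.
rewrite powRM ?(ltW d0) ?(ltW (t0 i)) // /t -powRrM [w i * _]mulrC divfK ?gt_eqF // powRr1 ?(ltW et0) //.
apply: le_lt_trans (_ : d%:R ^+ r * (e' / tau) < _).
  rewrite ler_pM2r // -(powR_mulrn r (ltW d0)); apply: ler_powR => //.
  by rewrite ler_pdivrMr.
have dr0 : 0 < d%:R ^+ r :> R by rewrite exprn_gt0.
rewrite mulrA ltr_pdivrMr //.
have -> : eps / (2 * tau) * tau = eps / 2 by field; rewrite gt_eqF.
have : 0 < d%:R ^+ r * e' by rewrite mulr_gt0.
by move=> ?; lra.
Qed.

Lemma exists_singular_outside (U : nat -> set 'rV[R]_d) (rho : nat -> R) :
    (forall n, 0 < rho n <= 1) ->
    (forall n (u v : 'rV[R]_d), U n u -> U n v -> forall i, `|u 0 i - v 0 i| <= rho n) ->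
    (\sum_(0 <= n <oo) (wt (U n) (rho n) 0 root)%:E < 1)%E ->
  exists2 z, singular w z & forall n, ~ U n z.
Proof.
move=> rho01 Udiam small.
have rho0 n : 0 < rho n by case/andP: (rho01 n).
pose Phi j st := (\sum_(0 <= n <oo) (wt (U n) (rho n) j st)%:E)%E.
pose ok (js : nat * state) := lnode js.1 js.2 /\ (Phi js.1 js.2 < 1)%E.
pose nxt (u v : {js | ok js}) := [/\ (sval v).1 = (sval u).1.+1,
  `|ev (sval u).2.2 (sval v).2.1| <= 2 / A_ (sval u).1 ^+ q / T_ (sval u).1.+1 &
  forall i, `|(sval v).2.1 i - (sval u).2.1 i| <= A_ (sval u).1 ^+ b / 2 * sc (sval u).1 i].
have ok0 : ok (0%N, root) by split=> //; exact: lnode_root.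
have ex u : {v | nxt u v}.
  apply: cid; case: u => -[j st] [/= nst Phist].
  have Phifin : (Phi j st < +oo)%E by apply: lt_trans Phist _; rewrite ltry.
  have [st' [n' e' c' le']] := exists_child rho01 Udiam nst Phifin.
  have ok' : ok (j.+1, st') := conj n' (le_lt_trans le' Phist).
  by exists (exist _ _ ok').
have [f [f0 fS]] := dependent_choice ex (exist _ _ ok0).
have fj j : (sval (f j)).1 = j.
  by elim: j => [|j IH]; [rewrite f0|have [-> _ _] := fS j; rewrite IH].
pose st j := (sval (f j)).2.
have nst j : lnode j (st j) by have [] := svalP (f j); rewrite fj.
have Phist j : (Phi j (st j) < 1)%E by have [] := svalP (f j); rewrite fj.
have est j : `|ev (st j).2 (st j.+1).1| <= 2 / A_ j ^+ q / T_ j.+1.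
  by have [_ + _] := fS j; rewrite fj.
have cst j i : `|(st j.+1).1 i - (st j).1 i| <= A_ j ^+ b / 2 * sc j i.
  by have [_ _] := fS j; rewrite fj.
have /choice[z zP] (i : 'I_d) : exists y, forall j, `|y - (st j).1 i| <= A_ j ^+ b * sc j i.
  apply: (@nested_limit R (fun j => (st j).1 i) (fun j => A_ j ^+ b * sc j i)) => j.
    by apply: le_trans (cst j i) _; rewrite mulrAC.
  by apply: le_trans (sc_nest j i) _; rewrite mulrAC.
pose x : 'rV[R]_d := \row_i z i.
have bst j : bx j (st j) x by move=> i; rewrite mxE.
exists x; first exact: singular_limit nst est bst.
move=> n Ux; have [j potj] := pot_eq1 (rho0 n).
have := Phist j; apply/negP; rewrite -leNgt.
have wj : wt (U n) (rho n) j (st j) = 1.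
  by rewrite /wt potj (_ : meets _ _ _) //; apply/asboolP; exists x.
rewrite -[leLHS]/(1%:E) -wj /Phi (@nneseriesD1 R _ n xpredT) //.
  rewrite leeDl //; apply: nneseries_ge0 => i _ _; rewrite lee_fin wt_ge0 //.
by move=> i _; rewrite lee_fin wt_ge0.
Qed.

Lemma pot0_le rho : 0 < rho -> rho <= 1 ->
  pot 0 rho <= kap `^ (1 + eta) * rho `^ (d%:R - (1 + del) * (al + eta)).
Proof.
move=> rho0 rho1; have dl0 : 0 < 1 + del by rewrite addr_gt0.
have sc0 i : sc 0 i = 1 by rewrite /sc /hh powR1 mulr1 invr1.
have mn : Num.min 1 rho = rho by apply/min_idPr.
have mx e : 0 <= e -> Num.max 1 (kap * rho `^ (- e)) = kap * rho `^ (- e).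
  move=> e0; apply/max_idPr; rewrite mulr_ege1 // -(powRr0 rho).
  by apply: ger_powR; rewrite ?rho0 // oppr_le0.
have x0 : 0 <= (1 + del) * al by apply: mulr_ge0; apply: ltW.
rewrite /pot /= !divr1 !mx ?(ltW dl0) ?x0 //.
rewrite (eq_bigr (fun=> rho)); last by move=> i _; rewrite sc0 divr1 mn.
rewrite prodr_const card_ord powRM ?powR_ge0 ?(ltW kap0) //.
have rne : rho != 0 by rewrite gt_eqF.
rewrite powRD ?(gt_eqF kap0) ?implybT // powRr1 ?(ltW kap0) //.
have -> : d%:R - (1 + del) * (al + eta) = d%:R + - ((1 + del) * al) + - (1 + del) * eta by ring.
rewrite !powRD ?rne ?implybT // powR_mulrn ?(ltW rho0) // (powRrM rho).
by rewrite le_eqVlt; apply/orP; left; apply/eqP; ring.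
Qed.

Lemma singular_outside (U : nat -> set 'rV[R]_d) (rho : nat -> R) (s : R) :
    (forall n, 0 < rho n <= 1) ->
    (forall n (u v : 'rV[R]_d), U n u -> U n v -> forall i, `|u 0 i - v 0 i| <= rho n) ->
    s <= d%:R - (1 + del) * (al + eta) ->
    (\sum_(0 <= n <oo) (rho n `^ s)%:E < (kap `^ (- (1 + eta)))%:E)%E ->
  exists2 z, singular w z & forall n, ~ U n z.
Proof.
move=> rho01 Udiam sle small; apply: (exists_singular_outside rho01 Udiam).
have K0 : 0 < kap `^ (1 + eta) by rewrite powR_gt0.
apply: (@le_lt_trans _ _ (\sum_(0 <= n <oo) ((kap `^ (1 + eta))%:E * (rho n `^ s)%:E))%E).
  apply: lee_nneseries => [n _ _|n _].
    by rewrite lee_fin wt_ge0 //; case/andP: (rho01 n).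
  have /andP[r0 r1] := rho01 n; rewrite -EFinM lee_fin /wt.
  case: ifP => _; last by rewrite mulr_ge0 ?powR_ge0.
  apply: le_trans (pot0_le r0 r1) _; rewrite ler_pM2l //.
  by apply: ger_powR; rewrite ?r0.
rewrite nneseriesZl; last by move=> n _; rewrite lee_fin powR_ge0.
have -> : 1%E = ((kap `^ (1 + eta))%:E * (kap `^ (- (1 + eta)))%:E)%E :> \bar R.
  by rewrite -EFinM powRN divff // gt_eqF.
by rewrite lte_pmul2l.
Qed.

End Levels.

(** * Choice of the constants *)

Section Constants.
Variable R : realType.

Lemma all_lt_nat (s : seq R) : exists a : nat, forall u, u \in s -> u < a%:R.
Proof.
exists (Num.truncn (\sum_(u <- s) `|u|)).+1 => u us.
have S0 : 0 <= \sum_(u <- s) `|u| by apply: sumr_ge0.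
have [_ S1] := truncn_bounds S0; rewrite -natr1; apply: le_lt_trans S1.
rewrite (big_rem u us) /=; apply: le_trans (ler_norm u) _.
by rewrite lerDl; apply: sumr_ge0.
Qed.

Lemma T_powR (a m j : nat) : (0 < a)%N ->
  T_ R a m j = ((a ^ m)%:R : R) `^ (j%:R * (j%:R + 1) / 2).
Proof.
move=> a0; have Q0 : 0 < (a ^ m)%:R :> R by rewrite ltr0n expn_gt0 a0.
elim: j => [|j IH]; first by rewrite /= !mul0r powRr0.
have -> : j.+1%:R * (j.+1%:R + 1) / 2 = j.+1%:R + j%:R * (j%:R + 1) / 2 :> R.
  by rewrite -natr1; field.
rewrite powRD ?(gt_eqF Q0) ?implybT // -IH powR_mulrn ?(ltW Q0) //=.
by rewrite /A_ !natrX -!exprM mulnC.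
Qed.

(** With [Q = a ^ m] the left side is [Q ^+ j.+1], while the exponent of [T_] is quadratic in [j];
    [kap] covers the finitely many levels where the linear exponent still wins. *)
Lemma subpolynomial (a m : nat) (del : R) : (0 < a)%N -> 0 < del ->
  exists kap, 1 <= kap /\ forall j, A_ R a j ^+ m <= kap * T_ R a m j `^ del.
Proof.
move=> a0 del0; pose Q : R := (a ^ m)%:R.
have Q1 : 1 <= Q by rewrite ler1n expn_gt0 a0.
have Q0 : 0 < Q := lt_le_trans ltr01 Q1.
have d20 : 0 <= 2 / del by rewrite divr_ge0 // ltW.
have [_ N1] := truncn_bounds d20; set N := Num.truncn _ in N1.
exists (Q ^+ N.+2); split; first by rewrite exprn_ege1.
move=> j; have -> : A_ R a j ^+ m = Q ^+ j.+1.
  by rewrite /A_ /Q !natrX -!exprM mulnC.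
rewrite T_powR // -/Q -powRrM.
have [jN|Nj] := leqP j N.+1.
  apply: le_trans (_ : Q ^+ N.+2 <= _); first by rewrite ler_weXn2l.
  rewrite ler_peMr ?exprn_ge0 ?(ltW Q0) // -[leLHS](powRr0 Q); apply: ler_powR => //.
  by rewrite !mulr_ge0 ?(ltW del0) ?addr_ge0 ?invr_ge0.
apply: le_trans (_ : 1 * Q `^ (j%:R * (j%:R + 1) / 2 * del) <= _); last first.
  by rewrite ler_pM2r ?powR_gt0 // exprn_ege1.
rewrite mul1r -(powR_mulrn _ (ltW Q0)); apply: ler_powR => //; rewrite -natr1.
have jd : 2 <= j%:R * del.
  rewrite -ler_pdivrMr //; apply: le_trans (ltW N1) _.
  by rewrite natr1 ler_nat ltnW.
have : 2 * (j%:R + 1) <= j%:R * del * (j%:R + 1).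
  by rewrite ler_pM2r // ltr_wpDl.
lra.
Qed.

Lemma inv_le_nat (d : nat) (w : 'I_d -> R) : (forall i, 0 < w i) ->
  exists r : nat, forall i, 1 <= r%:R * w i.
Proof.
move=> w0; have [r rP] := all_lt_nat [seq (w i)^-1 | i <- enum 'I_d].
exists r => i; rewrite -ler_pdivrMr // div1r; apply/ltW/rP/mapP.
by exists i; rewrite ?mem_enum.
Qed.

End Constants.

(** The order of the choices matters: [r] and all exponents up to [c] depend only on [d] and [w];
    [m] follows, large against [c / gap]; [a] is taken after [m], and [kap] after [a] and [del]. The
    errors [eta], [del * al] and [del * eta] each cost at most [gap / 4]. *)
Lemma Sing_not_covered (R : realType) (d : nat) (i0 i2 : 'I_d) (w : 'I_d -> R) (s : R) :
    i2 != i0 -> (forall i, 0 < w i) -> \sum_i w i = 1 ->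
    s < d%:R - 1 / (1 + w i0) ->
  exists2 e : R, 0 < e & forall (U : nat -> set 'rV[R]_d) (rho : nat -> R),
    (forall n, 0 < rho n <= 1) ->
    (forall n (u v : 'rV[R]_d), U n u -> U n v -> forall i, `|u 0 i - v 0 i| <= rho n) ->
    (\sum_(0 <= n <oo) (rho n `^ s)%:E < e%:E)%E ->
    exists2 z, singular w z & forall n, ~ U n z.
Proof.
move=> i20 w0 w1 sD; pose al : R := 1 / (1 + w i0); pose gap := d%:R - al - s.
have gap0 : 0 < gap by rewrite subr_gt0 ltrBrDr -ltrBrDl in sD *; rewrite /gap /al; lra.
have al0 : 0 <= al by rewrite divr_ge0 // addr_ge0 // ltW.
have al1 : al <= 1 by rewrite ler_pdivrMr ?addr_gt0 // mul1r lerDl ltW.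
have [r rw] := inv_le_nat w0.
pose p := (cov_exp d + 2)%N; pose q := (2 * p * r + 1)%N.
pose k2 := (cov_exp d + 2 * p + q + 1)%N; pose k := (k2 + 2 * p + 1)%N.
pose j0 := (p + k * d + 1)%N; pose y := (j0 + k * d + 1)%N.
pose b := (2 * p + 1)%N; pose mu := (3 * p + q + k * d.+1 + y + b + 2)%N.
pose c := ((2 * b + 2 * p + 2) * d + p + q + k2 * d.+1 + 2)%N.
have cg0 : 0 <= 4 * c%:R / gap by rewrite divr_ge0 ?mulr_ge0 // ltW.
have [_ n1] := truncn_bounds cg0; set n := Num.truncn _ in n1.
pose m := (d + mu * r + n).+1.
have md : (d < m)%N by rewrite /m ltnS -addnA leq_addr.
have mmu : (mu * r <= m)%N by rewrite /m leqW // addnAC leq_addl.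
have [a aP] := all_lt_nat (consts R d p m).
have a0 : (0 < a)%N.
  rewrite -(ltr_nat R); apply: lt_trans (aP 147 _); first by rewrite ltr0n.
  by rewrite inE eqxx.
pose del := Num.min 1 (gap / 4).
have del0 : 0 < del by rewrite lt_min ltr01 divr_gt0.
have [kap [kap1 kapC]] := subpolynomial m a0 del0.
pose eta : R := c%:R / m%:R.
have m0 : 0 < m%:R :> R by rewrite ltr0n.
have eta0 : 0 <= eta by rewrite divr_ge0.
have etag : eta <= gap / 4.
  rewrite ler_pdivrMr // -ler_pdivrMl ?divr_gt0 // invf_div mulrAC.
  apply: le_trans (ltW n1) _; rewrite natr1 ler_nat /m ltnS leq_addl //.
exists (kap `^ (- (1 + eta))); first by rewrite powR_gt0 // (lt_le_trans ltr01).
move=> U rho rho01 Udiam small.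
apply: (singular_outside i20 w0 w1 rw (erefl p) (erefl k2) (erefl k) (erefl j0) (erefl y)
  (erefl b) (erefl mu) (erefl c) md mmu aP del0 kap1 kapC (erefl q) rho01 Udiam _ small).
rewrite -/al -/eta.
have d1 : del <= 1 by rewrite ge_min lexx.
have d2 : del <= gap / 4 by rewrite ge_min lexx orbT.
have e1 : del * al <= gap / 4 by rewrite -[leRHS]mulr1; apply: ler_pM => //; apply: ltW.
have e2 : del * eta <= gap / 4 by rewrite -[leRHS]mul1r; apply: ler_pM => //; apply: ltW.
rewrite mulrDr !mulrDl !mul1r; move: etag e1 e2 gap0; rewrite /gap; lra.
Qed.

Local Open Scope classical_set_scope.

(** * From covers to the Hausdorff dimension *)

Lemma coord_le_dist (R : realType) (d : nat) (u v : 'rV[R]_d) i :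
  `|u 0 i - v 0 i| <= euclidean_dist u v.
Proof.
rewrite /euclidean_dist -sqrtr_sqr; apply: ler_wsqrtr.
rewrite (bigD1 i) //= lerDl; apply: sumr_ge0 => j _; exact: sqr_ge0.
Qed.

Theorem theorem1p1 (R : realType) (d : nat) (hd : (2 <= d)%N) (w : 'I_d -> R)
    (w_gt0 : forall i : 'I_d, 0 < w i)
    (w_sum1 : \sum_(i < d) w i = 1)
    (w_noninc : forall i j : 'I_d, (i <= j)%N -> w j <= w i) :
  ((d%:R - 1 / (1 + w (Ordinal (ltnW hd))))%:E <= hausdorff_dim (Sing w))%E.
Proof.
set i0 := Ordinal (ltnW hd); pose i2 : 'I_d := Ordinal hd.
have i20 : i2 != i0 by [].
set D := _ - _; apply: le_ereal_inf_tmp => _ [s [s0 Hs] <-]; rewrite lee_fin leNgt.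
(* Strictly above [s], so positive even for [s = 0]; sets of diameter 0 then have [s1]-power 0. *)
apply/negP => sD; pose s1 := (s + D) / 2.
have ss1 : s < s1 by rewrite /s1; lra.
have s1D : s1 < D by rewrite /s1; lra.
have s10 : 0 < s1 by apply: le_lt_trans ss1.
have [e e0 cov] := Sing_not_covered i20 w_gt0 w_sum1 s1D.
(* Used twice, for the cover and for its enlargement: the total stays below [e] and each enlarged
   [rho k] below 1. *)
pose th := Num.min (e / 3) (1 / 3).
have th0 : 0 < th by rewrite lt_min !divr_gt0.
have [U [SU Udel] Usum] : exists2 U : (set 'rV[R]_d)^nat, delta_cover (1 / 2) (Sing w) U &
    (\sum_(0 <= k <oo) diam_pow s (U k) < th%:E)%E.
  have : (hausdorff_premeasure s (1 / 2) (Sing w) <= 0)%E.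
    by rewrite -Hs; apply: ereal_sup_ubound; exists (1 / 2) => //=; rewrite divr_gt0.
  move=> /le_lt_trans/(_ (_ : (0 < th%:E)%E)); rewrite lte_fin => /(_ th0) /ereal_inf_lt.
  by move=> [_ [U UC <-] lt]; exists U.
(* The maximum with 0 replaces the diameter [-oo] of the empty set. *)
pose dm k : R := fine (maxe 0%E (diam (U k))).
have dmP k : U k !=set0 -> diam (U k) = (dm k)%:E /\ 0 <= dm k.
  move=> [x Ux]; have d0 : (0 <= diam (U k))%E.
    have -> : 0%E = (euclidean_dist x x)%:E :> \bar R.
      by rewrite /euclidean_dist big1 ?sqrtr0 // => i _; rewrite subrr expr0n.
    by apply: ereal_sup_ubound; exists (x, x).
  have dfin : diam (U k) \is a fin_num.
    by rewrite ge0_fin_numE //; apply: le_lt_trans (Udel k) _; rewrite ltry.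
  by rewrite /dm max_r // fineK // fine_ge0.
have dm1 k : U k !=set0 -> dm k <= 1 / 2.
  by move=> /dmP[dE _]; have := Udel k; rewrite dE lee_fin.
have dm_empty k : U k = set0 -> dm k = 0.
  move=> Uk; rewrite /dm (_ : diam (U k) = -oo%E) ?max_l ?leNye //.
  rewrite /diam Uk (_ : [set _ | _ in _] = set0) ?ereal_sup0 //.
  by apply/seteqP; split=> // x [[? ?] []].
have dm0 k : 0 <= dm k.
  have [/dm_empty->//|/set0P/dmP[]//] := eqVneq (U k) set0.
have dmle k : ((dm k `^ s1)%:E <= diam_pow s (U k))%E.
  rewrite /diam_pow; have [/dm_empty->|/set0P Un] := eqVneq (U k) set0.
    by rewrite powR0 // gt_eqF.
  have [-> _] := dmP k Un; rewrite poweR_EFin lee_fin.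
  have [->|dmn0] := eqVneq (dm k) 0; first by rewrite powR0 ?powR_ge0 // gt_eqF.
  apply: ger_powR; last exact: ltW.
  by rewrite lt_neqAle eq_sym dmn0 dm0 (le_trans (dm1 k Un)) //; lra.
have dp0 k : (0 <= diam_pow s (U k))%E.
  by rewrite /diam_pow; case: ifP => // _; apply: poweR_ge0.
(* A summable enlargement: the potential needs positive diameters, but sets of the cover may be
   empty or single points. *)
pose tk (k : nat) : R := th / (2 ^ k.+1)%:R.
have tk0 k : 0 < tk k by rewrite divr_gt0 // ltr0n expn_gt0.
have tk1 k : tk k <= th by rewrite ler_pdivrMr ?ltr0n ?expn_gt0 // ler_peMr ?(ltW th0) // ler1n expn_gt0.
have th3 : th <= 1 / 3 by rewrite ge_min lexx orbT.
have the : th <= e / 3 by rewrite ge_min lexx.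
pose rho k := (dm k `^ s1 + tk k) `^ s1^-1.
have b0 k : 0 < dm k `^ s1 + tk k by rewrite ltr_wpDl ?powR_ge0.
have rhoE k : rho k `^ s1 = dm k `^ s1 + tk k.
  by rewrite /rho -powRrM mulVf ?powRr1 ?(ltW (b0 k)) // gt_eqF.
have dmth k : dm k `^ s1 <= th.
  rewrite -lee_fin; apply: le_trans (dmle k) _; apply: le_trans (ltW Usum).
  by rewrite (@nneseriesD1 R _ k xpredT) // leeDl // nneseries_ge0.
have is1 : 0 < s1^-1 by rewrite invr_gt0.
have rho01 k : 0 < rho k <= 1.
  rewrite powR_gt0 //=; have -> : 1 = 1 `^ s1^-1 :> R by rewrite powR1.
  apply: ge0_ler_powR; rewrite ?nnegrE ?(ltW is1) ?(ltW (b0 k)) //.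
  by have := dmth k; have := tk1 k; lra.
have Udiam n (u v : 'rV[R]_d) : U n u -> U n v -> forall i, `|u 0 i - v 0 i| <= rho n.
  move=> Uu Uv i; apply: le_trans (coord_le_dist u v i) _.
  have [dE d0] : diam (U n) = (dm n)%:E /\ 0 <= dm n by apply: dmP; exists u.
  apply: le_trans (_ : dm n <= _).
    by rewrite -lee_fin -dE; apply: ereal_sup_ubound; exists (u, v).
  have {1}-> : dm n = (dm n `^ s1) `^ s1^-1.
    by rewrite -powRrM mulfV ?powRr1 // gt_eqF.
  apply: ge0_ler_powR; rewrite ?nnegrE ?(ltW is1) ?powR_ge0 ?(ltW (b0 n)) //.
  by rewrite lerDl ltW.
have [z Sz Uz] : exists2 z, singular w z & forall n, ~ U n z.
  apply: cov rho01 Udiam _.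
  apply: (@le_lt_trans _ _ (\sum_(0 <= k <oo) (diam_pow s (U k) + (tk k)%:E))%E).
    apply: lee_nneseries => [k _ _|k _]; first by rewrite lee_fin powR_ge0.
    by rewrite rhoE EFinD; apply: leeD.
  apply: le_lt_trans (epsilon_trick xpredT dp0 (ltW th0)) _.
  apply: (@lt_le_trans _ _ (th%:E + th%:E)%E); first by rewrite lteD2rE.
  by rewrite -EFinD lee_fin; lra.
by have [n _ Unz] := SU z Sz; exact: Uz Unz.
Qed.
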